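(* Let $\Sigma$ be a closed connected spacelike $2$-surface in a spacetime $N$ such that $\Sigma$ has positive Gaussian curvature and its mean curvature vector $H$ in $N$ is spacelike. Let $X$ be an isometric embedding of $\Sigma$ into $\mathbb{R}^3=\{(0,x)\in\mathbb{R}^{3,1}\}$, and let $T_0=(\sqrt{1+|a|^2},a^1,a^2,a^3)$, $a=(a^1,a^2,a^3)\in\mathbb{R}^3$, be an arbitrary constant future timelike unit vector in $\mathbb{R}^{3,1}$. Let $E(\Sigma,X,T_0)$ be the Wang-Yau quasilocal energy, $\mathfrak{m}_{LY}(\Sigma)$ the Liu-Yau mass, $\mathcal{V}=\mathcal{V}(\Sigma,X)=(\mathcal{V}_1,\mathcal{V}_2,\mathcal{V}_3)\in\mathbb{R}^3$ and $\mathcal{W}=\mathcal{W}(\Sigma,X)=(\mathfrak{m}_{LY}(\Sigma),\mathcal{V})\in\mathbb{R}^{3,1}$, all as defined in the context. Then the following are true. (i) One has $$ \begin{aligned} -\langle T_0,\mathcal{W}\rangle + C\sqrt{1+|a|^2} &= \sqrt{1+|a|^2}\,\bigl(\mathfrak{m}_{LY}(\Sigma)+C\bigr)-\sum_{i=1}^3 a^i\mathcal{V}_i \\ &\ge E(\Sigma,X,T_0) \\ &\ge \sqrt{1+|a|^2}\,\mathfrak{m}_{LY}(\Sigma)-\sum_{i=1}^3 a^i\mathcal{V}_i = -\langle T_0,\mathcal{W}\rangle, \end{aligned} $$ where $C$ is the constant $$ C=\sup_{\Sigma}\left|\frac{|H_0|^2}{|H|^2}+\frac{|H_0|}{|H|}-2\right|\cdot\frac{1}{8\pi}\int_\Sigma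 \bigl||H_0|-|H|\bigr|\,dv_\Sigma . $$ Moreover, the equality $E(\Sigma,X,T_0)=-\langle T_0,\mathcal{W}\rangle$ holds if and only if $T_0=(1,0,0,0)$ or $|H|=|H_0|$ everywhere on $\Sigma$. In this second case (i.e. if $|H|=|H_0|$ everywhere on $\Sigma$), $E(\Sigma,X,T_0)=-\sum_{i=1}^3 a^i\mathcal{V}_i$ for all $T_0$. (ii) If $\mathcal{W}$ is future timelike, then $$ \sqrt{-\langle\mathcal{W},\mathcal{W}\rangle}+C\,\frac{\mathfrak{m}_{LY}(\Sigma)}{\sqrt{-\langle\mathcal{W},\mathcal{W}\rangle}}\ \ge\ E(\Sigma,X,T_0^* )\ \ge\ \inf_{T_0}E(\Sigma,X,T_0)\ \ge\ \sqrt{-\langle\mathcal{W},\mathcal{W}\rangle}, $$ where $T_0^*=\mathcal{W}/\sqrt{-\langle\mathcal{W},\mathcal{W}\rangle}$, $C$ is the constant in (i), and the infimum is over all constant future timelike unit vectors $T_0$ in $\mathbb{R}^{3,1}$. (iii) The vector $-\mathcal{V}$ is the gradient at $a=(0,0,0)$ of the function $E(a)=E(\Sigma,X,T_0)$ of $a\in\mathbb{R}^3$, where $T_0=(\sqrt{1+|a|^2},a)$. If in addition $\mathfrak{m}_{LY}(\Sigma)\ge 0$, then $\mathcal{V}=0$ if and only if $$\inf_{T_0}E(\Sigma,X,T_0)=\mathfrak{m}_{LY}(\Sigma).$$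
   Context: A spacetime $N$ is a $4$-dimensional time-oriented Lorentzian manifold with signature $(-,+,+,+)$ and Levi-Civita connection $\nabla^N$; $\mathbb{R}^{3,1}$ is Minkowski spacetime with inner product $\langle\cdot,\cdot\rangle$ of signature $(-,+,+,+)$, first coordinate being time. All objects are smooth. Mean curvature vectors are traces (not averages) of the vector-valued second fundamental form. Let $\Sigma\subset N$ be a spacelike $2$-surface with spacelike mean curvature vector $H$, and $|H|=\sqrt{\langle H,H\rangle}>0$. Let $e_3,e_4$ be orthonormal normal vectors along $\Sigma$ with $e_3$ spacelike, $\langle e_3,H\rangle<0$, and $e_4$ future timelike, so that $H=\langle H,e_3\rangle e_3-\langle H,e_4\rangle e_4$. Define $J=\langle H,e_4\rangle e_3-\langle H,e_3\rangle e_4$ (future timelike normal field dual to $H$ along the light cone of the normal bundle). For an isometric embedding $X:\Sigma\to\mathbb{R}^{3,1}$ with spacelike mean curvature vector $H_0$, define $|H_0|=\sqrt{\langle H_0,H_0\rangle}$ and $J_0$ in the same way from $H_0$. (When $\Sigma$ has positive Gaussian curvature and $X(\Sigma)\subset\mathbb{R}^3=\{(0,x)\in\mathbb{R}^{3,1}\}$, $H_0$ is spacelike and $|H_0|=k_0$, the mean curvature of $X(\Sigma)$ in $\mathbb{R}^3$ with respect to the outward unit normal.) Wang-Yau quasilocal energy: for a constant future timelike unit vector $T_0\in\mathbb{R}^{3,1}$ put $\tau=-\langle X,T_0\rangle$, with $\nabla\tau,\Delta\tau$ the intrinsic gradient and Laplacian on $\Sigma$. Then $$ \begin{aligned} E(\Sigma,X,T_0)=\frac{1}{8\pi}\int_\Sigma\Big\{&\sqrt{|H_0|^2(1+|\nabla\tau|^2)+(\Delta\tau)^2}-\sqrt{|H|^2(1+|\nabla\tau|^2)+(\Delta\tau)^2}\\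 &-\Delta\tau\Big[\sinh^{-1}\Big(\tfrac{\Delta\tau}{\sqrt{1+|\nabla\tau|^2}\,|H_0|}\Big)-\sinh^{-1}\Big(\tfrac{\Delta\tau}{\sqrt{1+|\nabla\tau|^2}\,|H|}\Big)\Big]\\ &-\Big\langle\nabla^{\mathbb{R}^{3,1}}_{\nabla\tau}\tfrac{J_0}{|H_0|},\tfrac{H_0}{|H_0|}\Big\rangle+\Big\langle\nabla^{N}_{\nabla\tau}\tfrac{J}{|H|},\tfrac{H}{|H|}\Big\rangle\Big\}\,dv_\Sigma . \end{aligned} $$ Liu-Yau mass: $\mathfrak{m}_{LY}(\Sigma)=\frac{1}{8\pi}\int_\Sigma(k_0-|H|)\,dv_\Sigma$, where $k_0$ is the mean curvature of $\Sigma$ with respect to the outward unit normal when isometrically embedded in $\mathbb{R}^3$. The vectors $\mathcal{V},\mathcal{W}$: let $\alpha_{\hat e_3}(Y)=\langle\nabla^N_Y\frac{J}{|H|},\frac{H}{|H|}\rangle$ for $Y\in T\Sigma$, a $1$-form on $\Sigma$, and let $V$ be the vector field on $\Sigma$ dual to it with respect to the induced metric. Given $X:\Sigma\hookrightarrow\mathbb{R}^3$, identify $V$ with $dX(V)$, an $\mathbb{R}^3$-valued function on $\Sigma$. Define $$\mathcal{V}(\Sigma,X)=\frac{1}{8\pi}\int_\Sigma V\,dv_\Sigma\in\mathbb{R}^3,\qquad \mathcal{W}(\Sigma,X)=(\mathfrak{m}_{LY}(\Sigma),\mathcal{V}(\Sigma,X))\in\mathbb{R}^{3,1}.$$ *)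

(* Defs.v *)
From HB Require Import structures.
From mathcomp Require Import all_boot all_order all_algebra.
From mathcomp Require Import all_classical all_reals all_analysis.
Set Implicit Arguments.
Unset Strict Implicit.
Unset Printing Implicit Defensive.
Import Order.TTheory GRing.Theory Num.Theory.
Import numFieldNormedType.Exports.
Local Open Scope classical_set_scope.
Local Open Scope ring_scope.

Definition sinh {R : realType} (x : R) : R := (expR x - expR (- x)) / 2.

Definition asinh {R : realType} (x : R) : R := ln (x + Num.sqrt (x ^+ 2 + 1)).

Lemma asinhK {R : realType} : cancel (@asinh R) sinh.
Proof.
move=> x; rewrite /sinh /asinh.
set s := Num.sqrt _.
have x21 : 0 < x ^+ 2 + 1 by rewrite ltr_wpDl ?sqr_ge0.
have s2 : s ^+ 2 = x ^+ 2 + 1 by rewrite sqr_sqrtr ?ltW.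
have s0 : 0 < s by rewrite sqrtr_gt0.
have xs : `|x| < s.
  by rewrite -(ltr_pXn2r (n := 2)) ?nnegrE ?normr_ge0 ?ltW // real_normK ?num_real // s2 ltrDl.
have y0 : 0 < x + s.
  by have := ler_normr (-x) (- x); rewrite lexx normrN /= => h;
     rewrite -ltrBlDl sub0r (le_lt_trans h).
rewrite expRN lnK ?posrE //.
have e : (x + s) * (s - x) = 1 by rewrite mulrC [x + s]addrC -subr_sqr s2 addrAC subrr add0r.
have -> : (x + s)^-1 = s - x.
  by apply: (mulfI (lt0r_neq0 y0)); rewrite e divff ?lt0r_neq0.
by rewrite opprB addrCA addrK -mulr2n -[x *+ 2]mulr_natr mulfK ?pnatr_eq0.
Qed.

Section SmoothFunctions.
Context {R : realType}.

Definition partial n (W : normedModType R) (i : 'I_n) (f : 'rV[R]_n -> W) :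
  'rV[R]_n -> W := fun u => 'D_(delta_mx 0 i) f u.

Fixpoint Ck_on (k : nat) n (W : normedModType R) (U : set 'rV[R]_n)
    (f : 'rV[R]_n -> W) : Prop :=
  if k is k'.+1 then
    (forall u, U u -> differentiable f u) /\
    (forall i, Ck_on k' U (partial i f))
  else forall u, U u -> {for u, continuous f}.

Definition smooth_on n (W : normedModType R) (U : set 'rV[R]_n)
  (f : 'rV[R]_n -> W) : Prop := forall k, Ck_on k U f.

Lemma smooth_on_cst n (W : normedModType R) (U : set 'rV[R]_n) (w : W) :
  smooth_on U (fun=> w).
Proof.
move=> k; elim: k w => [|k IH] w /=; first by move=> u _; exact: cst_continuous.
split=> [u _|i]; first exact: differentiable_cst.
rewrite (_ : partial i _ = fun=> 0); first exact: IH.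
by apply/funext => u; rewrite /partial derive_cst.
Qed.

Lemma smooth_on_id n (U : set 'rV[R]_n) : smooth_on U (fun u => u).
Proof.
case=> [u _|k /=]; first exact: cvg_id.
split=> [u _|i]; first by apply: ex_diff.
rewrite (_ : partial i _ = fun=> delta_mx 0 i); first exact: smooth_on_cst.
by apply/funext => u; rewrite /partial derive_id.
Qed.

End SmoothFunctions.

Section Manifolds.
Context {R : realType}.

(** [param c] is the inverse of [coord c]; its values off the image of the
    domain are irrelevant. *)
Record chart (n : nat) (M : topologicalType) := Chart {
  dom : set M;
  coord : M -> 'rV[R]_n;
  param : 'rV[R]_n -> M;
  dom_open : open dom;
  image_open : open (coord @` dom);
  coordK : forall p, dom p -> param (coord p) = p;
  coord_continuous : forall p, dom p -> {for p, continuous coord};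
  param_continuous :
    forall u, (coord @` dom) u -> {for u, continuous param} }.

Definition transition n (M : topologicalType) (c c' : chart n M) :
  'rV[R]_n -> 'rV[R]_n := coord c' \o param c.

(** Manifolds have no boundary; they are pointed, hence nonempty. *)
Record manifold (n : nat) := Manifold {
  carrier :> ptopologicalType;
  atlas : set (chart n carrier);
  chart_at : carrier -> chart n carrier;
  chart_at_atlas : forall p, atlas (chart_at p);
  chart_at_dom : forall p, dom (chart_at p) p;
  manifold_hausdorff : hausdorff_space carrier;
  manifold_second_countable : @second_countable carrier;
  transition_smooth : forall c c', atlas c -> atlas c' ->
    smooth_on (coord c @` (dom c `&` dom c')) (transition c c') }.

(** The partial derivative of [f] along the [i]-th coordinate of [c]. *)
Definition pd n (M : manifold n) (W : normedModType R) (c : chart n M)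
  (i : 'I_n) (f : M -> W) (p : M) : W := partial i (f \o param c) (coord c p).

Definition smooth_fun n (M : manifold n) (W : normedModType R) (f : M -> W) :=
  forall c, atlas c -> smooth_on (coord c @` dom c) (f \o param c).

Definition smooth_map m n (S : manifold m) (N : manifold n) (F : S -> N) :=
  continuous F /\
  forall c d, atlas c -> atlas d ->
    smooth_on (coord c @` (dom c `&` F @^-1` dom d)) (coord d \o F \o param c).

(** A tangent vector of [N] at [q] is given by its components in every chart
    around [q].  A field along [F] assigns to a chart [d] of [N] and a point
    [p] the components in [d] of a vector at [F p]; this is meaningful when [d]
    belongs to the atlas and its domain contains [F p]. *)
Definition field_along m n (S : manifold m) (N : manifold n) : Type :=
  chart n N -> S -> 'rV[R]_n.

Definition smooth_field_along m n (S : manifold m) (N : manifold n)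
    (F : S -> N) (Z : field_along S N) : Prop :=
  (forall d d' p, atlas d -> atlas d' -> dom d (F p) -> dom d' (F p) ->
     Z d' p = Z d p *m 'J (transition d d') (coord d (F p))) /\
  (forall c d, atlas c -> atlas d ->
     smooth_on (coord c @` (dom c `&` F @^-1` dom d)) (Z d \o param c)).

(** [metric_field M]: the Gram matrix of the coordinate vectors, in each
    chart. *)
Definition metric_field n (M : manifold n) : Type := chart n M -> M -> 'M[R]_n.

Definition pairing n (G : 'M[R]_n) (u v : 'rV[R]_n) : R := (u *m G *m v^T) 0 0.

(** [christoffel g c p k i j] is Gamma^k_ij, for the Levi-Civita connection. *)
Definition christoffel n (M : manifold n) (g : metric_field M) (c : chart n M)
    (p : M) (k i j : 'I_n) : R :=
  2^-1 * \sum_l invmx (g c p) k l *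
    (pd c i (fun q => g c q j l) p + pd c j (fun q => g c q i l) p
     - pd c l (fun q => g c q i j) p).

Definition eta : 'M[R]_(1 + 3) := block_mx (-1)%:M 0 0 1%:M.

Record spacetime := Spacetime {
  st_manifold :> manifold 4;
  lorentz : metric_field st_manifold;
  time_field : field_along st_manifold st_manifold;
  lorentz_sym : forall d q, atlas d -> dom d q ->
    (lorentz d q)^T = lorentz d q;
  lorentz_signature : forall d q, atlas d -> dom d q ->
    exists P : 'M[R]_4, P \in unitmx /\ P *m lorentz d q *m P^T = eta;
  lorentz_tensor : forall d d' q, atlas d -> atlas d' -> dom d q -> dom d' q ->
    lorentz d q = 'J (transition d d') (coord d q) *m lorentz d' q
                  *m ('J (transition d d') (coord d q))^T;
  lorentz_smooth : forall d, atlas d ->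
    smooth_on (coord d @` dom d) (lorentz d \o param d);
  time_field_smooth : smooth_field_along id time_field;
  time_field_timelike : forall d q, atlas d -> dom d q ->
    pairing (lorentz d q) (time_field d q) (time_field d q) < 0 }.

Definition future_timelike (N : spacetime) (d : chart 4 N) (q : N)
    (v : 'rV[R]_4) : Prop :=
  pairing (lorentz d q) v v < 0 /\ pairing (lorentz d q) v (time_field d q) < 0.

Section IntrinsicGeometry.
Variables (S : manifold 2) (g : metric_field S).

(** [<R(d_0, d_1) d_1, d_0> / det g]. *)
Definition gauss_curvature (p : S) : R :=
  let c := chart_at p in
  let Gam q := christoffel g c q in
  (\sum_l g c p l 0 *
    (pd c 0 (fun q => Gam q l 1 1) p - pd c 1 (fun q => Gam q l 0 1) p
     + \sum_m (Gam p m 1 1 * Gam p l 0 m - Gam p m 0 1 * Gam p l 1 m)))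
  / \det (g c p).

(** The components in [chart_at p] of the vector at [p] dual to a covector. *)
Definition sharp (p : S) (w : 'rV[R]_2) : 'rV[R]_2 :=
  w *m invmx (g (chart_at p) p).

Definition gradient (f : S -> R) (p : S) : 'rV[R]_2 :=
  sharp p (\row_i pd (chart_at p) i f p).

Definition laplacian (f : S -> R) (p : S) : R :=
  let c := chart_at p in
  \sum_i \sum_j invmx (g c p) i j *
    (pd c i (pd c j f) p - \sum_k christoffel g c p k i j * pd c k f p).

Definition borel : Type := g_sigma_algebraType (@open S).
HB.instance Definition _ := Measurable.on borel.

Definition row2 (z : R * R) : 'rV[R]_2 := \row_i (if i == 0 then z.1 else z.2).

(** The Borel measure with density [sqrt (det g)] in every chart; these
    conditions determine it. *)
Definition area_measure (mu : {measure set borel -> \bar R}) : Prop :=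
  forall c, atlas c -> forall A : set borel, measurable A -> A `<=` dom c ->
  mu A = (\int[(@lebesgue_measure R) \x (@lebesgue_measure R)]_(
            z in [set z | (coord c @` A) (row2 z)])
          (Num.sqrt (\det (g c (param c (row2 z)))))%:E)%E.

End IntrinsicGeometry.

Section SurfaceInSpacetime.
Variables (N : spacetime) (S : manifold 2) (F : S -> N).

(** The inner product of two fields along [F]. *)
Definition inner (Z W : field_along S N) (p : S) : R :=
  let d := chart_at (F p) in pairing (lorentz d (F p)) (Z d p) (W d p).

(** The coordinate vector [dF(d_i)] for the [i]-th coordinate of [c]. *)
Definition push (c : chart 2 S) (i : 'I_2) : field_along S N :=
  fun d p => pd c i (coord d \o F) p.

Definition induced_metric : metric_field S :=
  fun c p => \matrix_(i, j) inner (push c i) (push c j) p.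

(** Since the surfaces considered are compact, an injective immersion is an
    embedding. *)
Definition embedding : Prop :=
  [/\ smooth_map F, injective F &
      forall c d p, atlas c -> atlas d -> dom c p -> dom d (F p) ->
        row_free (\matrix_i push c i d p)].

Definition spacelike : Prop :=
  forall c p, atlas c -> dom c p -> forall v : 'rV[R]_2, v != 0 ->
    0 < pairing (induced_metric c p) v v.

(** The covariant derivative along the [i]-th coordinate of [c] of a field
    along [F], for the Levi-Civita connection of [N]. *)
Definition cov (c : chart 2 S) (i : 'I_2) (Z : field_along S N) :
    field_along S N := fun d p =>
  pd c i (Z d) p +
  \row_k \sum_l \sum_m christoffel (@lorentz N) d (F p) k l m *
    push c i d p 0 l * Z d p 0 m.

Definition normal_part (c : chart 2 S) (Z : field_along S N) :
    field_along S N := fun d p =>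
  Z d p - \sum_i \sum_j
    (invmx (induced_metric c p) i j * inner Z (push c i) p) *: push c j d p.

(** The trace of the second fundamental form, whose value on [d_i, d_j] is the
    normal part of the covariant derivative of [dF(d_j)] along [d_i]. *)
Definition mean_curvature : field_along S N := fun d p =>
  let c := chart_at p in
  \sum_i \sum_j invmx (induced_metric c p) i j *:
    normal_part c (cov c i (push c j)) d p.

Definition spacelike_mean_curvature : Prop :=
  forall p, 0 < inner mean_curvature mean_curvature p.

Definition norm_H (p : S) : R := Num.sqrt (inner mean_curvature mean_curvature p).

Definition is_normal (Z : field_along S N) : Prop :=
  forall c p, atlas c -> dom c p -> forall i, inner Z (push c i) p = 0.

Record adapted_frame (e3 e4 : field_along S N) : Prop := {
  e3_smooth : smooth_field_along F e3;
  e4_smooth : smooth_field_along F e4;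
  e3_normal : is_normal e3;
  e4_normal : is_normal e4;
  e3_unit : forall p, inner e3 e3 p = 1;
  e4_unit : forall p, inner e4 e4 p = -1;
  e34_orthogonal : forall p, inner e3 e4 p = 0;
  e3_mean_curvature : forall p, inner e3 mean_curvature p < 0;
  e4_future : forall p, let d := chart_at (F p) in
    future_timelike d (F p) (e4 d p) }.

Variables e3 e4 : field_along S N.

Definition dual_mean_curvature : field_along S N := fun d p =>
  inner mean_curvature e4 p *: e3 d p - inner mean_curvature e3 p *: e4 d p.

Definition normalized (Z : field_along S N) : field_along S N :=
  fun d p => (norm_H p)^-1 *: Z d p.

(** The value at [p] of the connection 1-form [<nabla_Y (J/|H|), H/|H|>] on the
    vector with components [Y] in [chart_at p]. *)
Definition conn_form (p : S) (Y : 'rV[R]_2) : R :=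
  \sum_i Y 0 i *
    inner (cov (chart_at p) i (normalized dual_mean_curvature))
          (normalized mean_curvature) p.

(** The vector field dual to [conn_form]. *)
Definition conn_vector (p : S) : 'rV[R]_2 :=
  sharp induced_metric p (\row_i conn_form p (delta_mx 0 i)).

End SurfaceInSpacetime.

Section EuclideanSpace.
Variable S : manifold 2.

Definition dot n (u v : 'rV[R]_n) : R := \sum_i u 0 i * v 0 i.

(** The points of the complement of [A] in a bounded, resp. unbounded,
    component of that complement. *)
Definition inside (A : set 'rV[R]_3) : set 'rV[R]_3 :=
  [set y | ~ A y /\ bounded_set (connected_component (~` A) y)].
Definition outside (A : set 'rV[R]_3) : set 'rV[R]_3 :=
  [set y | ~ A y /\ ~ bounded_set (connected_component (~` A) y)].

Record outward_unit_normal (Y nu : S -> 'rV[R]_3) : Prop := {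
  nu_smooth : smooth_fun nu;
  nu_unit : forall p, dot (nu p) (nu p) = 1;
  nu_normal : forall c p, atlas c -> dom c p ->
    forall i, dot (nu p) (pd c i Y p) = 0;
  nu_outward : forall p, \forall t \near 0^'+,
    inside (range Y) (Y p - t *: nu p) /\
    outside (range Y) (Y p + t *: nu p) }.

(** The trace of the second fundamental form [<D_i nu, d_j Y>], positive for
    round spheres. *)
Definition euclidean_mean_curvature (g : metric_field S) (Y nu : S -> 'rV[R]_3)
    (p : S) : R :=
  let c := chart_at p in
  \sum_i \sum_j invmx (g c p) i j * dot (pd c i nu p) (pd c j Y p).

End EuclideanSpace.

End Manifolds.

Arguments chart : clear implicits.
Arguments manifold : clear implicits.
Arguments spacetime : clear implicits.
Arguments eta : clear implicits.

Section Minkowski.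
Variable R : realType.

Section EuclideanChart.
Variable n : nat.

Lemma id_image : (fun u : 'rV[R]_n => u) @` setT = setT.
Proof. by rewrite image_id. Qed.

Lemma id_image_open : open ((fun u : 'rV[R]_n => u) @` setT).
Proof. by rewrite id_image; exact: openT. Qed.

Definition id_chart : chart R n 'rV[R]_n :=
  @Chart R n 'rV[R]_n setT id id openT id_image_open (fun _ _ => erefl)
    (fun p _ => @cvg_id _ _) (fun p _ => @cvg_id _ _).

Lemma rV_second_countable : @second_countable 'rV[R]_n.
Proof.
pose U (q : {ffun 'I_n -> rat * rat}) : set 'rV[R]_n :=
  [set v | forall i, ratr (q i).1 < v 0 i < ratr (q i).2].
exists (range U); first by apply: sub_countable (card_image_le _ _) _; exact: countableP.
split=> [_ [q _ <-]|v A].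
- rewrite openE => v Uv.
  rewrite /interior /=.
  exists (fun _ i => [set x : R | ratr (q i).1 < x < ratr (q i).2]).
    move=> i j; rewrite (ord1 i).
    have := near_in_itvoo.
    have vin : v 0 j \in `]ratr (q j).1, ratr (q j).2[ by rewrite in_itv /= Uv.
    by move/(_ R _ _ (v 0 j) vin); apply: filterS => y; rewrite in_itv.
  by move=> w wU i; exact: wU.
- move=> [P Pv PA].
  have /fin_all_exists[q qP] (i : 'I_n) : exists q : rat * rat,
      ratr q.1 < v 0 i < ratr q.2 /\
      [set x | ratr q.1 < x < ratr q.2] `<=` P 0 i.
    have /nbhs_ballP[e /= e0 eP] := Pv 0 i.
    have [r /itvP r1] := @rat_in_itvoo R (v 0 i - e) (v 0 i) ltac:(by rewrite ltrBlDr ltrDl).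
    have [s /itvP s1] := @rat_in_itvoo R (v 0 i) (v 0 i + e) ltac:(by rewrite ltrDl).
    exists (r, s) => /=; split; first by rewrite r1 s1.
    move=> x /= /andP[rx xs]; apply: eP.
    rewrite /ball /= ltr_distlC.
    by rewrite (lt_trans _ rx) ?r1 //= (lt_trans xs) ?s1.
  exists (U [ffun i => q i]).
    split; first by exists [ffun i => q i].
    by move=> i; rewrite ffunE; have [] := qP i.
  move=> w wU; apply: PA => i j; rewrite (ord1 i).
  by have [_] := qP j; apply; have := wU j; rewrite ffunE.
Qed.

Lemma id_transition (c c' : chart R n 'rV[R]_n) :
  [set id_chart] c -> [set id_chart] c' ->
  smooth_on (coord c @` (dom c `&` dom c')) (transition c c').
Proof. by move=> -> ->; exact: smooth_on_id. Qed.

Definition euclidean_manifold : manifold R n :=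
  @Manifold R n 'rV[R]_n [set id_chart] (fun=> id_chart) (fun=> erefl)
    (fun=> I) (@norm_hausdorff R _) rV_second_countable id_transition.

Lemma jacobian_id (u : 'rV[R]_n) : 'J (transition id_chart id_chart) u = 1%:M.
Proof.
apply/matrixP => i j; rewrite !mxE.
have -> : 'd (transition id_chart id_chart) u = id :> ('rV_n -> 'rV_n).
  exact: diff_val.
by rewrite mxE eqxx eq_sym.
Qed.

End EuclideanChart.

Definition minkowski_manifold : manifold R 4 := euclidean_manifold 4.

Definition minkowski_metric : metric_field minkowski_manifold := fun _ _ => eta R.
Definition minkowski_time : field_along minkowski_manifold minkowski_manifold := fun _ _ => delta_mx 0 0.

Lemma tr_eta : (eta R)^T = eta R.
Proof. by rewrite /eta tr_block_mx !trmx0 !tr_scalar_mx. Qed.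

Lemma eta_sym (d : chart R 4 minkowski_manifold) (q : minkowski_manifold) : atlas d -> dom d q ->
  (minkowski_metric d q)^T = minkowski_metric d q.
Proof. by move=> _ _; exact: tr_eta. Qed.

Lemma eta_signature (d : chart R 4 minkowski_manifold) (q : minkowski_manifold) : atlas d -> dom d q ->
  exists P : 'M[R]_4, P \in unitmx /\ P *m minkowski_metric d q *m P^T = eta R.
Proof. by move=> _ _; exists 1%:M; rewrite unitmx1 trmx1 mulmx1 mul1mx. Qed.

Lemma eta_tensor (d d' : chart R 4 minkowski_manifold) (q : minkowski_manifold) :
  atlas d -> atlas d' -> dom d q -> dom d' q ->
  minkowski_metric d q = 'J (transition d d') (coord d q) *m minkowski_metric d' q
                  *m ('J (transition d d') (coord d q))^T.
Proof. by move=> -> -> _ _; rewrite jacobian_id trmx1 mulmx1 mul1mx. Qed.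

Lemma eta_smooth (d : chart R 4 minkowski_manifold) : atlas d ->
  smooth_on (coord d @` dom d) (minkowski_metric d \o param d).
Proof. by move=> _; exact: smooth_on_cst. Qed.

Lemma e0_smooth : smooth_field_along (id : minkowski_manifold -> minkowski_manifold) minkowski_time.
Proof.
split=> [d d' p -> -> _ _|c d _ _]; last exact: smooth_on_cst.
by rewrite jacobian_id mulmx1.
Qed.

Lemma eta00 : eta R 0 0 < 0.
Proof.
have -> : (0 : 'I_(1 + 3)) = lshift 3 (0 : 'I_1) by exact: val_inj.
by rewrite /eta block_mxEul mxE eqxx mulr1n ltrN10.
Qed.

Lemma e0_timelike (d : chart R 4 minkowski_manifold) (q : minkowski_manifold) : atlas d -> dom d q ->
  pairing (minkowski_metric d q) (minkowski_time d q) (minkowski_time d q) < 0.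
Proof.
move=> _ _.
rewrite /pairing /minkowski_metric /minkowski_time -rowE trmx_delta -colE mxE mxE.
exact: eta00.
Qed.

Definition minkowski_spacetime : spacetime R :=
  Spacetime eta_sym eta_signature eta_tensor eta_smooth e0_smooth e0_timelike.
End Minkowski.

Section QuasilocalEnergy.
Context {R : realType}.
Variables (N : spacetime R) (S : manifold R 2).
Variable mu : {measure set (borel S) -> \bar R}.
Variables (F : S -> N) (e3 e4 : field_along S N).
Variables (X : S -> minkowski_spacetime R) (f3 f4 : field_along S (minkowski_spacetime R)).

Definition mink (u v : 'rV[R]_(1 + 3)) : R := pairing (eta R) u v.

Definition future_vector : set 'rV[R]_(1 + 3) :=
  [set T | mink T T < 0 /\ 0 < T 0 0].

Definition observer : set 'rV[R]_(1 + 3) :=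
  [set T | mink T T = -1 /\ 0 < T 0 0].

Definition observer_of (a : 'rV[R]_3) : 'rV[R]_(1 + 3) :=
  row_mx (Num.sqrt (1 + dot a a))%:M a.

Definition surface_mean (f : S -> R) : R :=
  (8 * pi)^-1 * \int[mu]_(p in setT) f p.

Definition wang_yau_density (T0 : 'rV[R]_(1 + 3)) (p : S) : R :=
  let g := induced_metric F in
  let tau q := - mink (X q) T0 in
  let dtau := gradient g tau p in
  let s := 1 + pairing (g (chart_at p) p) dtau dtau in
  let L := laplacian g tau p in
  let h0 := norm_H X p in
  let h := norm_H F p in
  Num.sqrt (h0 ^+ 2 * s + L ^+ 2) - Num.sqrt (h ^+ 2 * s + L ^+ 2)
  - L * (asinh (L / (Num.sqrt s * h0)) - asinh (L / (Num.sqrt s * h)))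
  - conn_form X f3 f4 p dtau + conn_form F e3 e4 p dtau.

Definition wang_yau_energy (T0 : 'rV[R]_(1 + 3)) : R :=
  surface_mean (wang_yau_density T0).

Definition spatial (p : S) : 'rV[R]_3 := rsubmx (X p : 'rV[R]_(1 + 3)).

Definition liu_yau_mass (nu : S -> 'rV[R]_3) : R :=
  surface_mean (fun p =>
    euclidean_mean_curvature (induced_metric F) spatial nu p - norm_H F p).

(** The image under the differential of [spatial] of the vector field dual to
    the connection 1-form. *)
Definition conn_vector_R3 (p : S) : 'rV[R]_3 :=
  \sum_i conn_vector F e3 e4 p 0 i *: pd (chart_at p) i spatial p.

Definition momentum : 'rV[R]_3 :=
  \row_k surface_mean (fun p => conn_vector_R3 p 0 k).

Definition energy_momentum (nu : S -> 'rV[R]_3) : 'rV[R]_(1 + 3) :=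
  row_mx (liu_yau_mass nu)%:M momentum.

Definition error_const : R :=
  sup (range (fun p => `|(norm_H X p) ^+ 2 / (norm_H F p) ^+ 2
                         + norm_H X p / norm_H F p - 2|))
  * surface_mean (fun p => `|norm_H X p - norm_H F p|).

End QuasilocalEnergy.

(* Main.v *)
Require Import Defs.
From HB Require Import structures.
From mathcomp Require Import all_boot all_order all_algebra.
From mathcomp Require Import all_classical all_reals all_analysis.
From mathcomp Require Import ring lra.
Set Implicit Arguments.
Unset Strict Implicit.
Unset Printing Implicit Defensive.
Import Order.TTheory GRing.Theory Num.Theory.
Import numFieldNormedType.Exports.
Import Defs.
Local Open Scope classical_set_scope.
Local Open Scope ring_scope.

(** When X maps into the hyperplane R^3, the normal [nu] of the image controls
    everything: the time function is tau = - a . X, so that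
    [1 + |grad tau|^2 = A^2 - b^2] and [Laplace tau = k b], where
    [A = sqrt (1 + |a|^2)], [b = a . nu] and [k = |H_0|], while the connection
    form of X vanishes.  The energy density is thus an explicit function of
    [k], [|H|], [A] and [b], minus [a . V].  Writing its inverse hyperbolic
    sines as hyperbolic angles, the convexity of cosh (its graph lies above the
    tangent lines) shows that this function is at least [A (k - |H|)], with
    equality only if [k = |H|] or [b = 0], and exceeds it by at most a multiple
    of [b^2 / A].  Integration gives (i): in the equality case, where
    [|H| <> k] the function [a . nu] vanishes on an open set, and since the
    second fundamental form is nondegenerate there (Gauss equation, [K > 0]),
    [a = 0].  The mean curvature [k] is positive because it does not vanish
    and is positive at a point farthest from the origin.  Parts (ii) and (iii)
    follow from (i) by the reversed Cauchy-Schwarz inequality and by a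
    first-order expansion at [a = 0]. *)

(** * Functions of class C^k on open sets *)

(** One obstacle shapes the geometric half. The definitions evaluate every quantity at p in the
    chart [chart_at p], which varies with p arbitrarily, so none of them is visibly continuous in p,
    let alone integrable. Each is therefore shown to have the same value in every chart around p and
    is then studied in a fixed one. For the mean curvature vector and the connection form of F this
    rests on the transformation law of the Christoffel symbols of N, derived from the Koszul
    formula. In the analytic half the tangent line to cosh is taken at the angle belonging to |H|
    for the lower bound and at the one belonging to |H_0| for the upper bound. With x = k/|H|, the
    factor x^2 + x - 2 = (x - 1)(x + 2) of C comes from a difference of squares containing (x - 1)(x
    + 1). The upper bound is kept with the error C |a|^2/A, sharper than the C A of (i): it is of
    second order at a = 0, so E lies between two functions with the same first-order expansion
    there, and the gradient in (iii) needs no differentiation under the integral sign. *)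

Section Differentiability.
Context {R : realType}.

(** The inequality form of the little-o expansion, in which a candidate differential can be checked
    by estimates; the gradient of the energy at a = 0 is obtained this way. *)
Lemma diff_eps (V W : normedModType R) (f : V -> W) (L : {linear V -> W}) (x : V) :
  continuous L ->
  (forall e, 0 < e -> \forall h \near 0, `|f (h + x) - f x - L h| <= e * `|h|) ->
  differentiable f x /\ 'd f x = L :> (V -> W).
Proof.
move=> Lc fL.
have fE : f \o shift x = cst (f x) + L +o_ 0 id.
  apply/eqaddoP => e e0; near=> h; rewrite /= opprD addrA.
  by near: h; apply: fL.
have dL := diff_unique Lc fE.
split=> //; apply/diff_locallyP; rewrite dL; split=> //.
Unshelve. all: by end_near. Qed.

Lemma differentiable_eps (V W : normedModType R) (f : V -> W) (x : V) :
  differentiable f x ->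
  forall e, 0 < e -> \forall h \near 0, `|f (h + x) - f x - 'd f x h| <= e * `|h|.
Proof.
move=> /diff_locallyP [_ fE] e e0.
move/eqaddoP : fE => /(_ e e0); apply: filterS => h /=.
by rewrite opprD addrA.
Qed.

(** Functions read in a chart are total but meaningful only on an open set. Hence every fact about
    derivatives has to pass between functions that agree merely near a point. *)
Lemma near_differentiable (V W : normedModType R) (f g : V -> W) (x : V) :
  (\near x, f x = g x) -> differentiable f x -> differentiable g x.
Proof.
move=> fg df; apply: (proj1 (@diff_eps _ _ g ('d f x) x _ _)).
  by apply: diff_continuous.
move=> e e0; rewrite -(nbhs_singleton fg).
have := differentiable_eps df e0.
have H2 : \forall h \near 0, f (h + x) = g (h + x).
  by move: fg; rewrite (near_shift 0) /=; apply: filterS => h; rewrite subr0.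
move=> H1; near=> h; rewrite -(near H2 h) //; near: h; exact: H1.
Unshelve. all: by end_near. Qed.

End Differentiability.

Section Ck.
Context {R : realType}.
Implicit Types (W : normedModType R) (k : nat).

Lemma open_near (T : topologicalType) (U : set T) (P : T -> Prop) u :
  open U -> U u -> (forall v, U v -> P v) -> \near u, P u.
Proof.
move=> oU Uu UP; apply: (@filterS _ _ _ U) => //.
exact: open_nbhs_nbhs.
Qed.

Lemma near_partial n W (i : 'I_n) (f g : 'rV[R]_n -> W) u :
  (\near u, f u = g u) -> partial i f u = partial i g u.
Proof. exact: near_eq_derive. Qed.

Lemma Ck_on_sub k n W (U V : set 'rV[R]_n) (f : 'rV[R]_n -> W) :
  V `<=` U -> Ck_on k U f -> Ck_on k V f.
Proof.
elim: k f => [|k IH] f VU /=; first by move=> h u /VU; apply: h.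
by case=> h1 h2; split=> [u /VU|i]; [exact: h1|exact: IH].
Qed.

(** A point of an open U has a neighbourhood inside U, so partial derivatives on U see only the
    values on U. In the closure lemmas this replaces a partial derivative by the formula computed
    for it on U. *)
Lemma eq_Ck_on k n W (U : set 'rV[R]_n) (f g : 'rV[R]_n -> W) : open U ->
  (forall u, U u -> f u = g u) -> Ck_on k U f -> Ck_on k U g.
Proof.
move=> oU; elim: k f g => [|k IH] f g fg /=.
  move=> cf u Uu; have nfg := open_near oU Uu fg.
  rewrite /prop_for /continuous_at -(fg _ Uu).
  exact: cvg_trans (near_eq_cvg nfg) (cf _ Uu).
case=> h1 h2; split=> [u Uu|i].
  exact: (near_differentiable (open_near oU Uu fg) (h1 _ Uu)).
by apply: (IH (partial i f)) (h2 i) => u Uu; exact: (near_partial i (open_near oU Uu fg)).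
Qed.

Lemma Ck_on_continuous k n W (U : set 'rV[R]_n) (f : 'rV[R]_n -> W) :
  Ck_on k U f -> forall u, U u -> {for u, continuous f}.
Proof.
case: k => [//|k] [h _] u Uu; exact: differentiable_continuous (h _ Uu).
Qed.

Lemma Ck_onW k n W (U : set 'rV[R]_n) (f : 'rV[R]_n -> W) :
  Ck_on k.+1 U f -> Ck_on k U f.
Proof.
elim: k f => [|k IH] f.
  by move=> /(Ck_on_continuous).
by move=> [h1 h2]; split=> // i; apply: IH; exact: h2.
Qed.

Lemma Ck_on_cst k n W (U : set 'rV[R]_n) (w : W) : Ck_on k U (fun=> w).
Proof. exact: smooth_on_cst. Qed.

Lemma partialD n W (i : 'I_n) (f g : 'rV[R]_n -> W) u :
  differentiable f u -> differentiable g u ->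
  partial i (fun v => f v + g v) u = partial i f u + partial i g u.
Proof. by move=> df dg; apply: deriveD; exact: diff_derivable. Qed.

Lemma partial_lin n W W' (i : 'I_n) (f : 'rV[R]_n -> W) (L : {linear W -> W'}) u :
  continuous L -> differentiable f u ->
  partial i (fun v => L (f v)) u = L (partial i f u).
Proof.
move=> Lc df; have dL : differentiable L (f u) by exact: linear_differentiable.
rewrite /partial !deriveE //; last exact: differentiable_comp.
by rewrite (diff_comp df dL) /= diff_lin.
Qed.

Lemma differentiable_bilinear n (U V W : normedModType R) (B : {bilinear U -> V -> W})
    (f : 'rV[R]_n -> U) (g : 'rV[R]_n -> V) u :
  continuous (fun p => B p.1 p.2) -> differentiable f u -> differentiable g u ->
  differentiable (fun v => B (f v) (g v)) u.
Proof.
move=> Bc df dg; have dfg := differentiable_pair df dg.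
exact: (differentiable_comp dfg (differentiable_bilin (f := B) _ Bc)).
Qed.

Lemma partial_bilinear n (U V W : normedModType R) (B : {bilinear U -> V -> W})
    (i : 'I_n) (f : 'rV[R]_n -> U) (g : 'rV[R]_n -> V) u :
  continuous (fun p => B p.1 p.2) -> differentiable f u -> differentiable g u ->
  partial i (fun v => B (f v) (g v)) u = B (partial i f u) (g u) + B (f u) (partial i g u).
Proof.
move=> Bc df dg; have dfg := differentiable_pair df dg.
have dB := differentiable_bilin (f := B) (f u, g u) Bc.
rewrite /partial !deriveE //; last exact: differentiable_bilinear.
rewrite (diff_comp dfg dB) /= diff_bilin //= diff_pair //=.
by rewrite addrC.
Qed.

(** Scaling and the matrix product are both registered as bilinear maps, so that one product rule
    serves scalars, vectors and matrices. *)
Lemma scale_is_bilinear W :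
  bilinear_for
    (GRing.Scale.Law.clone _ _ *:%R _) (GRing.Scale.Law.clone _ _ *:%R _)
    (@GRing.scale R W).
Proof.
split=> [u'|u] a x y /=; first by rewrite scalerDl scalerA.
by rewrite scalerDr !scalerA mulrC.
Qed.
HB.instance Definition _ W :=
  bilinear_isBilinear.Build R R W W _ _ (@GRing.scale R W) (@scale_is_bilinear W).

Lemma mulmx_is_bilinear m n p :
  bilinear_for
    (GRing.Scale.Law.clone _ _ *:%R _) (GRing.Scale.Law.clone _ _ *:%R _)
    (@mulmx R m n p).
Proof.
split=> [u'|u] a x y /=; first by rewrite mulmxDl scalemxAl.
by rewrite mulmxDr scalemxAr.
Qed.
HB.instance Definition _ m n p :=
  bilinear_isBilinear.Build R 'M[R]_(m,n) 'M[R]_(n,p) 'M[R]_(m,p) _ _ (@mulmx R m n p)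
    (@mulmx_is_bilinear m n p).

Lemma continuous_mx (T : topologicalType) m n (f : T -> 'M[R]_(m, n)) x :
  (forall i j, {for x, continuous (fun y => f y i j)}) -> {for x, continuous f}.
Proof.
move=> fc; apply/cvgrPdist_le => e e0; near=> y.
rewrite /Num.Def.normr/= mx_normrE (bigmax_le _ (ltW e0))//= => i _.
rewrite !mxE/=.
move: i; near: y; apply: filter_forall => /= i.
exact: ((cvgrPdist_le _ _).1 (fc i.1 i.2)).
Unshelve. all: by end_near. Qed.

Lemma continuous_scale W : continuous (fun p : R * W => p.1 *: p.2).
Proof. exact: scale_continuous. Qed.

Lemma continuous_at_sum (T : topologicalType) W (I : Type) (r : seq I) (P : pred I)
    (f : I -> T -> W) x :
  (forall i, P i -> {for x, continuous (f i)}) ->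
  {for x, continuous (fun y => \sum_(i <- r | P i) f i y)}.
Proof. by move=> fc; apply: cvg_big => //; exact: add_continuous. Qed.

Lemma continuous_mulmx m n p :
  continuous (fun q : 'M[R]_(m, n) * 'M[R]_(n, p) => q.1 *m q.2).
Proof.
move=> q; apply: continuous_mx => i j.
rewrite (_ : (fun y => _) = fun y : 'M[R]_(m, n) * 'M[R]_(n, p) => \sum_k y.1 i k * y.2 k j); last first.
  by apply/funext => y; rewrite mxE.
apply: continuous_at_sum => k _.
apply: cvgM.
  apply: (@cvg_comp _ _ _ fst (fun M : 'M[R]_(m, n) => M i k) _ (nbhs q.1)); first exact: cvg_fst.
  exact: matrix_normedtype.coord_continuous.
apply: (@cvg_comp _ _ _ snd (fun M : 'M[R]_(n, p) => M k j) _ (nbhs q.2)); first exact: cvg_snd.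
exact: matrix_normedtype.coord_continuous.
Qed.

End Ck.

Section CkClosure.
Context {R : realType}.
Implicit Types (W : normedModType R) (k n : nat).

Lemma Ck_onD k n W (U : set 'rV[R]_n) (f g : 'rV[R]_n -> W) : open U ->
  Ck_on k U f -> Ck_on k U g -> Ck_on k U (fun u => f u + g u).
Proof.
move=> oU; elim: k f g => [|k IH] f g /=.
  by move=> cf cg u Uu; exact: continuousD (cf u Uu) (cg u Uu).
move=> [df pf] [dg pg]; split=> [u Uu|i].
  by apply: differentiableD; [exact: df|exact: dg].
apply: (eq_Ck_on oU) (IH _ _ (pf i) (pg i)) => u Uu /=.
by rewrite partialD //; [exact: df|exact: dg].
Qed.

Lemma Ck_on_sum k n W (U : set 'rV[R]_n) (I : Type) (r : seq I) (P : pred I)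
    (f : I -> 'rV[R]_n -> W) : open U ->
  (forall i, P i -> Ck_on k U (f i)) -> Ck_on k U (fun u => \sum_(i <- r | P i) f i u).
Proof.
move=> oU fC; elim: r => [|i r IH].
  by apply: (eq_Ck_on oU) (Ck_on_cst _ _ 0) => u _; rewrite big_nil.
have [Pi|nPi] := boolP (P i).
  by apply: (eq_Ck_on oU) (Ck_onD oU (fC i Pi) IH) => u _; rewrite big_cons Pi.
by apply: (eq_Ck_on oU) IH => u _; rewrite big_cons (negbTE nPi).
Qed.

Lemma Ck_on_bilinear k n (V1 V2 W : normedModType R) (B : {bilinear V1 -> V2 -> W})
    (U : set 'rV[R]_n) (f : 'rV[R]_n -> V1) (g : 'rV[R]_n -> V2) : open U ->
  continuous (fun p => B p.1 p.2) ->
  Ck_on k U f -> Ck_on k U g -> Ck_on k U (fun u => B (f u) (g u)).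
Proof.
move=> oU Bc; elim: k f g => [|k IH] f g /=.
  move=> cf cg u Uu.
  apply: (@cvg_comp _ _ _ (fun v => (f v, g v)) (fun p => B p.1 p.2) _ (nbhs (f u, g u))).
    exact: cvg_pair (cf u Uu) (cg u Uu).
  exact: (Bc (f u, g u)).
move=> fC gC; have [df pf] := fC; have [dg pg] := gC; split=> [u Uu|i].
  by apply: differentiable_bilinear Bc _ _; [exact: df|exact: dg].
apply: (eq_Ck_on oU) (Ck_onD oU (IH _ _ (pf i) (Ck_onW gC)) (IH _ _ (Ck_onW fC) (pg i))).
by move=> u Uu /=; rewrite (partial_bilinear i Bc) //; [exact: df|exact: dg].
Qed.

Lemma Ck_onZ k n W (U : set 'rV[R]_n) (f : 'rV[R]_n -> R) (g : 'rV[R]_n -> W) : open U ->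
  Ck_on k U f -> Ck_on k U g -> Ck_on k U (fun u => f u *: g u).
Proof.
by move=> oU; apply: (@Ck_on_bilinear _ _ _ _ _ (@GRing.scale R W)) => //; exact: continuous_scale.
Qed.

Lemma Ck_onM k n (U : set 'rV[R]_n) (f g : 'rV[R]_n -> R) : open U ->
  Ck_on k U f -> Ck_on k U g -> Ck_on k U (fun u => f u * g u).
Proof. exact: (@Ck_onZ k n R^o). Qed.

Lemma Ck_onN k n W (U : set 'rV[R]_n) (f : 'rV[R]_n -> W) : open U ->
  Ck_on k U f -> Ck_on k U (fun u => - f u).
Proof.
move=> oU fC; have := Ck_onZ oU (Ck_on_cst k U (-1 : R^o)) fC.
by apply: (eq_Ck_on oU) => u _; rewrite scaleN1r.
Qed.

Lemma Ck_onB k n W (U : set 'rV[R]_n) (f g : 'rV[R]_n -> W) : open U ->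
  Ck_on k U f -> Ck_on k U g -> Ck_on k U (fun u => f u - g u).
Proof. by move=> oU fC gC; apply: Ck_onD => //; exact: Ck_onN. Qed.

Lemma Ck_on_mulmx k n m p q (U : set 'rV[R]_n) (f : 'rV[R]_n -> 'M[R]_(m, p))
    (g : 'rV[R]_n -> 'M[R]_(p, q)) : open U ->
  Ck_on k U f -> Ck_on k U g -> Ck_on k U (fun u => f u *m g u).
Proof.
by move=> oU; apply: (@Ck_on_bilinear _ _ _ _ _ (@mulmx R m p q)) => //; exact: continuous_mulmx.
Qed.

Lemma Ck_on_prod k n (U : set 'rV[R]_n) (I : Type) (r : seq I) (P : pred I)
    (f : I -> 'rV[R]_n -> R) : open U ->
  (forall i, P i -> Ck_on k U (f i)) -> Ck_on k U (fun u => \prod_(i <- r | P i) f i u).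
Proof.
move=> oU fC; elim: r => [|i r IH].
  by apply: (eq_Ck_on oU) (Ck_on_cst k U (1 : R^o)) => u _; rewrite big_nil.
have [Pi|nPi] := boolP (P i).
  by apply: (eq_Ck_on oU) (Ck_onM oU (fC i Pi) IH) => u _; rewrite big_cons Pi.
by apply: (eq_Ck_on oU) IH => u _; rewrite big_cons (negbTE nPi).
Qed.

Lemma Ck_on_lin k n W W' (U : set 'rV[R]_n) (L : {linear W -> W'}) (f : 'rV[R]_n -> W) :
  open U -> continuous L -> Ck_on k U f -> Ck_on k U (fun u => L (f u)).
Proof.
move=> oU Lc; elim: k f => [|k IH] f /=.
  by move=> cf u Uu; exact: (@cvg_comp _ _ _ f L _ (nbhs (f u)) _ (cf _ Uu) (Lc _)).
move=> [df pf]; split=> [u Uu|i].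
  by apply: differentiable_comp (df _ Uu) _; exact: linear_differentiable.
by apply: (eq_Ck_on oU) (IH _ (pf i)) => u Uu; rewrite partial_lin //; exact: df.
Qed.

(** The coordinate function as a linear map between normed modules, whence the codomain [R^o]; the
    lemmas on continuous linear maps then apply to it. *)
Definition entry m p i j (A : 'M[R]_(m, p)) : R^o := A i j.

Lemma entry_is_linear m p i j : linear (@entry m p i j).
Proof. by move=> a A B; rewrite /entry !mxE. Qed.
HB.instance Definition _ m p i j :=
  GRing.isLinear.Build R 'M[R]_(m, p) R^o _ (@entry m p i j)
    (@entry_is_linear m p i j).

Lemma Ck_on_entry k n m p (U : set 'rV[R]_n) (f : 'rV[R]_n -> 'M[R]_(m, p)) i j : open U ->
  Ck_on k U f -> Ck_on k U (fun u => f u i j).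
Proof.
move=> oU; exact: (@Ck_on_lin k n _ _ U (@entry m p i j) f oU (@matrix_normedtype.coord_continuous _ _ _ i j)).
Qed.

Lemma partial_entry n m p (f : 'rV[R]_n -> 'M[R]_(m, p)) i j (l : 'I_n) u : differentiable f u ->
  partial l (fun v => f v i j) u = partial l f u i j.
Proof.
exact: (@partial_lin _ _ _ _ _ f (@entry m p i j) u (@matrix_normedtype.coord_continuous _ _ _ i j)).
Qed.

Lemma differentiable_mx n m p (f : 'rV[R]_n -> 'M[R]_(m, p)) u :
  (forall i j, differentiable (fun v => f v i j) u) -> differentiable f u.
Proof.
move=> df.
have -> : f = fun v => \sum_i \sum_j f v i j *: delta_mx i j.
  by apply/funext => v; exact: matrix_sum_delta.
pose g i v := \sum_j f v i j *: (delta_mx i j : 'M[R]_(m, p)).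
rewrite [F in differentiable F _](_ : _ = \sum_i g i); last first.
  by apply/funext => v; rewrite fct_sumE.
apply: differentiable_sum => i.
rewrite [g i](_ : _ = \sum_j (fun v => f v i j *: (delta_mx i j : 'M[R]_(m, p)))); last first.
  by apply/funext => v; rewrite fct_sumE.
by apply: differentiable_sum => j; exact: differentiableZl.
Qed.

Lemma Ck_on_mx k n m p (U : set 'rV[R]_n) (f : 'rV[R]_n -> 'M[R]_(m, p)) : open U ->
  (forall i j, Ck_on k U (fun u => f u i j)) -> Ck_on k U f.
Proof.
move=> oU fC.
have : Ck_on k U (fun v => \sum_i \sum_j f v i j *: delta_mx i j).
  apply: Ck_on_sum => // i _; apply: Ck_on_sum => // j _.
  by apply: Ck_onZ => //; exact: Ck_on_cst.
by apply: (eq_Ck_on oU) => v _; rewrite -matrix_sum_delta.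
Qed.

Lemma Ck_on_tr k n m p (U : set 'rV[R]_n) (f : 'rV[R]_n -> 'M[R]_(m, p)) : open U ->
  Ck_on k U f -> Ck_on k U (fun u => (f u)^T).
Proof.
move=> oU fC; apply: Ck_on_mx => // i j.
by apply: (eq_Ck_on oU) (Ck_on_entry j i oU fC) => u _; rewrite mxE.
Qed.

Lemma partialV n (f : 'rV[R]_n -> R) i u : differentiable f u -> f u != 0 ->
  partial i (fun v => (f v)^-1) u = - ((f u)^-1 * (f u)^-1) * partial i f u.
Proof.
move=> df f0; rewrite /partial !deriveE //; last exact: differentiableV.
by rewrite diffV //= -invfM expr2.
Qed.

Lemma Ck_onV k n (U : set 'rV[R]_n) (f : 'rV[R]_n -> R) : open U ->
  (forall u, U u -> f u != 0) -> Ck_on k U f -> Ck_on k U (fun u => (f u)^-1).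
Proof.
move=> oU f0; elim: k => [|k IH] /=.
  by move=> cf u Uu; exact: continuousV (f0 u Uu) (cf u Uu).
move=> fC; have [df pf] := fC; have {}IH := IH (Ck_onW fC); split=> [u Uu|i].
  by apply: differentiableV; [exact: df|exact: f0].
apply: (eq_Ck_on oU) (Ck_onM oU (Ck_onN oU (Ck_onM oU IH IH)) (pf i)) => u Uu.
by rewrite partialV //; [exact: df|exact: f0].
Qed.

Lemma differentiable_sqrt n (f : 'rV[R]_n -> R) u : differentiable f u -> 0 < f u ->
  differentiable (fun v => Num.sqrt (f v)) u.
Proof.
move=> df f0; have sd := is_derive1_sqrt f0.
have ds : differentiable (@Num.sqrt R) (f u) by apply/derivable1_diffP.
exact: (differentiable_comp df ds).
Qed.

Lemma partial_comp1 n (g : R -> R) (f : 'rV[R]_n -> R) i u :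
  differentiable f u -> differentiable g (f u) ->
  partial i (g \o f) u = 'D_1 g (f u) * partial i f u.
Proof.
move=> df dg; rewrite /partial !deriveE //; last exact: (differentiable_comp df dg).
rewrite (diff_comp df dg) /= -[X in 'd g _ X = _]mulr1.
by rewrite [LHS]linearZ mulrC.
Qed.

Lemma partial_sqrt n (f : 'rV[R]_n -> R) i u : differentiable f u -> 0 < f u ->
  partial i (fun v => Num.sqrt (f v)) u = (2 * Num.sqrt (f u))^-1 * partial i f u.
Proof.
move=> df f0; have sd := is_derive1_sqrt f0.
have ds : differentiable (@Num.sqrt R) (f u) by apply/derivable1_diffP.
by rewrite (partial_comp1 i df ds) derive_sqrt.
Qed.

Lemma Ck_on_sqrt k n (U : set 'rV[R]_n) (f : 'rV[R]_n -> R) : open U ->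
  (forall u, U u -> 0 < f u) -> Ck_on k U f -> Ck_on k U (fun u => Num.sqrt (f u)).
Proof.
move=> oU f0; elim: k => [|k IH] /=.
  move=> cf u Uu.
  exact: (@cvg_comp _ _ _ f (@Num.sqrt R) _ (nbhs (f u)) _ (cf _ Uu) (@sqrt_continuous _ _)).
move=> fC; have [df pf] := fC; have {}IH := IH (Ck_onW fC); split=> [u Uu|i].
  by apply: differentiable_sqrt; [exact: df|exact: f0].
have s0 u : U u -> 2 * Num.sqrt (f u) != 0.
  by move=> Uu; rewrite mulf_neq0 // gt_eqF // sqrtr_gt0 f0.
have C2 := Ck_onM oU (Ck_on_cst k U (2 : R^o)) IH.
apply: (eq_Ck_on oU) (Ck_onM oU (Ck_onV oU s0 C2) (pf i)) => u Uu.
by rewrite partial_sqrt //; [exact: df|exact: f0].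
Qed.

Lemma partial_comp n m W (f : 'rV[R]_n -> W) (phi : 'rV[R]_m -> 'rV[R]_n) i u :
  differentiable phi u -> differentiable f (phi u) ->
  partial i (fun v => f (phi v)) u =
  \sum_j partial i phi u 0 j *: partial j f (phi u).
Proof.
move=> dphi df; rewrite /partial deriveE; last exact: (differentiable_comp dphi df).
rewrite (diff_comp dphi df) /= -(deriveE _ dphi).
rewrite [X in 'd f _ X]row_sum_delta linear_sum /=.
by apply: eq_bigr => j _; rewrite linearZ /= (deriveE _ df).
Qed.

(** By the chain rule a partial derivative of the composite is a sum of products of the partial
    derivatives of the components of [phi] with [partial j f] composed with [phi]; the induction on
    k must therefore hold for all f at once. *)
Lemma Ck_on_comp k n m W (V : set 'rV[R]_n) (U : set 'rV[R]_m) (f : 'rV[R]_n -> W)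
    (phi : 'rV[R]_m -> 'rV[R]_n) : open U -> (forall u, U u -> V (phi u)) ->
  Ck_on k V f -> Ck_on k U phi -> Ck_on k U (fun u => f (phi u)).
Proof.
move=> oU UV; elim: k f => [|k IH] f.
  move=> /= cf cphi u Uu.
  exact: (@cvg_comp _ _ _ phi f _ (nbhs (phi u)) _ (cphi _ Uu) (cf _ (UV _ Uu))).
move=> [df pf] phiC; have [dphi pphi] := phiC; split=> [u Uu|i].
  exact: (differentiable_comp (dphi _ Uu) (df _ (UV _ Uu))).
have : Ck_on k U (fun u => \sum_j partial i phi u 0 j *: partial j f (phi u)).
  apply: Ck_on_sum => // j _; apply: Ck_onZ => //.
    by apply: Ck_on_entry => //; exact: pphi.
  by apply: IH; [exact: pf|exact: Ck_onW].
apply: (eq_Ck_on oU) => u Uu.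
by rewrite (partial_comp i (dphi _ Uu) (df _ (UV _ Uu))).
Qed.

End CkClosure.

(** * Symmetry of second derivatives, and derivatives at a maximum *)

Section SecondDerivatives.
Context {R : realType}.

(** Turns partial derivatives into derivatives of functions of one variable, at every point of a
    segment, so that the mean value theorem can be used. *)
Lemma is_derive_line n (f : 'rV[R]_n -> R) (i : 'I_n) (w : 'rV[R]_n) (t : R) :
  differentiable f (w + t *: delta_mx 0 i) ->
  is_derive t 1 (fun s : R => f (w + s *: delta_mx 0 i)) (partial i f (w + t *: delta_mx 0 i)).
Proof.
move=> df.
have dl : is_diff t (fun s : R => w + s *: (delta_mx 0 i : 'rV[R]_n)) (fun s => s *: delta_mx 0 i).
  have dk : is_diff t (fun s : R => s *: (delta_mx 0 i : 'rV[R]_n)) (fun s => s *: delta_mx 0 i).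
    exact: is_diff_scalel.
  have dw : is_diff t (fun s : R => w) (fun s => 0) by exact: is_diff_cst.
  apply: (is_diff_eq (is_diffD dw dk)).
  by rewrite funeqE => s /=; rewrite fctE add0r.
have dc := differentiable_comp (@ex_diff _ _ _ _ _ _ _ dl) df.
apply: DeriveDef; first exact: diff_derivable.
rewrite deriveE // (diff_comp (@ex_diff _ _ _ _ _ _ _ dl) df) /= diff_val scale1r.
by rewrite /partial deriveE.
Qed.

(** The second difference of [f] over a small square, by the mean value
    theorem in the [i]-th and then in the [j]-th direction. *)
Lemma second_difference n (U : set 'rV[R]_n) (f : 'rV[R]_n -> R) (i j : 'I_n) u (h : R) :
  Ck_on 2 U f -> 0 < h ->
  (forall s t, 0 <= s <= h -> 0 <= t <= h ->
     U (u + s *: delta_mx 0 i + t *: delta_mx 0 j)) ->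
  exists s t, [/\ 0 <= s <= h, 0 <= t <= h &
    f (u + h *: delta_mx 0 i + h *: delta_mx 0 j) - f (u + h *: delta_mx 0 i)
    - (f (u + h *: delta_mx 0 j) - f u) =
    partial j (partial i f) (u + s *: delta_mx 0 i + t *: delta_mx 0 j) * h * h].
Proof.
move=> [df pf] h0 Uh.
have h00 : 0 <= h <= h by rewrite (ltW h0) /=.
have z00 : (0 : R) <= 0 <= h by rewrite (ltW h0) andbT.
pose g (s : R) := f (u + h *: delta_mx 0 j + s *: delta_mx 0 i) - f (u + s *: delta_mx 0 i).
have Uh0 s : 0 <= s <= h -> U (u + s *: delta_mx 0 i).
  by move=> sh; have := Uh _ _ sh z00; rewrite scale0r addr0.
have Uhj s : 0 <= s <= h -> U (u + h *: delta_mx 0 j + s *: delta_mx 0 i).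
  by move=> sh; rewrite addrAC; apply: Uh.
have gd s : 0 <= s <= h -> is_derive s 1 g
    (partial i f (u + h *: delta_mx 0 j + s *: delta_mx 0 i) - partial i f (u + s *: delta_mx 0 i)).
  move=> sh; have d1 := @is_derive_line _ _ i _ _ (df _ (Uhj s sh)).
  by have d2 := @is_derive_line _ _ i _ _ (df _ (Uh0 s sh)); exact: is_deriveB.
have itv x : x \in `]0, h[%R -> 0 <= x <= h.
  by rewrite in_itv /= => /andP[/ltW -> /ltW ->].
have itvc x : x \in `[0, h]%R -> 0 <= x <= h by rewrite in_itv.
have gc : {within `[0, h], continuous g}.
  by apply: derivable_within_continuous => x /itvc /gd [].
have [s /itv sh gE] := MVT h0 (fun x xh => gd x (itv x xh)) gc.
have [dpf _] := pf i.
pose k (t : R) := partial i f (u + s *: delta_mx 0 i + t *: delta_mx 0 j).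
have kd t : 0 <= t <= h -> is_derive t 1 k (partial j (partial i f) (u + s *: delta_mx 0 i + t *: delta_mx 0 j)).
  by move=> th; apply: is_derive_line; apply: dpf; exact: Uh.
have kc : {within `[0, h], continuous k}.
  by apply: derivable_within_continuous => x /itvc /kd [].
have [t /itv th kE] := MVT h0 (fun x xh => kd x (itv x xh)) kc.
exists s, t; split=> //.
rewrite !subr0 in gE kE.
have gE' : g h - g 0 = (k h - k 0) * h.
  by rewrite gE /k scale0r addr0 [u + h *: _ + s *: _]addrAC.
rewrite -kE -gE' /g !scale0r !addr0.
by rewrite [u + h *: delta_mx 0 j + h *: _]addrAC.
Qed.

Lemma small_square n (u : 'rV[R]_n) (P : set 'rV[R]_n) : nbhs u P ->
  exists2 h : R, 0 < h & forall (i j : 'I_n) s t, 0 <= s <= h -> 0 <= t <= h ->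
    P (u + s *: delta_mx 0 i + t *: delta_mx 0 j).
Proof.
move=> /nbhs_ballP[e /= e0 eP]; exists (e / 4); first by rewrite divr_gt0.
have nd (i : 'I_n) : `|delta_mx 0 i : 'rV[R]_n| <= 1.
  rewrite /Num.Def.normr/= mx_normrE; apply: bigmax_le => // k _.
  by rewrite mxE; case: (_ && _); rewrite ?normr1 // normr0.
move=> i j s t /andP[s0 sh] /andP[t0 th]; apply: eP.
rewrite -ball_normE /= !opprD !addrA subrr add0r.
apply: le_lt_trans (ler_normB _ _) _; rewrite normrN !normrZ !ger0_norm //.
have H1 : s * `|delta_mx 0 i : 'rV[R]_n| <= e / 4.
  by apply: le_trans sh; rewrite ler_piMr.
have H2 : t * `|delta_mx 0 j : 'rV[R]_n| <= e / 4.
  by apply: le_trans th; rewrite ler_piMr.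
by apply: le_lt_trans (lerD H1 H2) _; lra.
Qed.

Lemma dist_le_halves (a b x y e : R) :
  x = y -> `|b - x| <= e / 2 -> `|a - y| <= e / 2 -> `|b - a| <= e.
Proof.
move=> -> hb ha; rewrite (splitr e) -(subrKA y).
by apply: le_trans (ler_normD _ _) _; apply: lerD => //; rewrite distrC.
Qed.

(** Each mixed derivative, at some point of the same small square, equals the second difference over
    that square divided by h^2. Continuity brings both within e / 2 of their values at [u]. *)
Lemma partial_sym n (U : set 'rV[R]_n) (f : 'rV[R]_n -> R) (i j : 'I_n) u :
  open U -> U u -> Ck_on 2 U f -> partial i (partial j f) u = partial j (partial i f) u.
Proof.
move=> oU Uu fC; have [df pf] := fC.
have Ccont i' j' : {for u, continuous (partial i' (partial j' f))}.
  by have [_ /(_ i') c] := pf j'; exact: c.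
apply/eqP; rewrite eq_sym -subr_eq0 -normr_le0; apply/ler_addgt0Pl => e e0; rewrite addr0.
have e2 : 0 < e / 2 by rewrite divr_gt0.
have nU : nbhs u U by exact: open_nbhs_nbhs.
have n1 := (cvgrPdist_le _ _).1 (Ccont i j) _ e2.
have n2 := (cvgrPdist_le _ _).1 (Ccont j i) _ e2.
have [h h0 hP] := small_square (filterI nU (filterI (n1 _) (n2 _))).
have [s [t [sh th E1]]] := second_difference (i := i) (j := j) fC h0
  (fun s t sh th => (hP i j s t sh th).1).
have [s' [t' [sh' th' E2]]] := second_difference (i := j) (j := i) fC h0
  (fun s t sh th => (hP j i s t sh th).1).
have [_ [_ /= H1]] := hP i j s t sh th.
have [_ [/= H2 _]] := hP j i s' t' sh' th'.
have E : partial j (partial i f) (u + s *: delta_mx 0 i + t *: delta_mx 0 j) =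
    partial i (partial j f) (u + s' *: delta_mx 0 j + t' *: delta_mx 0 i).
  apply: (mulIf (lt0r_neq0 h0)); apply: (mulIf (lt0r_neq0 h0)).
  refine (etrans (esym E1) (etrans _ E2)).
  rewrite [in RHS](addrAC u (h *: delta_mx 0 j)).
  have sub4 (x y z v : R) : x - y - (z - v) = x - z - (y - v) by ring.
  exact: sub4.
exact: dist_le_halves E H1 H2.
Qed.

Lemma line_nbhs n (u : 'rV[R]_n) (P : set 'rV[R]_n) (i : 'I_n) : nbhs u P ->
  exists2 h : R, 0 < h & forall t, `|t| <= h -> P (u + t *: delta_mx 0 i).
Proof.
move=> nP; have nP' : nbhs (0 : R) [set t | P (u + t *: delta_mx 0 i)].
  have cl : {for 0, continuous (fun t : R => u + t *: (delta_mx 0 i : 'rV[R]_n))}.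
    by apply: continuousD; [exact: cst_continuous|exact: scalel_continuous].
  by apply: cl; rewrite scale0r addr0.
have [e /= e0 eP] := (nbhs_ballP _ _).1 nP'.
exists (e / 2) => [|t th]; first by rewrite divr_gt0.
by apply: eP; rewrite -ball_normE /= sub0r normrN; apply: le_lt_trans th _; lra.
Qed.

Lemma partial_at_max n (U : set 'rV[R]_n) (f : 'rV[R]_n -> R) (i : 'I_n) u :
  open U -> U u -> Ck_on 1 U f -> (forall v, U v -> f v <= f u) -> partial i f u = 0.
Proof.
move=> oU Uu [df _] fmax; have nU : nbhs u U by exact: open_nbhs_nbhs.
have [h h0 hP] := line_nbhs i nU.
have dl (t : R) : t \in `]-h, h[%R -> is_derive t 1 (fun s => f (u + s *: delta_mx 0 i))
    (partial i f (u + t *: delta_mx 0 i)).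
  rewrite in_itv /= -ltr_norml => /ltW th.
  by apply: is_derive_line; apply: df; exact: hP.
have z : 0 \in `]-h, h[%R by rewrite in_itv /= oppr_lt0 h0.
have hh : - h <= h by rewrite ge0_cp // ltW.
have fm (t : R) : t \in `]-h, h[%R -> f (u + t *: delta_mx 0 i) <= f (u + 0 *: delta_mx 0 i).
  rewrite in_itv /= -ltr_norml => /ltW th.
  by rewrite scale0r addr0; apply: fmax; exact: hP.
have d0 := @derive1_at_max _ (fun s => f (u + s *: delta_mx 0 i)) (-h) h 0 hh
  (fun t th => @ex_derive _ _ _ _ _ _ _ (dl t th)) z fm.
have E : partial i f (u + 0 *: delta_mx 0 i) = 0.
  exact: etrans (esym (@derive_val _ _ _ _ _ _ _ (dl 0 z))) (@derive_val _ _ _ _ _ _ _ d0).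
by move: E; rewrite scale0r addr0.
Qed.

(** Were the second derivative positive, it would be so along a short segment from [u]. The mean
    value theorem, applied once to f and once to its first derivative, which vanishes at [u], would
    then give a value larger than the maximum. *)
Lemma partial_partial_max n (U : set 'rV[R]_n) (f : 'rV[R]_n -> R) (i : 'I_n) u :
  open U -> U u -> Ck_on 2 U f -> (forall v, U v -> f v <= f u) ->
  partial i (partial i f) u <= 0.
Proof.
move=> oU Uu fC fmax; have [df pf] := fC; have [dpf cpf] := pf i.
have p0 := partial_at_max i oU Uu (Ck_onW fC) fmax.
have nU : nbhs u U by exact: open_nbhs_nbhs.
rewrite leNgt; apply/negP => ppos.
have npos : \near u, 0 < partial i (partial i f) u.
  exact: (@cvgr_gt _ _ _ _ _ _ (cpf i u Uu) _ ppos).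
have [h h0 hP] := line_nbhs i (filterI nU npos).
have hP' t : t \in `[0, h]%R -> U (u + t *: delta_mx 0 i) /\
    0 < partial i (partial i f) (u + t *: delta_mx 0 i).
  by rewrite in_itv /= => /andP[t0 th]; apply: hP; rewrite ger0_norm.
have sub t : t \in `]0, h[%R -> t \in `[0, h]%R by apply: subset_itvW.
have [t th E] := @MVT _ (fun s => f (u + s *: delta_mx 0 i))
    (fun s => partial i f (u + s *: delta_mx 0 i)) _ _ h0
    (fun t th => is_derive_line (df _ (hP' t (sub t th)).1))
    (derivable_within_continuous (fun t th => @ex_derive _ _ _ _ _ _ _
      (is_derive_line (df _ (hP' t th).1)))).
have t0 : 0 < t by move: th; rewrite in_itv /= => /andP[].
have th' : t <= h by move: th; rewrite in_itv /= => /andP[_ /ltW].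
have sub' s : s \in `[0, t]%R -> s \in `[0, h]%R.
  by rewrite !in_itv /= => /andP[-> /le_trans]; apply.
have sub'' s : s \in `]0, t[%R -> s \in `[0, h]%R.
  by move=> st; apply: sub'; exact: subset_itvW st.
have [s st E'] := @MVT _ (fun s => partial i f (u + s *: delta_mx 0 i))
    (fun s => partial i (partial i f) (u + s *: delta_mx 0 i)) _ _ t0
    (fun s st => is_derive_line (dpf _ (hP' s (sub'' s st)).1))
    (derivable_within_continuous (fun s st => @ex_derive _ _ _ _ _ _ _
      (is_derive_line (dpf _ (hP' s (sub' s st)).1)))).
have [_ spos] := hP' _ (sub'' _ st).
rewrite scale0r addr0 p0 !subr0 in E'.
rewrite scale0r addr0 subr0 E' in E.
have [Uh _] : U (u + h *: delta_mx 0 i) /\ 0 < partial i (partial i f) (u + h *: delta_mx 0 i).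
  by apply: hP'; rewrite in_itv /= lexx ltW.
have := fmax _ Uh; rewrite -subr_le0 E leNgt => /negP; apply.
by rewrite !mulr_gt0.
Qed.

End SecondDerivatives.

(** * Calculus in charts *)

Section ChartCalculus.
Context {R : realType}.
Implicit Types (W : normedModType R).

(** A chart grants openness only for the image of its whole domain; for a smaller open set it is
    recovered from the continuity of [param]. *)
Lemma chart_image_open n (M : topologicalType) (c : chart R n M) (O : set M) :
  open O -> O `<=` dom c -> open (coord c @` O).
Proof.
move=> oO Oc; rewrite openE => u [p Op <-]; rewrite /interior.
have ic : (coord c @` dom c) (coord c p) by exists p => //; exact: Oc.
have nO : nbhs (coord c p) (param c @^-1` O).
  have cpar : param c @ coord c p --> p.
    by rewrite -{2}(coordK (Oc _ Op)); exact: param_continuous.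
  exact: cpar _ (open_nbhs_nbhs (conj oO Op)).
have nI : nbhs (coord c p) (coord c @` dom c).
  by apply: open_nbhs_nbhs; split=> //; exact: image_open.
apply: filterS (filterI nO nI) => v [/= Ov [q cq E]]; exists q => //.
by rewrite -(coordK cq) E.
Qed.

Lemma near_param n (M : topologicalType) (c : chart R n M) (P : set M) p :
  dom c p -> nbhs p P -> \forall u \near coord c p, P (param c u).
Proof.
move=> cp nP; have ic : (coord c @` dom c) (coord c p) by exists p.
have cpar : param c @ coord c p --> p.
  by rewrite -{2}(coordK cp); exact: param_continuous.
exact: (cpar _ nP).
Qed.

Definition dfr n (M : manifold R n) W (c : chart R n M) (f : M -> W) (p : M) :=
  differentiable (f \o param c) (coord c p).

(** Regularity in a single chart and on a part O of its domain: for objects along a map, O is the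
    overlap with the preimage of a chart of the target. *)
Definition CkM k n (M : manifold R n) W (c : chart R n M) (O : set M) (f : M -> W) :=
  Ck_on k (coord c @` O) (f \o param c).

Section OneManifold.
Context n (M : manifold R n).
Implicit Types (c d : chart R n M).

Lemma near_pd W c i (f g : M -> W) p : dom c p -> (\near p, f p = g p) ->
  pd c i f p = pd c i g p.
Proof.
move=> cp fg; apply: near_partial; exact: (near_param cp fg).
Qed.

Lemma near_dfr W c (f g : M -> W) p : dom c p -> (\near p, f p = g p) ->
  dfr c f p -> dfr c g p.
Proof.
move=> cp fg; apply: near_differentiable; exact: (near_param cp fg).
Qed.

Lemma pdD W c i (f g : M -> W) p : dfr c f p -> dfr c g p ->
  pd c i (fun q => f q + g q) p = pd c i f p + pd c i g p.
Proof. exact: partialD. Qed.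

Lemma dfr_cst W c (w : W) p : dfr c (fun=> w) p.
Proof. exact: differentiable_cst. Qed.

Lemma pd_cst W c i (w : W) p : pd c i (fun=> w) p = 0.
Proof. exact: derive_cst. Qed.

Lemma dfrD W c (f g : M -> W) p : dfr c f p -> dfr c g p ->
  dfr c (fun q => f q + g q) p.
Proof. exact: differentiableD. Qed.

Lemma dfr_bilinear (V1 V2 W : normedModType R) (B : {bilinear V1 -> V2 -> W}) c
    (f : M -> V1) (g : M -> V2) p : continuous (fun q => B q.1 q.2) ->
  dfr c f p -> dfr c g p -> dfr c (fun q => B (f q) (g q)) p.
Proof. exact: differentiable_bilinear. Qed.

Lemma pd_bilinear (V1 V2 W : normedModType R) (B : {bilinear V1 -> V2 -> W}) c i
    (f : M -> V1) (g : M -> V2) p : continuous (fun q => B q.1 q.2) -> dom c p ->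
  dfr c f p -> dfr c g p ->
  pd c i (fun q => B (f q) (g q)) p = B (pd c i f p) (g p) + B (f p) (pd c i g p).
Proof.
move=> Bc cp df dg; have := partial_bilinear i Bc df dg.
by rewrite /= coordK.
Qed.

Lemma dfrZ W c (f : M -> R) (g : M -> W) p :
  dfr c f p -> dfr c g p -> dfr c (fun q => f q *: g q) p.
Proof. exact: (@dfr_bilinear _ _ _ (@GRing.scale R W) c f g p (@continuous_scale _ _)). Qed.

Lemma pdZ W c i (f : M -> R) (g : M -> W) p : dom c p -> dfr c f p -> dfr c g p ->
  pd c i (fun q => f q *: g q) p = pd c i f p *: g p + f p *: pd c i g p.
Proof. exact: (@pd_bilinear _ _ _ (@GRing.scale R W) c i f g p (@continuous_scale _ _)). Qed.

Lemma pdM c i (f g : M -> R) p : dom c p -> dfr c f p -> dfr c g p ->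
  pd c i (fun q => f q * g q) p = pd c i f p * g p + f p * pd c i g p.
Proof. exact: (@pdZ R^o). Qed.

Lemma dfr_mulmx a b e c (f : M -> 'M[R]_(a, b)) (g : M -> 'M[R]_(b, e)) p :
  dfr c f p -> dfr c g p -> dfr c (fun q => f q *m g q) p.
Proof. exact: (@dfr_bilinear _ _ _ (@mulmx R a b e) c f g p (@continuous_mulmx _ _ _ _)). Qed.

Lemma pd_mulmx a b e c i (f : M -> 'M[R]_(a, b)) (g : M -> 'M[R]_(b, e)) p :
  dom c p -> dfr c f p -> dfr c g p ->
  pd c i (fun q => f q *m g q) p = pd c i f p *m g p + f p *m pd c i g p.
Proof. exact: (@pd_bilinear _ _ _ (@mulmx R a b e) c i f g p (@continuous_mulmx _ _ _ _)). Qed.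

Lemma dfr_sum W c (I : Type) (r : seq I) (f : I -> M -> W) p :
  (forall j, dfr c (f j) p) -> dfr c (fun q => \sum_(j <- r) f j q) p.
Proof.
move=> df; elim: r => [|j r IH].
  rewrite (_ : (fun q => _) = fun=> 0); first exact: dfr_cst.
  by apply/funext => q; rewrite big_nil.
rewrite (_ : (fun q => _) = fun q => f j q + \sum_(j <- r) f j q); first exact: dfrD.
by apply/funext => q; rewrite big_cons.
Qed.

Lemma pd_sum W c i (I : Type) (r : seq I) (f : I -> M -> W) p :
  (forall j, dfr c (f j) p) ->
  pd c i (fun q => \sum_(j <- r) f j q) p = \sum_(j <- r) pd c i (f j) p.
Proof.
move=> df; elim: r => [|j r IH].
  rewrite big_nil (_ : (fun q => _) = fun=> 0); first exact: pd_cst.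
  by apply/funext => q; rewrite big_nil.
rewrite big_cons -IH -pdD //; last exact: dfr_sum.
by congr pd; apply/funext => q; rewrite big_cons.
Qed.

Lemma dfr_mx a b c (f : M -> 'M[R]_(a, b)) p :
  (forall i j, dfr c (fun q => f q i j) p) -> dfr c f p.
Proof. exact: differentiable_mx. Qed.

Lemma dfr_entry a b c (f : M -> 'M[R]_(a, b)) i j p :
  dfr c f p -> dfr c (fun q => f q i j) p.
Proof.
move=> df; have dd := differentiable_coord ((f \o param c) (coord c p)) i j.
exact: (differentiable_comp df dd).
Qed.

Lemma pd_entry a b c l (f : M -> 'M[R]_(a, b)) i j p :
  dfr c f p -> pd c l (fun q => f q i j) p = pd c l f p i j.
Proof. exact: partial_entry. Qed.

Lemma dfr_tr a b c (f : M -> 'M[R]_(a, b)) p :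
  dfr c f p -> dfr c (fun q => (f q)^T) p.
Proof.
move=> df; apply: dfr_mx => i j.
by rewrite (_ : (fun q => _) = fun q => f q j i); [exact: dfr_entry|apply/funext => q; rewrite mxE].
Qed.

Lemma pd_tr a b c l (f : M -> 'M[R]_(a, b)) p :
  dfr c f p -> pd c l (fun q => (f q)^T) p = (pd c l f p)^T.
Proof.
move=> df; apply/matrixP => i j; rewrite -pd_entry; last exact: dfr_tr.
have E : (fun q => (f q)^T i j) = (fun q => f q j i) by apply/funext => q; rewrite mxE.
by rewrite E (pd_entry l j i df) [RHS]mxE.
Qed.

Section OnOpen.
Context (c : chart R n M) (O : set M) (oO : open O) (Oc : O `<=` dom c).

Lemma eq_CkM k W (f g : M -> W) : (forall p, O p -> f p = g p) -> CkM k c O f -> CkM k c O g.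
Proof.
move=> fg; apply: eq_Ck_on; first exact: chart_image_open.
by move=> _ [p Op <-] /=; rewrite coordK ?fg //; exact: Oc.
Qed.

Lemma CkM_dfr k W (f : M -> W) p : CkM k.+1 c O f -> O p -> dfr c f p.
Proof. by move=> [h _] Op; apply: h; exists p. Qed.

Lemma CkM_pd k W (f : M -> W) i : CkM k.+1 c O f -> CkM k c O (pd c i f).
Proof.
move=> [_ /(_ i)]; apply: eq_Ck_on; first exact: chart_image_open.
by move=> _ [p Op <-] /=; rewrite /pd coordK //; exact: Oc.
Qed.

Lemma CkM_continuous k W (f : M -> W) p : CkM k c O f -> O p -> {for p, continuous f}.
Proof.
move=> /Ck_on_continuous fC Op.
have cf := fC (coord c p) (ex_intro2 _ _ p Op erefl).
have cc := coord_continuous (Oc Op).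
have : {for p, continuous ((f \o param c) \o coord c)} by exact: continuous_comp.
rewrite /prop_for /continuous_at /= coordK; last exact: Oc.
apply: cvg_trans; apply: near_eq_cvg.
apply: (open_near oO Op) => q Oq; rewrite /= coordK //; exact: Oc.
Qed.

Lemma CkMW k W (f : M -> W) : CkM k.+1 c O f -> CkM k c O f.
Proof. exact: Ck_onW. Qed.

Let oU := chart_image_open oO Oc.

Lemma CkM_cst k W (w : W) : CkM k c O (fun=> w).
Proof. exact: Ck_on_cst. Qed.

Lemma CkMD k W (f g : M -> W) : CkM k c O f -> CkM k c O g -> CkM k c O (fun p => f p + g p).
Proof. exact: (Ck_onD oU). Qed.

Lemma CkMB k W (f g : M -> W) : CkM k c O f -> CkM k c O g -> CkM k c O (fun p => f p - g p).
Proof. exact: (Ck_onB oU). Qed.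

Lemma CkM_sum k W (I : Type) (r : seq I) (P : pred I) (f : I -> M -> W) :
  (forall i, P i -> CkM k c O (f i)) -> CkM k c O (fun p => \sum_(i <- r | P i) f i p).
Proof. by move=> fC; exact: (@Ck_on_sum _ k _ W _ I r P (fun i => f i \o param c) oU fC). Qed.

Lemma CkM_prod k (I : Type) (r : seq I) (P : pred I) (f : I -> M -> R) :
  (forall i, P i -> CkM k c O (f i)) -> CkM k c O (fun p => \prod_(i <- r | P i) f i p).
Proof. by move=> fC; exact: (@Ck_on_prod _ k _ _ I r P (fun i => f i \o param c) oU fC). Qed.

Lemma CkMZ k W (f : M -> R) (g : M -> W) :
  CkM k c O f -> CkM k c O g -> CkM k c O (fun p => f p *: g p).
Proof. exact: (Ck_onZ oU). Qed.

Lemma CkMM k (f g : M -> R) : CkM k c O f -> CkM k c O g -> CkM k c O (fun p => f p * g p).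
Proof. exact: (Ck_onM oU). Qed.

Lemma CkM_mulmx k a b e (f : M -> 'M[R]_(a, b)) (g : M -> 'M[R]_(b, e)) :
  CkM k c O f -> CkM k c O g -> CkM k c O (fun p => f p *m g p).
Proof. exact: (Ck_on_mulmx oU). Qed.

Lemma CkM_entry k a b (f : M -> 'M[R]_(a, b)) i j : CkM k c O f -> CkM k c O (fun p => f p i j).
Proof. exact: (Ck_on_entry i j oU). Qed.

Lemma CkM_mx k a b (f : M -> 'M[R]_(a, b)) :
  (forall i j, CkM k c O (fun p => f p i j)) -> CkM k c O f.
Proof. exact: (Ck_on_mx oU). Qed.

Lemma CkM_tr k a b (f : M -> 'M[R]_(a, b)) : CkM k c O f -> CkM k c O (fun p => (f p)^T).
Proof. exact: (Ck_on_tr oU). Qed.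

Lemma CkMV k (f : M -> R) : (forall p, O p -> f p != 0) ->
  CkM k c O f -> CkM k c O (fun p => (f p)^-1).
Proof.
move=> f0; apply: (Ck_onV oU) => _ [p Op <-] /=.
by rewrite coordK ?f0 //; exact: Oc.
Qed.

Lemma CkM_sqrt k (f : M -> R) : (forall p, O p -> 0 < f p) ->
  CkM k c O f -> CkM k c O (fun p => Num.sqrt (f p)).
Proof.
move=> f0; apply: (Ck_on_sqrt oU) => _ [p Op <-] /=.
by rewrite coordK ?f0 //; exact: Oc.
Qed.

Lemma CkM_det k a (f : M -> 'M[R]_a) : CkM k c O f -> CkM k c O (fun p => \det (f p)).
Proof.
move=> fC; apply: CkM_sum => s _; apply: CkMM; first exact: CkM_cst.
by apply: CkM_prod => i _; exact: CkM_entry.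
Qed.

Lemma CkM_invmx k a (f : M -> 'M[R]_a) : (forall p, O p -> f p \in unitmx) ->
  CkM k c O f -> CkM k c O (fun p => invmx (f p)).
Proof.
move=> fu fC.
have C1 : CkM k c O (fun p => (\det (f p))^-1 *: \adj (f p)).
  apply: CkMZ.
    by apply: CkMV; [move=> p Op; have := fu p Op; rewrite unitmxE unitfE|exact: CkM_det].
  apply: CkM_mx => i j; apply: (@eq_CkM _ _ (fun p => cofactor (f p) j i)).
    by move=> p _; rewrite mxE.
  apply: CkMM; first exact: CkM_cst.
  apply: CkM_det; apply: CkM_mx => a1 a2.
  apply: (@eq_CkM _ _ (fun p => f p (lift j a1) (lift i a2))); last exact: CkM_entry.
  by move=> p _; rewrite !mxE.
by apply: eq_CkM C1 => p Op; rewrite /invmx fu.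
Qed.

Lemma CkM_sub k W (O' : set M) (f : M -> W) : O' `<=` O -> CkM k c O f -> CkM k c O' f.
Proof. by move=> O'O; apply: Ck_on_sub => _ [p Op <-]; exists p => //; exact: O'O. Qed.

End OnOpen.

Lemma pd_sym c (O : set M) (f : M -> R) i j p : open O -> O `<=` dom c -> O p ->
  CkM 2 c O f -> pd c i (pd c j f) p = pd c j (pd c i f) p.
Proof.
move=> oO Oc Op fC; have oU := chart_image_open oO Oc.
have Up : (coord c @` O) (coord c p) by exists p.
have E k l : pd c k (pd c l f) p = partial k (partial l (f \o param c)) (coord c p).
  apply: near_partial; apply: (open_near oU Up) => _ [q Oq <-] /=.
  by rewrite /pd coordK //; exact: Oc.
by rewrite !E; exact: (partial_sym i j oU Up fC).
Qed.

End OneManifold.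

Section Maps.
Context m n (S : manifold R m) (N : manifold R n) (F : S -> N).
Implicit Types (c : chart R m S) (d : chart R n N).

Lemma CkM_comp k W c d (O : set S) (Q : set N) (f : N -> W) : open O -> O `<=` dom c ->
  Q `<=` dom d -> (forall p, O p -> Q (F p)) -> CkM k d Q f -> CkM k c O (coord d \o F) ->
  CkM k c O (fun p => f (F p)).
Proof.
move=> oO Oc Qd OF fC FC; have oU := chart_image_open oO Oc.
have UV u : (coord c @` O) u -> (coord d @` Q) ((coord d \o F \o param c) u).
  by move=> [p Op <-]; exists (F p); rewrite /= ?coordK //; [exact: OF|exact: Oc].
have := Ck_on_comp oU UV fC FC.
apply: (eq_CkM oO Oc (f := fun p => f (param d (coord d (F p))))) => p Op.
by rewrite coordK //; apply: Qd; exact: OF.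
Qed.

Lemma near_map (O : set N) p : {for p, continuous F} -> open O -> O (F p) -> \near p, O (F p).
Proof. by move=> cF oO OF; apply: cF; exact: open_nbhs_nbhs. Qed.

(** Since [param d] inverts [coord d] only on [dom d], the factorization of f o F through the chart
    d holds merely near p, by continuity of F. *)
Lemma dfr_comp W c d (f : N -> W) p : {for p, continuous F} -> dom c p -> dom d (F p) ->
  dfr c (coord d \o F) p -> dfr d f (F p) -> dfr c (fun q => f (F q)) p.
Proof.
move=> cF cp dF dc df.
apply: (near_dfr (f := fun q => f (param d (coord d (F q)))) cp).
  have := near_map cF (@dom_open _ _ _ d) dF.
  by apply: filterS => q dq; rewrite coordK.
have df' : differentiable (f \o param d) ((coord d \o F \o param c) (coord c p)).
  by rewrite /= coordK.
exact: (differentiable_comp dc df').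
Qed.

Lemma pd_comp W c d i (f : N -> W) p : {for p, continuous F} -> dom c p -> dom d (F p) ->
  dfr c (coord d \o F) p -> dfr d f (F p) ->
  pd c i (fun q => f (F q)) p = \sum_j pd c i (coord d \o F) p 0 j *: pd d j f (F p).
Proof.
move=> cF cp dF dc df.
rewrite (near_pd (g := fun q => f (param d (coord d (F q)))) i cp); last first.
  have := near_map cF (@dom_open _ _ _ d) dF.
  by apply: filterS => q dq; rewrite coordK.
have df' : differentiable (f \o param d) ((coord d \o F \o param c) (coord c p)).
  by rewrite /= coordK.
by rewrite /pd (partial_comp i dc df') /= coordK.
Qed.

End Maps.

End ChartCalculus.

Lemma pd_max (R : realType) n (M : manifold R n) (c : chart R n M) (f : M -> R) i p :
  dom c p -> CkM 2 c (dom c) f -> (forall q, f q <= f p) ->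
  pd c i f p = 0 /\ pd c i (pd c i f) p <= 0.
Proof.
move=> cp fC fmax; have oU := chart_image_open (@dom_open _ _ _ c) (fun _ h => h).
have Up : (coord c @` dom c) (coord c p) by exists p.
have fm v : (coord c @` dom c) v -> (f \o param c) v <= (f \o param c) (coord c p).
  by move=> [q cq <-]; rewrite /= !coordK.
split; first exact: (partial_at_max i oU Up (CkMW fC) fm).
have -> : pd c i (pd c i f) p = partial i (partial i (f \o param c)) (coord c p).
  apply: near_partial; apply: (open_near oU Up) => _ [q cq <-].
  by rewrite /pd /= coordK.
exact: (partial_partial_max i oU Up fC fm).
Qed.

(* Without this, conversion checks between derivatives of different functions
   unfold the underlying limits and do not terminate in practice. *)
Opaque pd partial dfr.

(** * Metrics and Christoffel symbols *)

Section MetricAlgebra.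
Context {R : realType}.

Lemma pairingE n (G : 'M[R]_n) (u v : 'rV[R]_n) :
  pairing G u v = \sum_i \sum_j u 0 i * G i j * v 0 j.
Proof.
rewrite /pairing mxE exchange_big; apply: eq_bigr => j _.
by rewrite mxE mulr_suml; apply: eq_bigr => i _; rewrite mxE.
Qed.

Lemma pairing_sym n (G : 'M[R]_n) (u v : 'rV[R]_n) : G^T = G ->
  pairing G u v = pairing G v u.
Proof.
move=> GT; rewrite /pairing -[in LHS](trmxK (u *m G *m v^T)) mxE.
by rewrite trmx_mul trmxK trmx_mul GT mulmxA.
Qed.

Lemma pairingDl n (G : 'M[R]_n) (u u' v : 'rV[R]_n) :
  pairing G (u + u') v = pairing G u v + pairing G u' v.
Proof. by rewrite /pairing !mulmxDl mxE. Qed.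

Lemma pairingZl n (G : 'M[R]_n) a (u v : 'rV[R]_n) :
  pairing G (a *: u) v = a * pairing G u v.
Proof. by rewrite /pairing -!scalemxAl mxE. Qed.

Lemma pairing_suml n (G : 'M[R]_n) (I : Type) (r : seq I) (u : I -> 'rV[R]_n) v :
  pairing G (\sum_(i <- r) u i) v = \sum_(i <- r) pairing G (u i) v.
Proof. by rewrite /pairing !mulmx_suml summxE. Qed.

Lemma pairing_mul n m (G : 'M[R]_n) (J : 'M[R]_(m, n)) (u v : 'rV[R]_m) :
  pairing (J *m G *m J^T) u v = pairing G (u *m J) (v *m J).
Proof. by rewrite /pairing trmx_mul !mulmxA. Qed.

Lemma pairing_mul2 n m (G : 'M[R]_n) (X Y : 'M[R]_(m, n)) (u v : 'rV[R]_m) :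
  pairing (X *m G *m Y^T) u v = pairing G (u *m X) (v *m Y).
Proof. by rewrite /pairing trmx_mul !mulmxA. Qed.

Lemma pairingDm n (G G' : 'M[R]_n) (u v : 'rV[R]_n) :
  pairing (G + G') u v = pairing G u v + pairing G' u v.
Proof. by rewrite /pairing mulmxDr mulmxDl mxE. Qed.

(** A vector in the kernel of G would pair to zero with itself. *)
Lemma posdef_unit n (G : 'M[R]_n) :
  (forall v, v != 0 -> 0 < pairing G v v) -> G \in unitmx.
Proof.
move=> Gpos; rewrite -row_free_unit -kermx_eq0; apply/eqP/row_matrixP => i.
rewrite row0; apply/eqP/negPn/negP => /Gpos.
have -> : pairing G (row i (kermx G)) (row i (kermx G)) = 0.
  by rewrite /pairing -row_mul mulmx_ker row0 mul0mx mxE.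
by rewrite ltxx.
Qed.

Lemma congruence_unit n (G B : 'M[R]_n) :
  B *m G *m B^T \in unitmx -> B \in unitmx.
Proof. by rewrite !unitmx_mul => /andP[/andP[]]. Qed.

Lemma invmx_congruence n (G B : 'M[R]_n) : B *m G *m B^T \in unitmx ->
  B^T *m invmx (B *m G *m B^T) *m B = invmx G.
Proof.
move=> U; have Bu := congruence_unit U.
have Gu : G \in unitmx by move: U; rewrite !unitmx_mul => /andP[/andP[]].
have BTu : B^T \in unitmx by rewrite unitmx_tr.
have := mulmxV U; set I := invmx (B *m G *m B^T) => E.
have E' : G *m (B^T *m I *m B) = 1%:M.
  apply: (can_inj (mulKmx Bu)); rewrite mulmx1 !mulmxA E.
  by rewrite mul1mx.
by rewrite -[LHS](mulKmx Gu) E' mulmx1.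
Qed.

Lemma trmx_invmx n (G : 'M[R]_n) : G^T = G -> (invmx G)^T = invmx G.
Proof. by move=> GT; rewrite trmx_inv GT. Qed.

(** The trace of a bilinear form with respect to a metric does not depend on the basis. Values in a
    module allow the vector-valued second fundamental form as well as the scalar one. *)
Lemma contract_congruence (W : lmodType R) n (G B : 'M[R]_n) (T T' : 'I_n -> 'I_n -> W) :
  B *m G *m B^T \in unitmx ->
  (forall i j, T' i j = \sum_k \sum_l (B i k * B j l) *: T k l) ->
  \sum_i \sum_j invmx (B *m G *m B^T) i j *: T' i j =
  \sum_i \sum_j invmx G i j *: T i j.
Proof.
move=> U TE; rewrite -(invmx_congruence U).
set I := invmx _.
under eq_bigr do under eq_bigr do rewrite TE scaler_sumr.
under eq_bigr do rewrite exchange_big /=.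
rewrite exchange_big /=; apply: eq_bigr => k _.
under eq_bigr do under eq_bigr do rewrite scaler_sumr.
under eq_bigr do rewrite exchange_big /=.
rewrite exchange_big /=; apply: eq_bigr => l _.
rewrite mxE scaler_suml exchange_big; apply: eq_bigr => j _.
rewrite mxE mulr_suml scaler_suml; apply: eq_bigr => i _.
by rewrite scalerA !mxE; congr (_ *: _); rewrite mulrA [in LHS](mulrC (I i j)) .
Qed.

End MetricAlgebra.

Section Christoffel.
Context {R : realType} n (M : manifold R n).
Implicit Types (d : chart R n M) (g : metric_field M).

(** The Jacobian of a change of chart, with rows indexed by the old coordinates. It is written with
    [pd], to which the product and chain rules apply; [jacE] identifies it with ['J]. *)
Definition jac d d' (q : M) : 'M[R]_n := \matrix_(i, j) pd d i (coord d') q 0 j.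

Definition dird (W : normedModType R) d (f : M -> W) (q : M) (u : 'rV[R]_n) : W :=
  \sum_i u 0 i *: pd d i f q.

Definition christ g d q (u v : 'rV[R]_n) : 'rV[R]_n :=
  \row_k \sum_l \sum_m christoffel g d q k l m * u 0 l * v 0 m.

Lemma pairing_dird d (f : M -> 'M[R]_n) q u v w :
  pairing (dird d f q u) v w =
  \sum_i \sum_j \sum_k u 0 i * v 0 j * w 0 k * pd d i f q j k.
Proof.
rewrite pairingE; under eq_bigr do under eq_bigr do rewrite summxE mulr_sumr mulr_suml.
under eq_bigr do rewrite exchange_big /=.
rewrite exchange_big /=; apply: eq_bigr => i _; apply: eq_bigr => j _; apply: eq_bigr => k _.
by rewrite mxE; ring.
Qed.

(** The Koszul formula for fields with constant components. Pairing with an arbitrary w removes the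
    inverse metric from the Christoffel symbols, which makes their change of chart tractable. *)
Lemma christ_pairing g d q u v w : dfr d (g d) q -> g d q \in unitmx -> (g d q)^T = g d q ->
  pairing (g d q) (christ g d q u v) w =
  2^-1 * (pairing (dird d (g d) q u) v w + pairing (dird d (g d) q v) u w
          - pairing (dird d (g d) q w) u v).
Proof.
move=> dg gu gs.
have [D [DE DE2]] : exists D : 'I_n -> 'I_n -> 'I_n -> R,
    (forall i j k, pd d i (fun r => g d r j k) q = D i j k) /\
    (forall i j k, pd d i (g d) q j k = D i j k).
  by exists (fun i j k => pd d i (g d) q j k); split=> // i j k; exact: pd_entry.
(* The covector on the right-hand side of the Koszul formula; raising its index gives the
   Christoffel term. *)
pose t : 'rV[R]_n := \row_k (2^-1 * \sum_i \sum_j u 0 i * v 0 j * (D i j k + D j i k - D k i j)).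
have -> : christ g d q u v = t *m invmx (g d q).
  apply/rowP => k; rewrite !mxE.
  under [RHS]eq_bigr do rewrite mxE mulrAC mulr_sumr.
  rewrite [RHS]exchange_big /=; apply: eq_bigr => i _.
  under [RHS]eq_bigr do rewrite mulr_sumr.
  rewrite [RHS]exchange_big /=; apply: eq_bigr => j _.
  rewrite /christoffel mulr_sumr !mulr_suml.
  apply: eq_bigr => l _; rewrite !DE.
  have -> : invmx (g d q) l k = invmx (g d q) k l by rewrite -{1}(trmx_invmx gs) mxE.
  by ring.
rewrite /pairing mulmxKV // -!/(pairing _ _ _).
rewrite mxE !pairing_dird.
under [in RHS]eq_bigr do under eq_bigr do under eq_bigr do rewrite DE2.
under [X in _ + X - _]eq_bigr do under eq_bigr do under eq_bigr do rewrite DE2.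
under [X in _ - X]eq_bigr do under eq_bigr do under eq_bigr do rewrite DE2.
have -> : \sum_i \sum_j \sum_k v 0 i * u 0 j * w 0 k * D i j k =
    \sum_i \sum_j \sum_k u 0 i * v 0 j * w 0 k * D j i k.
  rewrite exchange_big; apply: eq_bigr => i _; apply: eq_bigr => j _; apply: eq_bigr => k _.
  by ring.
have -> : \sum_i \sum_j \sum_k w 0 i * u 0 j * v 0 k * D i j k =
    \sum_i \sum_j \sum_k u 0 i * v 0 j * w 0 k * D k i j.
  rewrite exchange_big; apply: eq_bigr => i _.
  rewrite exchange_big; apply: eq_bigr => j _; apply: eq_bigr => k _.
  by ring.
under [LHS]eq_bigr do rewrite !mxE -mulrA mulr_suml.
rewrite -mulr_sumr; congr (_ * _); rewrite -big_split -sumrB exchange_big /=.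
apply: eq_bigr => i _; under [LHS]eq_bigr do rewrite mulr_suml.
rewrite exchange_big -big_split -sumrB /=; apply: eq_bigr => j _.
rewrite -big_split -sumrB /=; apply: eq_bigr => k _.
by ring.
Qed.

Lemma pairing_inj (G : 'M[R]_n) (x y : 'rV[R]_n) : G \in unitmx ->
  (forall w, pairing G x w = pairing G y w) -> x = y.
Proof.
move=> Gu E; apply: (can_inj (mulmxK Gu)); apply/rowP => j.
have := E (delta_mx 0 j); rewrite /pairing trmx_delta.
by rewrite -!colE !mxE.
Qed.

Lemma dird_congruence (A : M -> 'M[R]_n) (G : M -> 'M[R]_n) d q u v w : dom d q ->
  dfr d A q -> dfr d G q ->
  pairing (dird d (fun r => A r *m G r *m (A r)^T) q u) v w =
  pairing (G q) (v *m dird d A q u) (w *m A q)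
  + pairing (dird d G q u) (v *m A q) (w *m A q)
  + pairing (G q) (v *m A q) (w *m dird d A q u).
Proof.
move=> dq dA dG.
have dAG := dfr_mulmx dA dG.
have dAT := dfr_tr dA.
have -> : dird d (fun r => A r *m G r *m (A r)^T) q u =
    dird d A q u *m G q *m (A q)^T + A q *m dird d G q u *m (A q)^T
    + A q *m G q *m (dird d A q u)^T.
  have -> : dird d A q u *m G q *m (A q)^T = \sum_i u 0 i *: (pd d i A q *m G q *m (A q)^T).
    by rewrite /dird !mulmx_suml; apply: eq_bigr => i _; rewrite -!scalemxAl.
  have -> : A q *m dird d G q u *m (A q)^T = \sum_i u 0 i *: (A q *m pd d i G q *m (A q)^T).
    rewrite /dird mulmx_sumr mulmx_suml; apply: eq_bigr => i _.
    by rewrite -scalemxAr -scalemxAl.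
  have -> : A q *m G q *m (dird d A q u)^T = \sum_i u 0 i *: (A q *m G q *m (pd d i A q)^T).
    rewrite /dird linear_sum mulmx_sumr; apply: eq_bigr => i _ /=.
    by rewrite linearZ /= -scalemxAr.
  rewrite /dird -!big_split; apply: eq_bigr => i _ /=.
  rewrite (pd_mulmx i dq dAG dAT) (pd_mulmx i dq dA dG) (pd_tr i dA).
  by rewrite mulmxDl !scalerDr.
by rewrite !pairingDm !pairing_mul2.
Qed.

Lemma dird_near (W : normedModType R) d (f h : M -> W) q u : dom d q ->
  (\near q, f q = h q) -> dird d f q u = dird d h q u.
Proof. by move=> dq fh; apply: eq_bigr => i _; rewrite (near_pd i dq fh). Qed.

Lemma dird_change (W : normedModType R) d d' (f : M -> W) q u : dom d q -> dom d' q ->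
  dfr d (coord d') q -> dfr d' f q -> dird d f q u = dird d' f q (u *m jac d d' q).
Proof.
move=> dq d'q dc df; rewrite /dird.
have cid : {for q, continuous (idfun : M -> M)} by exact: cvg_id.
under eq_bigr => i _ do rewrite (pd_comp (F := idfun) i cid dq d'q dc df) scaler_sumr.
rewrite exchange_big; apply: eq_bigr => j _.
by rewrite mxE scaler_suml; apply: eq_bigr => i _; rewrite scalerA mxE.
Qed.

(** K stands for the derivative of the Jacobian. In the Koszul combination the six terms that
    contain K cancel, by its symmetry, except for twice the pairing of [K u v] with w; this is the
    inhomogeneous term of the transformation law. *)
Lemma koszul_change (G J : 'M[R]_n) (D D' : 'rV[R]_n -> 'M[R]_n)
    (K : 'rV[R]_n -> 'rV[R]_n -> 'rV[R]_n) (u v c c' : 'rV[R]_n) :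
  G \in unitmx -> G^T = G -> J \in unitmx -> (forall x y, K x y = K y x) ->
  (forall x y z, pairing (D x) y z =
    pairing G (K x y) (z *m J) + pairing (D' (x *m J)) (y *m J) (z *m J)
    + pairing G (y *m J) (K x z)) ->
  (forall w, pairing (J *m G *m J^T) c w =
    2^-1 * (pairing (D u) v w + pairing (D v) u w - pairing (D w) u v)) ->
  (forall w, pairing G c' w =
    2^-1 * (pairing (D' (u *m J)) (v *m J) w + pairing (D' (v *m J)) (u *m J) w
            - pairing (D' w) (u *m J) (v *m J))) ->
  c *m J = K u v + c'.
Proof.
move=> Gu Gs Ju Ksym P Pc Pc'; apply: (pairing_inj Gu) => w'.
rewrite -(mulmxKV Ju w'); set w := w' *m invmx J.
rewrite -(pairing_mul G J) Pc !P pairingDl Pc'.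
rewrite (Ksym w v) (Ksym w u) (Ksym v u).
rewrite (pairing_sym (v *m J) _ Gs) (pairing_sym (u *m J) (K v w) Gs).
by field.
Qed.

(** The term with [dird d (jac d d')] is the second derivative of the transition map, symmetric
    because mixed partial derivatives commute. The tensor law of the metric is assumed near q, not
    only at q, because it gets differentiated. *)
Lemma christ_change g d d' q u v : dom d q -> dom d' q ->
  dfr d (coord d') q -> dfr d (jac d d') q ->
  (forall i j k, pd d i (jac d d') q j k = pd d j (jac d d') q i k) ->
  dfr d (g d) q -> dfr d' (g d') q ->
  g d q \in unitmx -> (g d q)^T = g d q -> (g d' q)^T = g d' q ->
  (\near q, g d q = jac d d' q *m g d' q *m (jac d d' q)^T) ->
  christ g d q u v *m jac d d' q =
  v *m dird d (jac d d') q u + christ g d' q (u *m jac d d' q) (v *m jac d d' q).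
Proof.
move=> dq d'q dc dJ Jsym dg dg' gu gs gs' gJ.
set J := jac d d' q.
have gE : g d q = J *m g d' q *m J^T by exact: nbhs_singleton gJ.
have Ju : J \in unitmx by apply: (@congruence_unit _ _ (g d' q)); rewrite -gE.
have gu' : g d' q \in unitmx.
  by move: gu; rewrite gE !unitmx_mul => /andP[/andP[]].
have Ksym x y : y *m dird d (jac d d') q x = x *m dird d (jac d d') q y.
  apply/rowP => k; rewrite /dird !mulmx_sumr !summxE.
  under eq_bigr do rewrite -scalemxAr mxE mxE mulr_sumr.
  rewrite exchange_big; apply: eq_bigr => i _.
  rewrite -scalemxAr mxE mxE mulr_sumr; apply: eq_bigr => j _.
  rewrite (mulrCA (x 0 j)).
  exact: (congr1 (fun z => y 0 i * (x 0 j * z)) (Jsym j i k)).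
have dg'2 : dfr d (g d') q.
  have cid : {for q, continuous (idfun : M -> M)} by exact: cvg_id.
  exact: (dfr_comp (F := idfun) cid dq d'q dc dg').
have P x y z : pairing (dird d (g d) q x) y z =
    pairing (g d' q) (y *m dird d (jac d d') q x) (z *m J)
    + pairing (dird d' (g d') q (x *m J)) (y *m J) (z *m J)
    + pairing (g d' q) (y *m J) (z *m dird d (jac d d') q x).
  apply: (etrans (congr1 (fun D => pairing D y z) (dird_near x dq gJ))).
  apply: (etrans (dird_congruence x y z dq dJ dg'2)).
  exact: (congr1 (fun D => _ + pairing D _ _ + _) (dird_change x dq d'q dc dg')).
apply: (koszul_change (D := dird d (g d) q) (D' := dird d' (g d') q)
  (K := fun x y => y *m dird d (jac d d') q x) gu' gs' Ju Ksym P).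
  by move=> w; rewrite -/J -gE; exact: christ_pairing.
by move=> w; exact: christ_pairing.
Qed.

Lemma christDl g d q u u' v : christ g d q (u + u') v = christ g d q u v + christ g d q u' v.
Proof.
apply/rowP => k; rewrite !mxE -big_split; apply: eq_bigr => l _; rewrite -big_split.
by apply: eq_bigr => m _; rewrite mxE /=; ring.
Qed.

Lemma christDr g d q u v v' : christ g d q u (v + v') = christ g d q u v + christ g d q u v'.
Proof.
apply/rowP => k; rewrite !mxE -big_split; apply: eq_bigr => l _; rewrite -big_split.
by apply: eq_bigr => m _; rewrite mxE /=; ring.
Qed.

Lemma christZl g d q a u v : christ g d q (a *: u) v = a *: christ g d q u v.
Proof.
apply/rowP => k; rewrite !mxE mulr_sumr; apply: eq_bigr => l _; rewrite mulr_sumr.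
by apply: eq_bigr => m _; rewrite mxE /=; ring.
Qed.

Lemma christZr g d q a u v : christ g d q u (a *: v) = a *: christ g d q u v.
Proof.
apply/rowP => k; rewrite !mxE mulr_sumr; apply: eq_bigr => l _; rewrite mulr_sumr.
by apply: eq_bigr => m _; rewrite mxE /=; ring.
Qed.

Lemma christ_suml g d q v (I : Type) (r : seq I) (f : I -> R) (u : I -> 'rV[R]_n) :
  christ g d q (\sum_(j <- r) f j *: u j) v = \sum_(j <- r) f j *: christ g d q (u j) v.
Proof.
elim: r => [|j r IH]; last by rewrite !big_cons christDl christZl IH.
by have := christZl g d q 0 0 v; rewrite !big_nil !scale0r.
Qed.

Lemma christ_sumr g d q u (I : Type) (r : seq I) (f : I -> R) (v : I -> 'rV[R]_n) :
  christ g d q u (\sum_(j <- r) f j *: v j) = \sum_(j <- r) f j *: christ g d q u (v j).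
Proof.
elim: r => [|j r IH]; last by rewrite !big_cons christDr christZr IH.
by have := christZr g d q 0 u 0; rewrite !big_nil !scale0r.
Qed.

End Christoffel.

(** * Changes of chart and the spacetime metric *)

Section Transitions.
Context {R : realType} n (M : manifold R n).
Implicit Types (d : chart R n M).

Lemma transition_CkM k d d' : atlas d -> atlas d' -> CkM k d (dom d `&` dom d') (coord d').
Proof. by move=> ad ad'; exact: (transition_smooth ad ad'). Qed.

Lemma open_dom2 d d' : open (dom d `&` dom d').
Proof. by apply: openI; exact: dom_open. Qed.

Lemma jac_CkM k d d' : atlas d -> atlas d' -> CkM k d (dom d `&` dom d') (jac d d').
Proof.
move=> ad ad'; have oO := open_dom2 d d'; have sO := @subIsetl _ (dom d) (dom d').
apply: (CkM_mx oO sO) => i j.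
apply: (eq_CkM oO sO (f := fun q => pd d i (coord d') q 0 j)).
  by move=> q _; rewrite mxE.
by apply: (CkM_entry oO sO); apply: (CkM_pd oO sO); exact: transition_CkM.
Qed.

Lemma jac_pd_sym d d' i j k q : atlas d -> atlas d' -> dom d q -> dom d' q ->
  pd d i (jac d d') q j k = pd d j (jac d d') q i k.
Proof.
move=> ad ad' dq d'q; have oO := open_dom2 d d'; have sO := @subIsetl _ (dom d) (dom d').
have Oq : (dom d `&` dom d') q by [].
have dJ := CkM_dfr (jac_CkM 1 ad ad') Oq.
have E a b : pd d a (jac d d') q b k = pd d a (pd d b (fun r => coord d' r 0 k)) q.
  rewrite -(pd_entry _ _ _ dJ); apply: near_pd => //.
  apply: (open_near oO Oq) => r Or; rewrite mxE pd_entry //.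
  exact: (CkM_dfr (transition_CkM 1 ad ad') Or).
apply: (etrans (E i j)); apply: (etrans _ (esym (E j i))).
apply: (pd_sym _ _ oO sO Oq).
by apply: (CkM_entry oO sO); exact: transition_CkM.
Qed.

Lemma jacE d d' q : atlas d -> atlas d' -> dom d q -> dom d' q ->
  'J (transition d d') (coord d q) = jac d d' q.
Proof.
move=> ad ad' dq d'q; have oO := open_dom2 d d'; have sO := @subIsetl _ (dom d) (dom d').
have Oq : (dom d `&` dom d') q by [].
have dc := CkM_dfr (transition_CkM 1 ad ad') Oq.
apply/row_matrixP => i; rewrite rowE -(deriveEjacobian _ dc).
by apply/rowP => j; rewrite !mxE.
Qed.

End Transitions.

Section Eta.
Context {R : realType}.
Lemma eta_sqr : eta R *m eta R = 1%:M.
Proof.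
rewrite /eta mulmx_block !mulmx0 !mul0mx !addr0 !add0r mulmx1 -scalar_mxM mulrNN mulr1.
by rewrite -scalar_mx_block.
Qed.

Lemma eta_unit : eta R \in unitmx.
Proof. by have [] := mulmx1_unit eta_sqr. Qed.

End Eta.

Section Spacetime.
Context {R : realType} (N : spacetime R).
Implicit Types (d : chart R 4 N) (q : N).

Let lor := @lorentz R N.

Lemma lorentz_unit d q : atlas d -> dom d q -> lor d q \in unitmx.
Proof.
move=> ad dq; have [P [Pu PE]] := lorentz_signature ad dq.
by have := @eta_unit R; rewrite -PE !unitmx_mul => /andP[/andP[]].
Qed.

Lemma lorentz_CkM k d : atlas d -> CkM k d (dom d) (lor d).
Proof. by move=> ad; exact: (lorentz_smooth ad). Qed.

Lemma lorentz_jac d d' q : atlas d -> atlas d' -> dom d q -> dom d' q ->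
  lor d q = jac d d' q *m lor d' q *m (jac d d' q)^T.
Proof. by move=> ad ad' dq d'q; rewrite -jacE //; exact: lorentz_tensor. Qed.

Lemma christ_jac d d' q u v : atlas d -> atlas d' -> dom d q -> dom d' q ->
  christ lor d q u v *m jac d d' q =
  v *m dird d (jac d d') q u + christ lor d' q (u *m jac d d' q) (v *m jac d d' q).
Proof.
move=> ad ad' dq d'q; have Oq : (dom d `&` dom d') q by [].
apply: christ_change => //.
- exact: (CkM_dfr (transition_CkM 1 ad ad') Oq).
- exact: (CkM_dfr (jac_CkM 1 ad ad') Oq).
- by move=> i j k; exact: jac_pd_sym.
- exact: (CkM_dfr (lorentz_CkM 1 ad) dq).
- exact: (CkM_dfr (lorentz_CkM 1 ad') d'q).
- exact: lorentz_unit.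
- exact: lorentz_sym.
- exact: lorentz_sym.
- apply: (open_near (open_dom2 d d') Oq) => r [dr d'r]; exact: lorentz_jac.
Qed.

End Spacetime.

Lemma dfr_chart (R : realType) n (S : manifold R n) (W : normedModType R) (c c' : chart R n S)
    (f : S -> W) p : atlas c -> atlas c' -> dom c p -> dom c' p -> dfr c f p -> dfr c' f p.
Proof.
move=> ac ac' cp c'p df.
have cid : {for p, continuous (idfun : S -> S)} by exact: cvg_id.
have Op : (dom c' `&` dom c) p by [].
exact: (dfr_comp (F := idfun) cid c'p cp (CkM_dfr (transition_CkM 1 ac' ac) Op) df).
Qed.

Lemma pd_chart (R : realType) n (S : manifold R n) (W : normedModType R) (c c' : chart R n S)
    (f : S -> W) i p : atlas c -> atlas c' -> dom c p -> dom c' p -> dfr c f p ->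
  pd c' i f p = \sum_j jac c' c p i j *: pd c j f p.
Proof.
move=> ac ac' cp c'p df.
have cid : {for p, continuous (idfun : S -> S)} by exact: cvg_id.
have Op : (dom c' `&` dom c) p by [].
apply: (etrans (pd_comp (F := idfun) i cid c'p cp (CkM_dfr (transition_CkM 1 ac' ac) Op) df)).
by apply: eq_bigr => j _; rewrite mxE.
Qed.

(** * Fields along a surface and their covariant derivatives *)

Section Along.
Context {R : realType} (N : spacetime R) (S : manifold R 2) (F : S -> N).
Hypothesis Fs : smooth_map F.
Implicit Types (c : chart R 2 S) (d : chart R 4 N) (Z : field_along S N).

Let lor := @lorentz R N.

(** A field along F needs a chart at both ends. The sets of this form are open and cover S, so local
    properties may be checked on them. *)
Definition odom c d : set S := dom c `&` F @^-1` dom d.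

Lemma odom_open c d : open (odom c d).
Proof.
apply: openI; first exact: dom_open.
by have [/continuousP Fc _] := Fs; apply: Fc; exact: dom_open.
Qed.

Lemma odom_sub c d : odom c d `<=` dom c.
Proof. exact: subIsetl. Qed.

Lemma coordF_CkM k c d : atlas c -> atlas d -> CkM k c (odom c d) (coord d \o F).
Proof. by move=> ac ad; have [_ /(_ c d ac ad k)] := Fs. Qed.

Lemma push_CkM k c i d : atlas c -> atlas d -> CkM k c (odom c d) (push F c i d).
Proof.
move=> ac ad; apply: (CkM_pd (@odom_open c d) (@odom_sub c d)).
exact: coordF_CkM.
Qed.

(** Stated at a single point, because a coordinate field [push F c i] obeys the transformation law
    only on [dom c]. *)
Definition tensorial Z (p : S) := forall d d', atlas d -> atlas d' ->
  dom d (F p) -> dom d' (F p) -> Z d' p = Z d p *m jac d d' (F p).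

Lemma cF p : {for p, continuous F}. Proof. by have [Fc _] := Fs; exact: Fc. Qed.

Lemma coordF_dfr c d p : atlas c -> atlas d -> dom c p -> dom d (F p) -> dfr c (coord d \o F) p.
Proof. by move=> ac ad cp dp; apply: (CkM_dfr (coordF_CkM 1 ac ad)). Qed.

Lemma push_tensorial c i p : atlas c -> dom c p -> tensorial (push F c i) p.
Proof.
move=> ac cp d d' ad ad' dp d'p.
have Oq : (dom d `&` dom d') (F p) by [].
have dJ := CkM_dfr (transition_CkM 1 ad ad') Oq.
apply: (etrans (pd_comp i (@cF p) cp dp (coordF_dfr ac ad cp dp) dJ)).
apply/rowP => k; rewrite summxE [RHS]mxE; apply: eq_bigr => j _.
by rewrite [LHS]mxE [in RHS]mxE.
Qed.

(** [inner] is evaluated in [chart_at (F p)], which jumps with p. For tensorial fields any fixed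
    chart d gives the same value, and smoothness becomes visible. *)
Lemma inner_chart Z W d p : atlas d -> dom d (F p) -> tensorial Z p -> tensorial W p ->
  inner F Z W p = pairing (lor d (F p)) (Z d p) (W d p).
Proof.
move=> ad dp tZ tW; rewrite /inner /=.
have a0 := chart_at_atlas (F p); have d0 := chart_at_dom (F p).
rewrite (tZ _ _ ad a0 dp d0) (tW _ _ ad a0 dp d0) -pairing_mul.
by rewrite /lor (lorentz_jac ad a0 dp d0).
Qed.

Lemma covE c i Z d p :
  cov F c i Z d p = pd c i (Z d) p + christ lor d (F p) (push F c i d p) (Z d p).
Proof. by []. Qed.

Lemma near_odom c d p : dom c p -> dom d (F p) -> \near p, odom c d p.
Proof. by move=> cp dp; apply: (open_near (@odom_open c d)) => //; split. Qed.

Lemma jacF_dfr c d d' p : atlas c -> atlas d -> atlas d' -> dom c p -> dom d (F p) ->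
  dom d' (F p) -> dfr c (fun q => jac d d' (F q)) p.
Proof.
move=> ac ad ad' cp dp d'p; have Oq : (dom d `&` dom d') (F p) by [].
have dJ := CkM_dfr (jac_CkM 1 ad ad') Oq.
exact: (dfr_comp (@cF p) cp dp (coordF_dfr ac ad cp dp) dJ).
Qed.

Lemma dfr_frame Z c d d' p : atlas c -> atlas d -> atlas d' -> dom c p -> dom d (F p) ->
  dom d' (F p) -> (\near p, tensorial Z p) -> dfr c (Z d) p -> dfr c (Z d') p.
Proof.
move=> ac ad ad' cp dp d'p tZ dZ.
apply: (near_dfr (f := fun q => Z d q *m jac d d' (F q)) cp); last first.
  by apply: dfr_mulmx dZ _; exact: jacF_dfr.
by near=> q; apply: esym; have tq : tensorial Z q; [by near: q|];
  apply: tq => //; near: q; [have := near_odom cp dp|have := near_odom cp d'p];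
  apply: filterS => q [].
Unshelve. all: by end_near. Qed.

(** Differentiating the transformation law of Z produces the derivative of the Jacobian along F; the
    inhomogeneous term of the Christoffel symbols cancels it exactly. *)
Lemma cov_tensorial Z c i d d' p : atlas c -> atlas d -> atlas d' -> dom c p -> dom d (F p) ->
  dom d' (F p) -> (\near p, tensorial Z p) -> dfr c (Z d) p ->
  cov F c i Z d' p = cov F c i Z d p *m jac d d' (F p).
Proof.
move=> ac ad ad' cp dp d'p tZ dZ.
have tp : tensorial Z p by exact: nbhs_singleton tZ.
have nZ : \near p, Z d' p = Z d p *m jac d d' (F p).
  near=> q; have tq : tensorial Z q by near: q.
  by apply: tq => //; near: q; [have := near_odom cp dp|have := near_odom cp d'p];
    apply: filterS => q [].
have Oq : (dom d `&` dom d') (F p) by [].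
have dJF := jacF_dfr ac ad ad' cp dp d'p.
have E1 : pd c i (Z d') p = pd c i (Z d) p *m jac d d' (F p)
    + Z d p *m dird d (jac d d') (F p) (push F c i d p).
  apply: (etrans (near_pd i cp nZ)); apply: (etrans (pd_mulmx i cp dZ dJF)).
  apply: (congr1 (fun D => _ + Z d p *m D)).
  exact: (pd_comp i (@cF p) cp dp (coordF_dfr ac ad cp dp) (CkM_dfr (jac_CkM 1 ad ad') Oq)).
rewrite !covE mulmxDl (christ_jac _ _ ad ad' dp d'p).
rewrite (tp _ _ ad ad' dp d'p) (push_tensorial i ac cp ad ad' dp d'p).
by rewrite addrA; apply: (congr1 (fun z => z + _)).
Unshelve. all: by end_near. Qed.

(** What covariant differentiation at p consumes: the transformation law near p, since it is
    differentiated, and differentiability at p in all charts. *)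
Definition regular Z p := (\near p, tensorial Z p) /\
  (forall c d, atlas c -> atlas d -> dom c p -> dom d (F p) -> dfr c (Z d) p).

Lemma regular_chart Z c d p : atlas c -> atlas d -> dom c p -> dom d (F p) ->
  (\near p, tensorial Z p) -> dfr c (Z d) p -> regular Z p.
Proof.
move=> ac ad cp dp tZ dZ; split=> // c' d' ac' ad' c'p d'p.
apply: (dfr_chart ac ac' cp c'p).
exact: (dfr_frame ac ad ad' cp dp d'p tZ dZ).
Qed.

Lemma push_regular c i p : atlas c -> dom c p -> regular (push F c i) p.
Proof.
move=> ac cp; have a0 := chart_at_atlas (F p); have d0 := chart_at_dom (F p).
apply: (regular_chart ac a0 cp d0).
  by apply: (open_near (@dom_open _ _ _ c) cp) => q cq; exact: push_tensorial.
by apply: (CkM_dfr (push_CkM 1 i ac a0)).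
Qed.

Lemma cov_regular_tensorial Z c i p : atlas c -> dom c p -> regular Z p ->
  tensorial (cov F c i Z) p.
Proof.
move=> ac cp [tZ dZ] d d' ad ad' dp d'p.
by apply: cov_tensorial => //; exact: dZ.
Qed.

Lemma cov_chart Z c c' i d p : atlas c -> atlas c' -> atlas d -> dom c p -> dom c' p ->
  dom d (F p) -> dfr c (Z d) p ->
  cov F c' i Z d p = \sum_j jac c' c p i j *: cov F c j Z d p.
Proof.
move=> ac ac' ad cp c'p dp dZ; rewrite covE.
rewrite (pd_chart i ac ac' cp c'p dZ).
have -> : push F c' i d p = \sum_j jac c' c p i j *: push F c j d p.
  exact: (pd_chart i ac ac' cp c'p (coordF_dfr ac ad cp dp)).
have -> : christ lor d (F p) (\sum_j jac c' c p i j *: push F c j d p) (Z d p) =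
    \sum_j jac c' c p i j *: christ lor d (F p) (push F c j d p) (Z d p).
  exact: christ_suml.
by rewrite -big_split; apply: eq_bigr => j _; rewrite /= -scalerDr.
Qed.

Lemma cov_sum c i d p (f : 'I_2 -> S -> R) (Z : 'I_2 -> field_along S N) : dom c p ->
  (forall j, dfr c (f j) p) -> (forall j, dfr c (Z j d) p) ->
  cov F c i (fun d q => \sum_j f j q *: Z j d q) d p =
  \sum_j (pd c i (f j) p *: Z j d p + f j p *: cov F c i (Z j) d p).
Proof.
move=> cp df dZ; rewrite covE.
rewrite (pd_sum (f := fun j q => f j q *: Z j d q) i _ (fun j => dfrZ (df j) (dZ j))).
have -> : christ lor d (F p) (push F c i d p) (\sum_j f j p *: Z j d p) =
    \sum_j f j p *: christ lor d (F p) (push F c i d p) (Z j d p).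
  exact: christ_sumr.
rewrite -big_split; apply: eq_bigr => j _ /=.
by rewrite (pdZ i cp (df j) (dZ j)) covE scalerDr addrA.
Qed.

Lemma cov_near c i Z Z' d p : dom c p -> (\near p, Z d p = Z' d p) ->
  cov F c i Z d p = cov F c i Z' d p.
Proof.
move=> cp ZZ'; rewrite !covE (nbhs_singleton ZZ').
by apply: (congr1 (fun z => z + _)); exact: near_pd.
Qed.

Lemma cov_CkM k c i Z d : atlas c -> atlas d -> CkM k.+1 c (odom c d) (Z d) ->
  CkM k c (odom c d) (cov F c i Z d).
Proof.
move=> ac ad ZC; have oO := @odom_open c d; have sO := @odom_sub c d.
apply: (CkMD oO sO); first exact: CkM_pd.
have LC : CkM k.+1 d (dom d) (lor d) by exact: lorentz_CkM.
have sd : dom d `<=` dom d by [].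
have pC := push_CkM k i ac ad.
have chC a b e : CkM k c (odom c d) (fun p => christoffel lor d (F p) a b e).
  have FO p : odom c d p -> dom d (F p) by case.
  apply: (CkM_comp (f := fun q => christoffel lor d q a b e) oO sO sd FO); last exact: coordF_CkM.
  have od := @dom_open _ _ _ d.
  apply: (CkMM od sd); first exact: CkM_cst.
  apply: (CkM_sum od sd) => l _; apply: (CkMM od sd).
    apply: (CkM_entry od sd); apply: (CkM_invmx od sd); last exact: CkMW.
    by move=> q dq; exact: lorentz_unit.
  by apply: (CkMB od sd); first apply: (CkMD od sd);
    apply: (CkM_pd od sd); apply: (CkM_entry od sd).
apply: (CkM_mx oO sO) => a b.
apply: (eq_CkM oO sO (f := fun p => \sum_l \sum_m christoffel lor d (F p) b l m *
  push F c i d p 0 l * Z d p 0 m)); first by move=> p _; rewrite mxE.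
apply: (CkM_sum oO sO) => l _; apply: (CkM_sum oO sO) => m _.
apply: (CkMM oO sO); last by apply: (CkM_entry oO sO); exact: CkMW.
by apply: (CkMM oO sO); [exact: chC|exact: (CkM_entry oO sO)].
Qed.

End Along.

(** * The mean curvature vector and the connection form *)

Section MeanCurvature.
Context {R : realType} (N : spacetime R) (S : manifold R 2) (F : S -> N).
Hypothesis Fs : smooth_map F.
Hypothesis Fsp : spacelike F.
Implicit Types (c : chart R 2 S) (d : chart R 4 N) (Z W : field_along S N).

Let lor := @lorentz R N.
Let g := induced_metric F.

Definition push_mx c d p : 'M[R]_(2, 4) := \matrix_i push F c i d p.

(** Acting on row vectors from the right, this is the orthogonal projection onto the normal space:
    the subtracted matrix takes the tangential components with the inverse induced metric and maps
    them back by [push_mx]. *)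
Definition normal_proj c d p : 'M[R]_4 :=
  1%:M - lor d (F p) *m (push_mx c d p)^T *m invmx (g c p) *m push_mx c d p.

Lemma row_push_mx c d p i : row i (push_mx c d p) = push F c i d p.
Proof. exact: rowK. Qed.

Lemma induced_metric_gram c d p : atlas c -> atlas d -> dom c p -> dom d (F p) ->
  g c p = push_mx c d p *m lor d (F p) *m (push_mx c d p)^T.
Proof.
move=> ac ad cp dp; apply/matrixP => i j.
rewrite mxE (inner_chart ad dp (push_tensorial Fs i ac cp) (push_tensorial Fs j ac cp)).
by rewrite /pairing -!row_push_mx -!row_mul tr_row mxE colE mulmxA -colE mxE.
Qed.

Lemma induced_metric_unit c p : atlas c -> dom c p -> g c p \in unitmx.
Proof. by move=> ac cp; apply: posdef_unit; exact: Fsp. Qed.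

Lemma push_mx_chart c c' d p : atlas c -> atlas c' -> atlas d -> dom c p -> dom c' p ->
  dom d (F p) -> push_mx c' d p = jac c' c p *m push_mx c d p.
Proof.
move=> ac ac' ad cp c'p dp; apply/row_matrixP => i; rewrite row_push_mx row_mul.
rewrite mulmx_sum_row.
apply: (etrans (pd_chart i ac ac' cp c'p (coordF_dfr Fs ac ad cp dp))).
by apply: eq_bigr => j _; rewrite row_push_mx [row _ _ _ _]mxE.
Qed.

Lemma push_mx_frame c d d' p : atlas c -> atlas d -> atlas d' -> dom c p ->
  dom d (F p) -> dom d' (F p) -> push_mx c d' p = push_mx c d p *m jac d d' (F p).
Proof.
move=> ac ad ad' cp dp d'p; apply/row_matrixP => i; rewrite row_mul !row_push_mx.
exact: push_tensorial.
Qed.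

Lemma induced_metric_chart c c' p : atlas c -> atlas c' -> dom c p -> dom c' p ->
  g c' p = jac c' c p *m g c p *m (jac c' c p)^T.
Proof.
move=> ac ac' cp c'p; have a0 := chart_at_atlas (F p); have d0 := chart_at_dom (F p).
rewrite (induced_metric_gram ac' a0 c'p d0) (induced_metric_gram ac a0 cp d0).
by rewrite (push_mx_chart ac ac' a0 cp c'p d0) trmx_mul !mulmxA.
Qed.

Lemma push_normal_proj c d p : atlas c -> atlas d -> dom c p -> dom d (F p) ->
  push_mx c d p *m normal_proj c d p = 0.
Proof.
move=> ac ad cp dp; rewrite /normal_proj mulmxBr mulmx1 !mulmxA.
rewrite -(induced_metric_gram ac ad cp dp) mulmxV ?mul1mx ?subrr //.
exact: induced_metric_unit.
Qed.

Lemma normal_proj_chart c c' d p : atlas c -> atlas c' -> atlas d -> dom c p -> dom c' p ->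
  dom d (F p) -> normal_proj c' d p = normal_proj c d p.
Proof.
move=> ac ac' ad cp c'p dp; rewrite /normal_proj; apply: (congr1 (fun z => 1%:M - z)).
have gE := induced_metric_chart ac ac' cp c'p.
have gu := induced_metric_unit ac' c'p; rewrite gE in gu.
rewrite (push_mx_chart ac ac' ad cp c'p dp) trmx_mul gE -!mulmxA.
congr (_ *m (_ *m _)); rewrite !mulmxA; congr (_ *m _).
exact: invmx_congruence.
Qed.

Lemma normal_proj_frame c d d' p : atlas c -> atlas d -> atlas d' -> dom c p ->
  dom d (F p) -> dom d' (F p) ->
  normal_proj c d p *m jac d d' (F p) = jac d d' (F p) *m normal_proj c d' p.
Proof.
move=> ac ad ad' cp dp d'p; rewrite /normal_proj mulmxBl mulmxBr mul1mx mulmx1.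
congr (_ - _); rewrite (push_mx_frame ac ad ad' cp dp d'p) trmx_mul.
by rewrite /lor (lorentz_jac ad ad' dp d'p) !mulmxA.
Qed.

Lemma normal_partE c d Z p : atlas c -> atlas d -> dom c p -> dom d (F p) ->
  tensorial F Z p -> normal_part F c Z d p = Z d p *m normal_proj c d p.
Proof.
move=> ac ad cp dp tZ; rewrite /normal_part mulmxBr mulmx1; congr (_ - _).
rewrite !mulmxA mulmx_sum_row exchange_big; apply: eq_bigr => j _ /=.
rewrite row_push_mx mxE scaler_suml; apply: eq_bigr => i _; congr (_ *: _).
rewrite mulrC (inner_chart ad dp tZ (push_tensorial Fs i ac cp)) -/g; congr (_ * _).
by rewrite -row_push_mx /pairing tr_row colE mulmxA -colE mxE.
Qed.

(** The chart of the surface is a parameter here, in contrast to [mean_curvature]. For a fixed chart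
    the expression is smooth by inspection, and it is then shown not to depend on the chart. *)
Definition mean_curvature_in c d p : 'rV[R]_4 :=
  \sum_i \sum_j invmx (g c p) i j *: (cov F c i (push F c j) d p *m normal_proj c d p).

Lemma mean_curvatureE d p : atlas d -> dom d (F p) ->
  mean_curvature F d p = mean_curvature_in (chart_at p) d p.
Proof.
move=> ad dp; have ac := chart_at_atlas p; have cp := chart_at_dom p.
rewrite /mean_curvature /mean_curvature_in; apply: eq_bigr => i _; apply: eq_bigr => j _.
rewrite (normal_partE ac ad cp dp) //; apply: cov_regular_tensorial => //.
exact: push_regular.
Qed.

(** The second derivatives of the change of chart multiply tangent vectors only, and the normal
    projection kills them. The second fundamental form is therefore a tensor. *)
Lemma cov_push_chart c c' i j d p : atlas c -> atlas c' -> atlas d -> dom c p -> dom c' p ->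
  dom d (F p) ->
  cov F c' i (push F c' j) d p *m normal_proj c d p =
  \sum_k \sum_l (jac c' c p i k * jac c' c p j l) *:
    (cov F c k (push F c l) d p *m normal_proj c d p).
Proof.
move=> ac ac' ad cp c'p dp; have Op : (dom c' `&` dom c) p by [].
have dpush c1 l : atlas c1 -> dom c1 p -> dfr c (push F c1 l d) p.
  by move=> ac1 c1p; have [_] := push_regular Fs l ac1 c1p; apply.
rewrite (cov_chart Fs i ac ac' ad cp c'p dp (dpush c' j ac' c'p)) mulmx_suml.
apply: eq_bigr => k _; rewrite -scalemxAl.
have nE : \near p, push F c' j d p = \sum_l jac c' c p j l *: push F c l d p.
  apply: (open_near (openI (open_dom2 c' c) (@odom_open _ _ _ _ Fs c d))) => //.
  move=> q [[c'q cq] [_ dq]].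
  exact: (pd_chart j ac ac' cq c'q (coordF_dfr Fs ac ad cq dq)).
have dj l : dfr c (fun q => jac c' c q j l) p.
  by apply: dfr_entry; apply: (dfr_chart ac' ac c'p cp); exact: (CkM_dfr (jac_CkM 1 ac' ac) Op).
have cE : cov F c k (push F c' j) d p =
    cov F c k (fun d q => \sum_l jac c' c q j l *: push F c l d q) d p.
  exact: cov_near.
rewrite cE (cov_sum F (f := fun l q => jac c' c q j l) (Z := fun l => push F c l) k cp dj
  (fun l => dpush c l ac cp)).
rewrite mulmx_suml scaler_sumr; apply: eq_bigr => l _.
rewrite mulmxDl -!scalemxAl -{1}row_push_mx -row_mul (push_normal_proj ac ad cp dp).
by rewrite row0 scaler0 add0r scalerA.
Qed.

Lemma mean_curvature_in_chart c c' d p : atlas c -> atlas c' -> atlas d -> dom c p ->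
  dom c' p -> dom d (F p) -> mean_curvature_in c' d p = mean_curvature_in c d p.
Proof.
move=> ac ac' ad cp c'p dp.
have gE := induced_metric_chart ac ac' cp c'p.
have gu := induced_metric_unit ac' c'p; rewrite gE in gu.
rewrite /mean_curvature_in gE (normal_proj_chart ac ac' ad cp c'p dp).
apply: contract_congruence => // i j; exact: cov_push_chart.
Qed.

Lemma mean_curvature_chart c d p : atlas c -> atlas d -> dom c p -> dom d (F p) ->
  mean_curvature F d p = mean_curvature_in c d p.
Proof.
move=> ac ad cp dp; rewrite (mean_curvatureE ad dp).
by apply: mean_curvature_in_chart => //; [exact: chart_at_atlas|exact: chart_at_dom].
Qed.

Lemma mean_curvature_tensorial p : tensorial F (mean_curvature F) p.
Proof.
move=> d d' ad ad' dp d'p; have ac := chart_at_atlas p; have cp := chart_at_dom p.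
rewrite (mean_curvature_chart ac ad cp dp) (mean_curvature_chart ac ad' cp d'p).
rewrite /mean_curvature_in mulmx_suml; apply: eq_bigr => i _.
rewrite mulmx_suml; apply: eq_bigr => j _; rewrite -scalemxAl; congr (_ *: _).
have t := cov_regular_tensorial Fs i ac cp (push_regular Fs j ac cp).
rewrite (t _ _ ad ad' dp d'p) -!mulmxA; congr (_ *m _).
by rewrite (normal_proj_frame ac ad ad' cp dp d'p).
Qed.

Definition Cfun k (f : S -> R) := forall c d, atlas c -> atlas d -> CkM k c (odom F c d) f.

Definition Cfield k Z := (forall p, tensorial F Z p) /\
  forall c d, atlas c -> atlas d -> CkM k c (odom F c d) (Z d).

Let oO c d := @odom_open _ _ _ _ Fs c d.
Let sO c d := @odom_sub _ _ _ F c d.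

Lemma lorentzF_CkM k c d : atlas c -> atlas d -> CkM k c (odom F c d) (fun p => lor d (F p)).
Proof.
move=> ac ad; have FO p : odom F c d p -> dom d (F p) by case.
apply: (CkM_comp (f := lor d) (@oO c d) (@sO c d) (fun _ h => h) FO).
  exact: lorentz_CkM.
exact: coordF_CkM.
Qed.

Lemma push_mx_CkM k c d : atlas c -> atlas d -> CkM k c (odom F c d) (push_mx c d).
Proof.
move=> ac ad; apply: (CkM_mx (@oO c d) (@sO c d)) => i j.
apply: (eq_CkM (@oO c d) (@sO c d) (f := fun p => push F c i d p 0 j)).
  by move=> p _; rewrite mxE.
by apply: (CkM_entry (@oO c d) (@sO c d)); exact: push_CkM.
Qed.

Lemma induced_metric_CkM k c d : atlas c -> atlas d -> CkM k c (odom F c d) (g c).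
Proof.
move=> ac ad; have PC := push_mx_CkM k ac ad.
apply: (eq_CkM (@oO c d) (@sO c d)
  (f := fun p => push_mx c d p *m lor d (F p) *m (push_mx c d p)^T)).
  by move=> p [cp dp]; rewrite -induced_metric_gram.
apply: (CkM_mulmx (@oO c d) (@sO c d)); last exact: (CkM_tr (@oO c d) (@sO c d)).
by apply: (CkM_mulmx (@oO c d) (@sO c d)) => //; exact: lorentzF_CkM.
Qed.

Lemma inv_metric_CkM k c d : atlas c -> atlas d ->
  CkM k c (odom F c d) (fun p => invmx (g c p)).
Proof.
move=> ac ad; apply: (CkM_invmx (@oO c d) (@sO c d)); last exact: induced_metric_CkM.
by move=> p [cp _]; exact: induced_metric_unit.
Qed.

Lemma mean_curvature_Cfield k : Cfield k (mean_curvature F).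
Proof.
split; first exact: mean_curvature_tensorial.
move=> c d ac ad; have o := @oO c d; have s := @sO c d.
apply: (eq_CkM o s (f := mean_curvature_in c d)).
  by move=> p [cp dp]; rewrite -mean_curvature_chart.
have GC := inv_metric_CkM k ac ad.
apply: (CkM_sum o s) => i _; apply: (CkM_sum o s) => j _.
apply: (CkMZ o s); first exact: (CkM_entry o s).
apply: (CkM_mulmx o s).
  by apply: (cov_CkM Fs) => //; exact: push_CkM.
apply: (CkMB o s); first exact: CkM_cst.
apply: (CkM_mulmx o s); last exact: push_mx_CkM.
apply: (CkM_mulmx o s) => //.
apply: (CkM_mulmx o s); first exact: lorentzF_CkM.
by apply: (CkM_tr o s); exact: push_mx_CkM.
Qed.

Lemma smooth_Cfield k Z : smooth_field_along F Z -> Cfield k Z.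
Proof.
move=> [tZ sZ]; split=> [p d d' ad ad' dp d'p|c d ac ad].
  by rewrite (tZ _ _ _ ad ad' dp d'p) jacE.
exact: sZ.
Qed.

Lemma inner_Cfun k Z W : Cfield k Z -> Cfield k W -> Cfun k (inner F Z W).
Proof.
move=> [tZ ZC] [tW WC] c d ac ad; have o := @oO c d; have s := @sO c d.
apply: (eq_CkM o s (f := fun p => pairing (lor d (F p)) (Z d p) (W d p))).
  by move=> p [cp dp]; rewrite -inner_chart.
apply: (CkM_entry o s); apply: (CkM_mulmx o s); last by apply: (CkM_tr o s); exact: WC.
by apply: (CkM_mulmx o s); [exact: ZC|exact: lorentzF_CkM].
Qed.

Lemma Cfield_scale k (f : S -> R) Z : Cfun k f -> Cfield k Z ->
  Cfield k (fun d p => f p *: Z d p).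
Proof.
move=> fC [tZ ZC]; split=> [p d d' ad ad' dp d'p|c d ac ad].
  by rewrite (tZ _ _ _ ad ad' dp d'p) scalemxAl.
by apply: (CkMZ (@oO c d) (@sO c d)); [exact: fC|exact: ZC].
Qed.

Lemma Cfield_sub k Z W : Cfield k Z -> Cfield k W -> Cfield k (fun d p => Z d p - W d p).
Proof.
move=> [tZ ZC] [tW WC]; split=> [p d d' ad ad' dp d'p|c d ac ad].
  by rewrite (tZ _ _ _ ad ad' dp d'p) (tW _ _ _ ad ad' dp d'p) mulmxBl.
by apply: (CkMB (@oO c d) (@sO c d)); [exact: ZC|exact: WC].
Qed.

Lemma Cfield_regular k Z p : Cfield k.+1 Z -> regular F Z p.
Proof.
move=> [tZ ZC]; split; first exact: nearW.
by move=> c d ac ad cp dp; apply: (CkM_dfr (ZC c d ac ad)).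
Qed.

Lemma Cfun_continuous k f : Cfun k f -> continuous f.
Proof.
move=> fC p; apply: (CkM_continuous (@oO (chart_at p) (chart_at (F p))) (@sO _ _)).
  by apply: (fC _ _ (chart_at_atlas p) (chart_at_atlas (F p))).
by split; exact: chart_at_dom.
Qed.

Hypothesis Hsp : spacelike_mean_curvature F.

Lemma norm_H_gt0 p : 0 < norm_H F p.
Proof. by rewrite sqrtr_gt0; exact: Hsp. Qed.

Lemma norm_H_Cfun k : Cfun k (norm_H F).
Proof.
move=> c d ac ad; apply: (CkM_sqrt (@oO c d) (@sO c d)); first by move=> p _; exact: Hsp.
by apply: inner_Cfun => //; exact: mean_curvature_Cfield.
Qed.

Lemma normalized_Cfield k Z : Cfield k Z -> Cfield k (normalized F Z).
Proof.
move=> ZC; apply: (Cfield_scale (f := fun p => (norm_H F p)^-1)) => // c d ac ad.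
apply: (CkMV (@oO c d) (@sO c d)); last exact: norm_H_Cfun.
by move=> p _; rewrite gt_eqF // norm_H_gt0.
Qed.

Variables e3 e4 : field_along S N.
Hypotheses (e3s : smooth_field_along F e3) (e4s : smooth_field_along F e4).

Lemma dual_Cfield k : Cfield k (dual_mean_curvature F e3 e4).
Proof.
have HC := mean_curvature_Cfield k.
have C3 := smooth_Cfield k e3s; have C4 := smooth_Cfield k e4s.
apply: (Cfield_sub (Z := fun d p => inner F (mean_curvature F) e4 p *: e3 d p)
  (W := fun d p => inner F (mean_curvature F) e3 p *: e4 d p)).
  by apply: Cfield_scale => //; exact: inner_Cfun.
by apply: Cfield_scale => //; exact: inner_Cfun.
Qed.

(** The components of the connection form in an arbitrary chart; [conn_form] fixes [chart_at p], in
    which continuity in p cannot be read off. *)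
Definition conn_covector c p : 'rV[R]_2 := \row_i
  inner F (cov F c i (normalized F (dual_mean_curvature F e3 e4)))
    (normalized F (mean_curvature F)) p.

Lemma conn_covectorE c d p i : atlas c -> atlas d -> dom c p -> dom d (F p) ->
  conn_covector c p 0 i = pairing (lor d (F p))
    (cov F c i (normalized F (dual_mean_curvature F e3 e4)) d p)
    (normalized F (mean_curvature F) d p).
Proof.
move=> ac ad cp dp; rewrite mxE; apply: inner_chart => //.
  apply: (cov_regular_tensorial Fs) => //.
  by apply: (@Cfield_regular 0); apply: normalized_Cfield; exact: dual_Cfield.
by have [h _] := normalized_Cfield (mean_curvature_Cfield 0); exact: h.
Qed.

Lemma conn_covector_chart c c' p : atlas c -> atlas c' -> dom c p -> dom c' p ->
  conn_covector c' p = conn_covector c p *m (jac c' c p)^T.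
Proof.
move=> ac ac' cp c'p; have a0 := chart_at_atlas (F p); have d0 := chart_at_dom (F p).
apply/rowP => i; rewrite (conn_covectorE i ac' a0 c'p d0).
have [_ dZ] : regular F (normalized F (dual_mean_curvature F e3 e4)) p.
  by apply: (@Cfield_regular 0); apply: normalized_Cfield; exact: dual_Cfield.
rewrite (cov_chart Fs i ac ac' a0 cp c'p d0 (dZ _ _ ac a0 cp d0)) pairing_suml [RHS]mxE.
apply: eq_bigr => j _; rewrite pairingZl -(conn_covectorE j ac a0 cp d0).
by rewrite mulrC [_^T _ _]mxE.
Qed.

Lemma conn_covector_CkM c d : atlas c -> atlas d -> CkM 0 c (odom F c d) (conn_covector c).
Proof.
move=> ac ad; have o := @oO c d; have s := @sO c d.
apply: (CkM_mx o s) => a i; rewrite (ord1 a).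
apply: (eq_CkM o s (f := fun p => pairing (lor d (F p))
    (cov F c i (normalized F (dual_mean_curvature F e3 e4)) d p)
    (normalized F (mean_curvature F) d p))).
  by move=> p [cp dp]; rewrite -conn_covectorE.
have [_ C1] := normalized_Cfield (dual_Cfield 1).
have [_ C0] := normalized_Cfield (mean_curvature_Cfield 0).
apply: (CkM_entry o s); apply: (CkM_mulmx o s); last by apply: (CkM_tr o s); exact: C0.
apply: (CkM_mulmx o s); last exact: lorentzF_CkM.
by apply: (cov_CkM Fs) => //; exact: C1.
Qed.

Lemma conn_formE p (Y : 'rV[R]_2) :
  conn_form F e3 e4 p Y = \sum_i Y 0 i * conn_covector (chart_at p) p 0 i.
Proof. by apply: eq_bigr => i _; rewrite mxE. Qed.

Lemma conn_vectorE p :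
  conn_vector F e3 e4 p = conn_covector (chart_at p) p *m invmx (g (chart_at p) p).
Proof.
rewrite /conn_vector /sharp; congr (_ *m _); apply/rowP => i.
rewrite mxE conn_formE (bigD1 i) //= big1 => [|j ji]; last first.
  by rewrite mxE (negbTE ji) andbF mul0r.
by rewrite mxE !eqxx mul1r addr0.
Qed.

(** The Jacobians of the covector, of the inverse metric and of the differential of Y cancel. The
    image of the dual vector field under dY may thus be computed in a fixed chart, where it is
    continuous. *)
Lemma conn_vector_image_chart n (Y : S -> 'rV[R]_n) c c' p :
  atlas c -> atlas c' -> dom c p -> dom c' p -> dfr c Y p ->
  conn_covector c' p *m invmx (g c' p) *m (\matrix_i pd c' i Y p) =
  conn_covector c p *m invmx (g c p) *m (\matrix_i pd c i Y p).
Proof.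
move=> ac ac' cp c'p dY.
have gE := induced_metric_chart ac ac' cp c'p.
have gu := induced_metric_unit ac' c'p; rewrite gE in gu.
have -> : \matrix_i pd c' i Y p = jac c' c p *m \matrix_i pd c i Y p.
  apply/row_matrixP => i; rewrite rowK row_mul mulmx_sum_row (pd_chart i ac ac' cp c'p dY).
  by apply: eq_bigr => j _; rewrite (rowK (fun i => pd c i Y p)) [row _ _ _ _]mxE.
rewrite (conn_covector_chart ac ac' cp c'p) gE -!mulmxA; congr (_ *m _).
by rewrite !mulmxA (invmx_congruence gu).
Qed.

End MeanCurvature.

(** * Surfaces in Euclidean space *)

Section Dot.
Context {R : realType} (n : nat).
Implicit Types u v w : 'rV[R]_n.

Lemma dotE u v : dot u v = (u *m v^T) 0 0.
Proof. by rewrite mxE; apply: eq_bigr => i _; rewrite mxE. Qed.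

Lemma dotC u v : dot u v = dot v u.
Proof. by apply: eq_bigr => i _; rewrite mulrC. Qed.

Lemma dotDl u v w : dot (u + v) w = dot u w + dot v w.
Proof. by rewrite !dotE mulmxDl mxE. Qed.

Lemma dotZl a u v : dot (a *: u) v = a * dot u v.
Proof. by rewrite !dotE -scalemxAl mxE. Qed.

Lemma dotNl u v : dot (- u) v = - dot u v.
Proof. by rewrite -scaleN1r dotZl mulN1r. Qed.

Lemma dot0l v : dot 0 v = 0.
Proof. by rewrite dotE mul0mx mxE. Qed.

Lemma dotDr u v w : dot u (v + w) = dot u v + dot u w.
Proof. by rewrite dotC dotDl !(dotC u). Qed.

Lemma dotZr a u v : dot u (a *: v) = a * dot u v.
Proof. by rewrite dotC dotZl dotC. Qed.

Lemma dotNr u v : dot u (- v) = - dot u v.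
Proof. by rewrite dotC dotNl dotC. Qed.

Lemma dot_suml (I : Type) (r : seq I) (u : I -> 'rV[R]_n) v :
  dot (\sum_(i <- r) u i) v = \sum_(i <- r) dot (u i) v.
Proof. by elim: r => [|i r IH]; rewrite ?big_nil ?dot0l // !big_cons dotDl IH. Qed.

Lemma dot_ge0 u : 0 <= dot u u.
Proof. by apply: sumr_ge0 => i _; rewrite -expr2 sqr_ge0. Qed.

Lemma dot_eq0 u : (dot u u == 0) = (u == 0).
Proof.
apply/idP/eqP => [/eqP u0|->]; last by rewrite dot0l.
apply/rowP => i; rewrite mxE; apply/eqP; rewrite -sqrf_eq0 expr2.
move/eqP: u0; rewrite psumr_eq0 => [/allP/(_ i)|j _]; last by rewrite -expr2 sqr_ge0.
by rewrite mem_index_enum => /(_ isT) /implyP/(_ isT).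
Qed.

Lemma pd_dot m (S : manifold R m) (c : chart R m S) (f h : S -> 'rV[R]_n) i p :
  dom c p -> dfr c f p -> dfr c h p ->
  pd c i (fun q => dot (f q) (h q)) p = dot (pd c i f p) (h p) + dot (f p) (pd c i h p).
Proof.
move=> cp df dh; have dT := dfr_tr dh.
have E : (fun q => dot (f q) (h q)) = (fun q => (f q *m (h q)^T) 0 0).
  by apply/funext => q; rewrite dotE.
rewrite E (pd_entry _ _ _ (dfr_mulmx df dT)) (pd_mulmx i cp df dT) (pd_tr i dh).
by rewrite mxE -!dotE.
Qed.

Lemma dfr_dot m (S : manifold R m) (c : chart R m S) (f h : S -> 'rV[R]_n) p :
  dfr c f p -> dfr c h p -> dfr c (fun q => dot (f q) (h q)) p.
Proof.
move=> df dh; have dT := dfr_tr dh.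
have E : (fun q => dot (f q) (h q)) = (fun q => (f q *m (h q)^T) 0 0).
  by apply/funext => q; rewrite dotE.
by rewrite E; apply: dfr_entry; exact: dfr_mulmx.
Qed.

Lemma pd_dotl m (S : manifold R m) (c : chart R m S) (f : S -> 'rV[R]_n) a i p :
  dom c p -> dfr c f p -> pd c i (fun q => dot (f q) a) p = dot (pd c i f p) a.
Proof.
move=> cp df; have dc := dfr_cst c a p.
by rewrite (pd_dot i cp df dc) pd_cst (dotC _ 0) dot0l addr0.
Qed.

Lemma CkM_dot k m (S : manifold R m) (c : chart R m S) (O : set S) (f h : S -> 'rV[R]_n) :
  open O -> O `<=` dom c -> CkM k c O f -> CkM k c O h ->
  CkM k c O (fun q => dot (f q) (h q)).
Proof.
move=> oO sO fC hC; apply: (eq_CkM oO sO (f := fun q => (f q *m (h q)^T) 0 0)).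
  by move=> q _; rewrite dotE.
by apply: (CkM_entry oO sO); apply: (CkM_mulmx oO sO) => //; exact: CkM_tr.
Qed.

End Dot.

Section SurfaceAlgebra.
Context {R : realType}.

(** For a metric g_ij = Y_i . Y_j the Christoffel symbols of the first kind reduce to Y_ij . Y_l,
    because second derivatives of Y commute. *)
Lemma christoffel_first_kind n (yij yji yil yli yjl ylj yi yj yl : 'rV[R]_n) :
  yji = yij -> yli = yil -> ylj = yjl ->
  2^-1 * (dot yij yl + dot yj yil + (dot yji yl + dot yi yjl) - (dot yli yj + dot yi ylj)) =
  dot yij yl.
Proof. by move=> -> -> ->; rewrite (dotC yj); field. Qed.

Lemma add_normal_part (V : lmodType R) (w t v : V) (s h : R) :
  w = t + s *: v -> s = - h -> t = w + h *: v.
Proof. by move=> -> ->; rewrite scaleNr subrK. Qed.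

(** The two sums are the components along Y_0 of the Gauss formulas for Y_11 and Y_01,
    differentiated in the directions 0 and 1 respectively; a and b come from the third derivatives
    Y_011 and Y_101, which agree. Subtracting leaves curvature on one side and the determinant of
    the second fundamental form on the other. *)
Lemma gauss_algebra (G : 'I_2 -> 'I_2 -> 'I_2 -> R) (x y gg : 'I_2 -> R) (h00 h11 h01 h10 a b : R) :
  \sum_e (x e * gg e + G e 1 1 * \sum_m G m 0 e * gg m) = a + h11 * h00 ->
  \sum_e (y e * gg e + G e 0 1 * \sum_m G m 1 e * gg m) = b + h01 * h10 ->
  a = b ->
  \sum_l gg l * (x l - y l + \sum_m (G m 1 1 * G l 0 m - G m 0 1 * G l 1 m)) =
  h00 * h11 - h01 * h10.
Proof.
rewrite !big_ord_recl !big_ord0 => E1 E2 ab.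
have -> : h00 * h11 - h01 * h10 = (a + h11 * h00) - (b + h01 * h10) by rewrite ab; ring.
by rewrite -E1 -E2; ring.
Qed.

Lemma det2E (A : 'M[R]_2) : \det A = A 0 0 * A 1 1 - A 0 1 * A 1 0.
Proof.
rewrite (expand_det_row _ 0) !big_ord_recl big_ord0 addr0 /cofactor !det_mx11 !mxE /=.
have -> : lift 0 0 = 1 :> 'I_2 by apply/val_inj.
have -> : lift 1 (0 : 'I_1) = 0 :> 'I_2 by apply/val_inj.
by rewrite expr0 expr1; ring.
Qed.

Lemma pairing2E (A : 'M[R]_2) (u v : 'rV[R]_2) :
  pairing A u v = u 0 0 * A 0 0 * v 0 0 + u 0 0 * A 0 1 * v 0 1
    + u 0 1 * A 1 0 * v 0 0 + u 0 1 * A 1 1 * v 0 1.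
Proof.
rewrite pairingE !big_ord_recl !big_ord0.
have -> : lift ord0 ord0 = 1 :> 'I_2 by apply/val_inj.
by rewrite -/(0 : 'I_2) !addr0 addrA.
Qed.

Lemma posdef2_00 (A : 'M[R]_2) : (forall v, v != 0 -> 0 < pairing A v v) -> 0 < A 0 0.
Proof.
move=> /(_ (delta_mx 0 0)); rewrite pairing2E !mxE /= !mul0r !mulr0 !mul1r !mulr1 !addr0; apply.
by apply/eqP => /rowP/(_ 0); rewrite !mxE /= => /eqP; rewrite oner_eq0.
Qed.

Lemma det_posdef2 (A : 'M[R]_2) : (forall v, v != 0 -> 0 < pairing A v v) -> 0 < \det A.
Proof.
move=> Ap; have A0 := posdef2_00 Ap.
(* Chosen so that the form takes the value A_00 det A on it. *)
pose v : 'rV[R]_2 := \row_i (if i == 0 then - A 1 0 else A 0 0).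
have : 0 < pairing A v v.
  by apply: Ap; apply/eqP => /rowP/(_ 1); rewrite !mxE /= => /eqP; rewrite gt_eqF.
rewrite pairing2E !mxE /= det2E => E.
by rewrite -(pmulr_rgt0 _ A0); apply: (lt_le_trans E); lra.
Qed.

Lemma dot_mulmx2 n (x : 'rV[R]_2) (T : 'M[R]_(2, n)) w :
  dot (x *m T) w = x 0 0 * dot w (row 0 T) + x 0 1 * dot w (row 1 T).
Proof.
rewrite mulmx_sum_row dot_suml !big_ord_recl big_ord0 addr0 !dotZl.
have -> : lift ord0 ord0 = 1 :> 'I_2 by apply/val_inj.
by rewrite !(dotC _ w).
Qed.

Lemma cramer2_zero (h00 h01 h10 h11 x y : R) : h00 * h11 - h01 * h01 != 0 ->
  x * h00 + y * h01 = 0 -> x * h10 + y * h11 = 0 -> h10 = h01 -> x = 0 /\ y = 0.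
Proof.
move=> D E1 E2 E3; rewrite E3 in E2.
split; apply: (mulIf D); rewrite mul0r.
  have -> : x * (h00 * h11 - h01 * h01) = (x * h00 + y * h01) * h11 - (x * h01 + y * h11) * h01 by ring.
  by rewrite E1 E2 !mul0r subr0.
have -> : y * (h00 * h11 - h01 * h01) = (x * h01 + y * h11) * h00 - (x * h00 + y * h01) * h01 by ring.
by rewrite E1 E2 !mul0r subr0.
Qed.

Lemma ord2_cases (i : 'I_2) : (i = 0) \/ (i = 1).
Proof. by case: i => -[|[|m]] h; [left|right|]; [apply/val_inj..|]. Qed.

Lemma invmx2 (A : 'M[R]_2) : A \in unitmx -> invmx A =
  (\det A)^-1 *: (\matrix_(i, j) (if i == 0 then (if j == 0 then A 1 1 else - A 0 1)
                                  else (if j == 0 then - A 1 0 else A 0 0)) : 'M[R]_2).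
Proof.
move=> Au; apply: (can_inj (mulKmx Au)); rewrite mulmxV //.
have D0 : \det A != 0 by move: Au; rewrite unitmxE unitfE.
rewrite -scalemxAr; apply: (canRL (scalerK D0)).
apply/matrixP => i j; rewrite !mxE !big_ord_recl big_ord0 !mxE det2E.
have L : lift ord0 ord0 = 1 :> 'I_2 by apply/val_inj.
by case: (ord2_cases i) => ->; case: (ord2_cases j) => ->; rewrite ?L /=; ring.
Qed.

(** A symmetric h of positive determinant is definite, of the sign of h_00, and its trace has this
    sign too. The identity behind it is det A h_00 tr h = A(v, v) + A_00 det h with v = (h_01, -
    h_00). *)
Lemma trace_pos2 (A : 'M[R]_2) (h : 'I_2 -> 'I_2 -> R) :
  (forall v, v != 0 -> 0 < pairing A v v) -> A^T = A -> h 1 0 = h 0 1 ->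
  0 < h 0 0 * h 1 1 - h 0 1 * h 0 1 ->
  0 < h 0 0 * \sum_i \sum_j invmx A i j * h i j.
Proof.
move=> Ap As hs D.
have Au := posdef_unit Ap; have A0 := posdef2_00 Ap; have dA := det_posdef2 Ap.
have h0 : h 0 0 != 0.
  by apply/eqP => h0; move: D; rewrite h0 mul0r sub0r oppr_gt0 -expr2 ltNge sqr_ge0.
pose v : 'rV[R]_2 := \row_i (if i == 0 then h 0 1 else - h 0 0).
have Av : 0 < pairing A v v.
  by apply: Ap; apply/eqP => /rowP/(_ 1); rewrite !mxE /= => /eqP; rewrite oppr_eq0 (negbTE h0).
have A10 : A 1 0 = A 0 1 by rewrite -{1}As mxE.
rewrite invmx2 // !big_ord_recl !big_ord0.
have -> : lift ord0 ord0 = 1 :> 'I_2 by apply/val_inj.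
rewrite !mxE /= hs A10.
rewrite pairing2E !mxE /= A10 in Av.
have E : h 0 0 * ((\det A)^-1 * A 1 1 * h 0 0 + ((\det A)^-1 * - A 0 1 * h 0 1 + 0)
    + ((\det A)^-1 * - A 0 1 * h 0 1 + ((\det A)^-1 * A 0 0 * h 1 1 + 0) + 0)) =
  (\det A)^-1 * ((h 0 1 * A 0 0 * h 0 1 + h 0 1 * A 0 1 * - h 0 0 + - h 0 0 * A 0 1 * h 0 1 + - h 0 0 * A 1 1 * - h 0 0)
    + A 0 0 * (h 0 0 * h 1 1 - h 0 1 * h 0 1)) by ring.
by rewrite E mulr_gt0 ?invr_gt0 // addr_gt0 // mulr_gt0.
Qed.

End SurfaceAlgebra.

Section EuclideanSurface.
Context {R : realType} (S : manifold R 2) (g : metric_field S) (Y nu : S -> 'rV[R]_3).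
Implicit Types (c : chart R 2 S).

Definition tangent_mx c p : 'M[R]_(2, 3) := \matrix_i pd c i Y p.

Hypothesis Ys : forall k c, atlas c -> CkM k c (dom c) Y.
Hypothesis nus : forall k c, atlas c -> CkM k c (dom c) nu.
Hypothesis gE : forall c p, atlas c -> dom c p -> g c p = tangent_mx c p *m (tangent_mx c p)^T.
Hypothesis gpos : forall c p, atlas c -> dom c p -> forall v, v != 0 -> 0 < pairing (g c p) v v.
Hypothesis nu_unit : forall p, dot (nu p) (nu p) = 1.
Hypothesis nu_normal : forall c p, atlas c -> dom c p -> forall i, dot (nu p) (pd c i Y p) = 0.

Lemma g_unit c p : atlas c -> dom c p -> g c p \in unitmx.
Proof. by move=> ac cp; apply: posdef_unit; exact: gpos. Qed.

Lemma gijE c p i j : atlas c -> dom c p -> g c p i j = dot (pd c i Y p) (pd c j Y p).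
Proof.
move=> ac cp; rewrite gE // mxE; apply: eq_bigr => k _.
by rewrite [_^T _ _]mxE [X in X * _]mxE [X in _ * X]mxE.
Qed.

Lemma g_sym c p : atlas c -> dom c p -> (g c p)^T = g c p.
Proof. by move=> ac cp; rewrite gE // trmx_mul trmxK. Qed.

(** The tangent vectors and nu form a square matrix, for which the metric provides a right inverse.
    A right inverse of a square matrix is also a left inverse, which is the claim. *)
Lemma complete_frame c p : atlas c -> dom c p ->
  (tangent_mx c p)^T *m invmx (g c p) *m tangent_mx c p + (nu p)^T *m nu p = 1%:M.
Proof.
move=> ac cp; set P := tangent_mx c p; set v := nu p.
have Pv : P *m v^T = 0.
  apply/colP => i; have := nu_normal ac cp i; rewrite dotC dotE => E.
  rewrite [RHS]mxE -E -(rowK (fun i => pd c i Y p)) -row_mul.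
  by rewrite [RHS]mxE.
have vP : v *m P^T = 0 by rewrite -(trmxK (v *m P^T)) trmx_mul trmxK Pv trmx0.
have vv : v *m v^T = 1%:M.
  by apply/matrixP => i j; rewrite !ord1 -dotE nu_unit mxE.
have gu := g_unit ac cp.
have E : col_mx P v *m row_mx (P^T *m invmx (g c p)) v^T = 1%:M.
  rewrite mul_col_row !mulmxA -(gE ac cp) mulmxV // Pv vP mul0mx vv.
  by rewrite -scalar_mx_block.
by have := mulmx1C E; rewrite mul_row_col.
Qed.

Definition second_form c p i j := dot (pd c i nu p) (pd c j Y p).

Lemma decompose c p (w : 'rV[R]_3) : atlas c -> dom c p ->
  w = w *m (tangent_mx c p)^T *m invmx (g c p) *m tangent_mx c p + dot w (nu p) *: nu p.
Proof.
move=> ac cp; rewrite -[LHS]mulmx1 -(complete_frame ac cp) mulmxDr !mulmxA.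
apply: (congr1 (fun z => _ + z)).
have -> : w *m (nu p)^T = (dot w (nu p))%:M.
  by apply/matrixP => i j; rewrite !ord1 -dotE mxE.
by rewrite mul_scalar_mx.
Qed.

Lemma Yd c i p : atlas c -> dom c p -> dfr c (pd c i Y) p.
Proof.
move=> ac cp; apply: (CkM_dfr (k := 0) (O := dom c)) => //.
apply: CkM_pd => //; [exact: dom_open|exact: Ys].
Qed.

Lemma nud c p : atlas c -> dom c p -> dfr c nu p.
Proof. by move=> ac cp; exact: (CkM_dfr (nus 1 ac) cp). Qed.

Lemma Y2_sym c i j p : atlas c -> dom c p -> pd c i (pd c j Y) p = pd c j (pd c i Y) p.
Proof.
move=> ac cp; have oc := @dom_open _ _ _ c; have sc : dom c `<=` dom c by [].
apply/rowP => k.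
have E a b : pd c a (pd c b Y) p 0 k = pd c a (pd c b (fun q => Y q 0 k)) p.
  rewrite -(pd_entry a 0 k (Yd b ac cp)); apply: near_pd => //.
  apply: (open_near oc cp) => q cq; rewrite pd_entry //.
  exact: (CkM_dfr (Ys 1 ac) cq).
apply: (etrans (E i j)); apply: (etrans _ (esym (E j i))).
apply: (pd_sym _ _ oc sc cp); apply: (CkM_entry oc sc); exact: Ys.
Qed.

Lemma Y3_sym c i j k p : atlas c -> dom c p ->
  pd c i (pd c j (pd c k Y)) p = pd c j (pd c i (pd c k Y)) p.
Proof.
move=> ac cp; have oc := @dom_open _ _ _ c; have sc : dom c `<=` dom c by [].
have C2 l : CkM l c (dom c) (pd c k Y) by apply: CkM_pd => //; exact: Ys.
apply/rowP => e.
have E a b : pd c a (pd c b (pd c k Y)) p 0 e = pd c a (pd c b (fun q => pd c k Y q 0 e)) p.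
  have d1 : dfr c (pd c b (pd c k Y)) p.
    by apply: (CkM_dfr (k := 0) (O := dom c)) => //; apply: CkM_pd.
  rewrite -(pd_entry a 0 e d1); apply: near_pd => //.
  apply: (open_near oc cp) => q cq; rewrite pd_entry //.
  exact: (CkM_dfr (C2 1) cq).
apply: (etrans (E i j)); apply: (etrans _ (esym (E j i))).
by apply: (pd_sym _ _ oc sc cp); apply: (CkM_entry oc sc).
Qed.

(** Differentiation of nu . Y_j = 0. The sign reflects the convention h_ij = D_i nu . Y_j, positive
    for round spheres with outward normal. *)
Lemma second_formE c i j p : atlas c -> dom c p ->
  dot (pd c i (pd c j Y) p) (nu p) = - second_form c p i j.
Proof.
move=> ac cp; apply/eqP; rewrite -addr_eq0 addrC /second_form dotC [X in _ + X]dotC.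
rewrite [X in X + _]dotC.
rewrite -(pd_dot i cp (nud ac cp) (Yd j ac cp)).
rewrite (near_pd (g := fun=> 0) i cp); first by rewrite pd_cst.
by apply: (open_near (@dom_open _ _ _ c) cp) => q cq; exact: nu_normal.
Qed.

Lemma second_form_sym c i j p : atlas c -> dom c p ->
  second_form c p i j = second_form c p j i.
Proof.
move=> ac cp; apply: oppr_inj.
apply: (etrans (esym (second_formE i j ac cp))); apply: (etrans _ (second_formE j i ac cp)).
exact: (congr1 (fun z => dot z _) (Y2_sym i j ac cp)).
Qed.

Lemma pd_g c i j l p : atlas c -> dom c p -> pd c i (fun q => g c q j l) p =
  dot (pd c i (pd c j Y) p) (pd c l Y p) + dot (pd c j Y p) (pd c i (pd c l Y) p).
Proof.
move=> ac cp; rewrite -(pd_dot i cp (Yd j ac cp) (Yd l ac cp)); apply: near_pd => //.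
by apply: (open_near (@dom_open _ _ _ c) cp) => q cq; exact: gijE.
Qed.

Lemma christoffelE c p k i j : atlas c -> dom c p ->
  christoffel g c p k i j = \sum_l invmx (g c p) k l * dot (pd c i (pd c j Y) p) (pd c l Y p).
Proof.
move=> ac cp; rewrite /christoffel mulr_sumr; apply: eq_bigr => l _.
rewrite !pd_g // mulrCA; apply: (congr1 (fun z => _ * z)).
apply: christoffel_first_kind; exact: Y2_sym.
Qed.

Lemma tangent_part c p (w : 'rV[R]_3) : atlas c -> dom c p ->
  w *m (tangent_mx c p)^T *m invmx (g c p) *m tangent_mx c p =
  \sum_k (\sum_l invmx (g c p) k l * dot w (pd c l Y p)) *: pd c k Y p.
Proof.
move=> ac cp; rewrite mulmx_sum_row; apply: eq_bigr => k _; rewrite rowK.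
apply: (congr1 (fun z => z *: _)); rewrite mxE; apply: eq_bigr => l _.
rewrite mulrC; congr (_ * _); first by rewrite -[in RHS](trmx_invmx (g_sym ac cp)) mxE.
by rewrite mxE; apply: eq_bigr => e _; rewrite [_^T _ _]mxE [tangent_mx c p l e]mxE.
Qed.

Lemma gauss_formula c p i j : atlas c -> dom c p ->
  \sum_k christoffel g c p k i j *: pd c k Y p =
  pd c i (pd c j Y) p + second_form c p i j *: nu p.
Proof.
move=> ac cp; have D := decompose (pd c i (pd c j Y) p) ac cp.
apply: etrans (add_normal_part D (second_formE i j ac cp)).
apply: (etrans _ (esym (tangent_part _ ac cp))).
by apply: eq_bigr => k _; rewrite (christoffelE k i j ac cp).
Qed.

Lemma g_CkM k c : atlas c -> CkM k c (dom c) (g c).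
Proof.
move=> ac; have oc := @dom_open _ _ _ c; have sc : dom c `<=` dom c by [].
have TC : CkM k c (dom c) (tangent_mx c).
  apply: (CkM_mx oc sc) => i j; apply: (eq_CkM oc sc (f := fun p => pd c i Y p 0 j)).
    by move=> p _; rewrite mxE.
  by apply: (CkM_entry oc sc); apply: (CkM_pd oc sc); exact: Ys.
apply: (eq_CkM oc sc (f := fun p => tangent_mx c p *m (tangent_mx c p)^T)).
  by move=> p cp; rewrite gE.
by apply: (CkM_mulmx oc sc) => //; exact: (CkM_tr oc sc).
Qed.

Lemma invg_CkM k c : atlas c -> CkM k c (dom c) (fun p => invmx (g c p)).
Proof.
move=> ac; have oc := @dom_open _ _ _ c; have sc : dom c `<=` dom c by [].
by apply: (CkM_invmx oc sc); [move=> p cp; exact: g_unit|exact: g_CkM].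
Qed.

Lemma christoffel_dfr c p k i j : atlas c -> dom c p ->
  dfr c (fun q => christoffel g c q k i j) p.
Proof.
move=> ac cp; have oc := @dom_open _ _ _ c; have sc : dom c `<=` dom c by [].
apply: (CkM_dfr (k := 0) (O := dom c)) => //.
apply: (CkMM oc sc); first exact: CkM_cst.
have GC := g_CkM 2 ac.
apply: (CkM_sum oc sc) => l _; apply: (CkMM oc sc).
  by apply: (CkM_entry oc sc); exact: invg_CkM.
by apply: (CkMB oc sc); first apply: (CkMD oc sc);
  apply: (CkM_pd oc sc); apply: (CkM_entry oc sc).
Qed.

Lemma second_form_CkM k c i j : atlas c -> CkM k c (dom c) (fun p => second_form c p i j).
Proof.
move=> ac; have oc := @dom_open _ _ _ c; have sc : dom c `<=` dom c by [].
by apply: (CkM_dot oc sc); apply: (CkM_pd oc sc); [exact: nus|exact: Ys].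
Qed.

Lemma gauss_formula_tangent c p i j l : atlas c -> dom c p ->
  dot (pd c i (pd c j Y) p) (pd c l Y p) = \sum_k christoffel g c p k i j * g c p k l.
Proof.
move=> ac cp; have := congr1 (fun z => dot z (pd c l Y p)) (gauss_formula i j ac cp).
rewrite dot_suml dotDl dotZl (nu_normal ac cp l) mulr0 addr0 => /esym E.
apply: (etrans E); apply: eq_bigr => k _.
by rewrite dotZl (gijE k l ac cp).
Qed.

(** The Gauss formula is differentiated along the k-th coordinate and paired with Y_l. Of the
    derivative of h_ij nu only h_ij D_k nu survives, which contributes h_ij h_kl. *)
Lemma gauss_diff c p k i j l : atlas c -> dom c p ->
  \sum_e (pd c k (fun q => christoffel g c q e i j) p * g c p e l
    + christoffel g c p e i j * \sum_m christoffel g c p m k e * g c p m l) =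
  dot (pd c k (pd c i (pd c j Y)) p) (pd c l Y p) + second_form c p i j * second_form c p k l.
Proof.
move=> ac cp.
have dG e := christoffel_dfr e i j ac cp.
have dh : dfr c (fun q => second_form c q i j) p by exact: (CkM_dfr (second_form_CkM 1 i j ac)).
have dY2 : dfr c (pd c i (pd c j Y)) p.
  apply: (CkM_dfr (k := 0) (O := dom c)) => //; have oc := @dom_open _ _ _ c.
  by apply: CkM_pd => //; apply: CkM_pd => //; exact: Ys.
have nE : \near p, \sum_e christoffel g c p e i j *: pd c e Y p =
    pd c i (pd c j Y) p + second_form c p i j *: nu p.
  by apply: (open_near (@dom_open _ _ _ c) cp) => q cq; exact: gauss_formula.
have E := near_pd k cp nE.
have dS e := dfrZ (dG e) (Yd e ac cp).
have EL := pd_sum (f := fun e q => christoffel g c q e i j *: pd c e Y q) k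
  (index_enum 'I_2) dS.
have ER := etrans (pdD k dY2 (dfrZ dh (nud ac cp)))
  (congr1 (fun z => _ + z) (pdZ k cp dh (nud ac cp))).
have := congr1 (fun z => dot z (pd c l Y p)) (etrans (esym EL) (etrans E ER)).
rewrite dot_suml !dotDl !dotZl (nu_normal ac cp l) mulr0 add0r => E2.
apply: etrans E2; apply: eq_bigr => e _.
rewrite (pdZ k cp (dG e) (Yd e ac cp)) dotDl !dotZl.
by rewrite (gijE e l ac cp) (gauss_formula_tangent k e l ac cp).
Qed.

Lemma gauss_equation p : let c := chart_at p in
  gauss_curvature g p = (second_form c p 0 0 * second_form c p 1 1
    - second_form c p 0 1 * second_form c p 1 0) / \det (g c p).
Proof.
move=> c; have ac : atlas c by exact: chart_at_atlas.
have cp : dom c p by exact: chart_at_dom.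
rewrite /gauss_curvature -/c; apply: (congr1 (fun z => z / _)).
apply: (gauss_algebra (gauss_diff 0 1 1 0 ac cp) (gauss_diff 1 0 1 0 ac cp)).
exact: (congr1 (fun z => dot z _) (Y3_sym 0 1 1 ac cp)).
Qed.

Lemma det_second_form_gt0 p : let c := chart_at p in 0 < gauss_curvature g p ->
  0 < second_form c p 0 0 * second_form c p 1 1 - second_form c p 0 1 * second_form c p 0 1.
Proof.
move=> c; have ac : atlas c by exact: chart_at_atlas.
have cp : dom c p by exact: chart_at_dom.
rewrite gauss_equation -/c (second_form_sym 1 0 ac cp) => K0.
by rewrite -(pmulr_lgt0 _ (_ : 0 < (\det (g c p))^-1)) // invr_gt0; apply: det_posdef2; exact: gpos.
Qed.

(** If [a . nu] vanishes near a point where the second fundamental form is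
    nondegenerate, then the tangential vector [a] is annihilated by it. *)
Lemma normal_component_nonzero p (a : 'rV[R]_3) : 0 < gauss_curvature g p ->
  (\near p, dot (nu p) a = 0) -> a = 0.
Proof.
move=> K0 an; set c := chart_at p; have ac : atlas c by exact: chart_at_atlas.
have cp : dom c p by exact: chart_at_dom.
have D0 := det_second_form_gt0 K0.
have nia i : dot (pd c i nu p) a = 0.
  rewrite -(pd_dotl a i cp (nud ac cp)).
  by rewrite (near_pd (g := fun=> 0) i cp) // pd_cst.
have D := decompose a ac cp.
rewrite (dotC a) (nbhs_singleton an) scale0r addr0 in D.
set al := a *m (tangent_mx c p)^T *m invmx (g c p) in D.
have E i : al 0 0 * second_form c p i 0 + al 0 1 * second_form c p i 1 = 0.
  apply: etrans (nia i); rewrite dotC.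
  have R0 : row 0 (tangent_mx c p) = pd c 0 Y p by exact: rowK.
  have R1 : row 1 (tangent_mx c p) = pd c 1 Y p by exact: rowK.
  have := dot_mulmx2 al (tangent_mx c p) (pd c i nu p).
  by rewrite -D R0 R1 => ->.
have [a0 a1] := cramer2_zero (lt0r_neq0 D0) (E 0) (E 1) (second_form_sym 1 0 ac cp).
have al0 : al = 0 by apply/rowP => j; rewrite [RHS]mxE; case: (ord2_cases j) => ->.
by rewrite D al0 mul0mx.
Qed.

Definition mean_in c p := \sum_i \sum_j invmx (g c p) i j * second_form c p i j.

Lemma euclidean_mean_curvatureE p : euclidean_mean_curvature g Y nu p = mean_in (chart_at p) p.
Proof. by []. Qed.

Lemma second_form_mean_gt0 p : let c := chart_at p in 0 < gauss_curvature g p ->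
  0 < second_form c p 0 0 * mean_in c p.
Proof.
move=> c K0; have ac : atlas c by exact: chart_at_atlas.
have cp : dom c p by exact: chart_at_dom.
have D0 := det_second_form_gt0 K0.
by apply: (trace_pos2 (gpos ac cp) (g_sym ac cp) (second_form_sym 1 0 ac cp) D0).
Qed.

Lemma mean_in_chart c c' p : atlas c -> atlas c' -> dom c p -> dom c' p ->
  mean_in c' p = mean_in c p.
Proof.
move=> ac ac' cp c'p; rewrite /mean_in.
have tE : tangent_mx c' p = jac c' c p *m tangent_mx c p.
  apply/row_matrixP => i; rewrite rowK row_mul mulmx_sum_row.
  rewrite (pd_chart i ac ac' cp c'p (CkM_dfr (Ys 1 ac) cp)).
  by apply: eq_bigr => j _; rewrite (rowK (fun i => pd c i Y p)) [row _ _ _ _]mxE.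
have gE' : g c' p = jac c' c p *m g c p *m (jac c' c p)^T.
  by rewrite (gE ac' c'p) (gE ac cp) tE trmx_mul !mulmxA.
have gu := g_unit ac' c'p; rewrite gE' in gu; rewrite gE'.
apply: (contract_congruence (W := R^o) gu) => i j.
rewrite /second_form (pd_chart i ac ac' cp c'p (nud ac cp)).
rewrite (pd_chart j ac ac' cp c'p (CkM_dfr (Ys 1 ac) cp)).
rewrite dot_suml; apply: eq_bigr => k _; rewrite dotZl dotC dot_suml mulr_sumr.
by apply: eq_bigr => l _; rewrite dotZl mulrA dotC.
Qed.

Lemma mean_CkM k c : atlas c -> CkM k c (dom c) (euclidean_mean_curvature g Y nu).
Proof.
move=> ac; have oc := @dom_open _ _ _ c; have sc : dom c `<=` dom c by [].
apply: (eq_CkM oc sc (f := mean_in c)).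
  move=> p cp; rewrite euclidean_mean_curvatureE.
  exact: (esym (mean_in_chart ac (chart_at_atlas p) cp (chart_at_dom p))).
apply: (CkM_sum oc sc) => i _; apply: (CkM_sum oc sc) => j _; apply: (CkMM oc sc).
  by apply: (CkM_entry oc sc); exact: invg_CkM.
exact: second_form_CkM.
Qed.

Lemma mean_continuous : continuous (euclidean_mean_curvature g Y nu).
Proof.
move=> p; apply: (CkM_continuous (@dom_open _ _ _ (chart_at p)) _ (mean_CkM 0 (chart_at_atlas p)));
  [by []|exact: chart_at_dom].
Qed.

(** By the Gauss formula the Christoffel terms cancel the tangential part of Y_ij, so that the
    Hessian of - Y . a is h_ij (nu . a); its trace is k (nu . a). *)
Lemma laplacian_height p (a : 'rV[R]_3) :
  laplacian g (fun q => - dot (Y q) a) p = euclidean_mean_curvature g Y nu p * dot (nu p) a.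
Proof.
rewrite euclidean_mean_curvatureE /mean_in /laplacian; set c := chart_at p.
have ac : atlas c by exact: chart_at_atlas.
have cp : dom c p by exact: chart_at_dom.
have dY q : dom c q -> dfr c Y q by exact: (CkM_dfr (Ys 1 ac)).
have E1 j q : dom c q -> pd c j (fun q => - dot (Y q) a) q = dot (pd c j Y q) (- a).
  move=> cq; rewrite -(pd_dotl (- a) j cq (dY q cq)).
  by apply: (congr1 (fun f => pd c j f q)); apply/funext => r; rewrite dotNr.
have E2 i j : pd c i (pd c j (fun q => - dot (Y q) a)) p = dot (pd c i (pd c j Y) p) (- a).
  rewrite -(pd_dotl (- a) i cp (Yd j ac cp)); apply: near_pd => //.
  by apply: (open_near (@dom_open _ _ _ c) cp) => q cq; exact: E1.
rewrite mulr_suml; apply: eq_bigr => i _; rewrite mulr_suml; apply: eq_bigr => j _.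
rewrite -mulrA; apply: (congr1 (fun z => _ * z)).
rewrite (E2 i j).
have -> : \sum_k christoffel g c p k i j * pd c k (fun q => - dot (Y q) a) p =
    dot (\sum_k christoffel g c p k i j *: pd c k Y p) (- a).
  by rewrite dot_suml; apply: eq_bigr => k _; rewrite dotZl (E1 k p cp).
rewrite (gauss_formula i j ac cp) dotDl dotZl.
by rewrite opprD addrA subrr sub0r -mulrN !dotNr opprK.
Qed.

Lemma gradient_height p (a : 'rV[R]_3) : let c := chart_at p in
  gradient g (fun q => - dot (Y q) a) p = - (a *m (tangent_mx c p)^T *m invmx (g c p)).
Proof.
move=> c; have ac : atlas c by exact: chart_at_atlas.
have cp : dom c p by exact: chart_at_dom.
rewrite /gradient /sharp -/c -!mulNmx; apply: (congr1 (fun z => z *m _)).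
apply/rowP => i; rewrite mxE.
have -> : (fun q => - dot (Y q) a) = (fun q => dot (Y q) (- a)).
  by apply/funext => r; rewrite dotNr.
rewrite (pd_dotl (- a) i cp (CkM_dfr (Ys 1 ac) cp)) dotC mxE.
by apply: eq_bigr => e _; rewrite [_^T _ _]mxE [tangent_mx c p i e]mxE.
Qed.

(** The gradient is minus the tangential part of a, and the completeness relation of the frame is
    Pythagoras for a. *)
Lemma gradient_height_norm p (a : 'rV[R]_3) :
  let dt := gradient g (fun q => - dot (Y q) a) p in
  pairing (g (chart_at p) p) dt dt = dot a a - dot (nu p) a ^+ 2.
Proof.
rewrite /= gradient_height; set c := chart_at p.
have ac : atlas c by exact: chart_at_atlas.
have cp : dom c p by exact: chart_at_dom.
rewrite /pairing linearN /= mulNmx mulNmx mulmxN opprK !trmx_mul trmxK.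
rewrite (trmx_invmx (g_sym ac cp)) mulmxKV ?(g_unit ac cp) //.
have E := congr1 (fun z => a *m z *m a^T) (complete_frame ac cp).
rewrite /= mulmx1 mulmxDr mulmxDl !mulmxA in E.
have -> : dot (nu p) a ^+ 2 = (a *m (nu p)^T *m nu p *m a^T) 0 0.
  have -> : a *m (nu p)^T = (dot (nu p) a)%:M.
    by apply/matrixP => i j; rewrite !ord1 -dotE dotC mxE.
  by rewrite mul_scalar_mx -scalemxAl mxE -dotE expr2.
rewrite dotE -E [in RHS]mxE addrK.
by rewrite !mulmxA.
Qed.

(** At a maximum of |Y|^2 the first derivatives make Y normal, Y = r nu. The second derivative along
    the coordinate 0 gives g_00 + Y . Y_00 <= 0, and Y . Y_00 = - r h_00, so that r h_00 >= g_00 >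
    0. *)
Lemma farthest_point p : (forall q, dot (Y q) (Y q) <= dot (Y p) (Y p)) ->
  let r := dot (Y p) (nu p) in let c := chart_at p in
  Y p = r *: nu p /\ 0 < r * second_form c p 0 0.
Proof.
move=> fmax r c; have ac : atlas c by exact: chart_at_atlas.
have cp : dom c p by exact: chart_at_dom.
have oc := @dom_open _ _ _ c; have sc : dom c `<=` dom c by [].
have dY q : dom c q -> dfr c Y q by exact: (CkM_dfr (Ys 1 ac)).
have fC : CkM 2 c (dom c) (fun q => dot (Y q) (Y q)).
  by apply: (CkM_dot oc sc); exact: Ys.
have P i := pd_max i cp fC fmax.
have D1 i q : dom c q -> pd c i (fun q => dot (Y q) (Y q)) q = 2 * dot (pd c i Y q) (Y q).
  move=> cq; rewrite (pd_dot i cq (dY q cq) (dY q cq)) [X in _ + X]dotC.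
  by rewrite mulr2n mulrDl mul1r.
have D1p i : dot (Y p) (pd c i Y p) = 0.
  have [] := P i; rewrite (D1 i p cp) => /eqP; rewrite mulf_eq0 pnatr_eq0 /= dotC.
  by move=> /eqP.
have YE : Y p = r *: nu p.
  rewrite [LHS](decompose (Y p) ac cp) (tangent_part (Y p) ac cp) big1 ?add0r // => k _.
  rewrite big1 ?scale0r // => l _.
  by rewrite (D1p l) mulr0.
split=> //.
have [_] := P 0.
have -> : pd c 0 (pd c 0 (fun q => dot (Y q) (Y q))) p =
    2 * (dot (pd c 0 (pd c 0 Y) p) (Y p) + dot (pd c 0 Y p) (pd c 0 Y p)).
  have H1 : \near p, pd c 0 (fun q => dot (Y q) (Y q)) p = 2 * dot (pd c 0 Y p) (Y p).
    by apply: (open_near oc cp) => q cq; exact: D1.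
  apply: (etrans (near_pd 0 cp H1)).
  have d2 := dfr_dot (Yd 0 ac cp) (dY p cp).
  apply: (etrans (pdM 0 cp (dfr_cst c (2 : R^o) p) d2)).
  rewrite (pd_cst c 0 (2 : R^o)) mul0r add0r.
  by rewrite (pd_dot 0 cp (Yd 0 ac cp) (dY p cp)).
rewrite pmulr_rle0 // -(gijE 0 0 ac cp).
rewrite {1}YE dotZr (second_formE 0 0 ac cp) mulrN addrC subr_le0.
by apply: lt_le_trans; apply: posdef2_00; exact: gpos.
Qed.

Lemma ray_unbounded (v : 'rV[R]_3) (s0 : R) : v != 0 -> s0 < 0 ->
  ~ bounded_set [set s *: v | s in [set s | s <= s0]].
Proof.
move=> v0 s00 [M' [_ bM']].
have bM := bM' (M' + 1) (ltr_pwDr ltr01 (lexx M')).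
set M := M' + 1 in bM.
have vp : 0 < `|v| by rewrite normr_gt0.
pose s := Num.min s0 (- ((`|M| + 1) / `|v|)).
have ss : s <= s0 by rewrite ge_min lexx.
have := bM (s *: v); rewrite /= => /(_ (ex_intro2 _ _ s ss erefl)).
rewrite normrZ leNgt => /negP; apply.
have sn : s < 0 by exact: le_lt_trans ss s00.
rewrite ltr0_norm // -ltr_pdivrMr // ltrNr.
have : s <= - ((`|M| + 1) / `|v|) by rewrite ge_min lexx orbT.
move=> /le_lt_trans; apply; rewrite ltrN2 ltr_pM2r ?invr_gt0 //.
by apply: (le_lt_trans (ler_norm M)); rewrite ltrDl.
Qed.

(** If r were negative, the ray of the vectors s nu with s <= r - t would start at Y - t nu and lie
    farther from the origin than all of the surface. Being connected, unbounded and disjoint from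
    the surface, it would put its starting point in an unbounded component, against the choice of
    nu. *)
Lemma farthest_outward p : (forall q, dot (Y q) (Y q) <= dot (Y p) (Y p)) ->
  (\forall t \near 0^'+, inside (range Y) (Y p - t *: nu p)) ->
  0 <= dot (Y p) (nu p).
Proof.
move=> fmax ins; have [YE _] := farthest_point fmax; set r := dot (Y p) (nu p) in YE *.
rewrite leNgt; apply/negP => r0.
have [t [t0 [_ bd]]] : exists t, 0 < t /\ inside (range Y) (Y p - t *: nu p).
  by apply: (@filter_ex _ (0^'+)); near=> t; split; near: t; [exact: nbhs_right_gt|].
have v0 : nu p != 0 by rewrite -dot_eq0 nu_unit oner_eq0.
have s0 : r - t < 0 by rewrite subr_lt0 (lt_trans r0).
apply: (ray_unbounded v0 s0); apply: sub_boundedr bd.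
move=> B GB y yL; apply: GB.
apply: (connected_component_max _ _ _ yL).
- by exists (r - t) => //=; rewrite YE -scalerBl.
- move=> _ [s /= sr <-] [q _ E]; have := fmax q.
  rewrite E YE !dotZl !dotZr !nu_unit !mulr1 leNgt => /negP; apply.
  by nra.
- apply: connected_continuous_connected.
    by apply/connected_intervalP => x z /= xs zs x' /andP[_ xz]; exact: le_trans xz zs.
  by apply: continuous_subspaceT => s; exact: scalel_continuous.
Unshelve. all: by end_near. Qed.

Lemma mean_gt0 : compact [set: S] -> connected [set: S] ->
  (forall p, 0 < gauss_curvature g p) ->
  (forall p, \forall t \near 0^'+, inside (range Y) (Y p - t *: nu p)) ->
  forall p, 0 < euclidean_mean_curvature g Y nu p.
Proof.
move=> cS conS K0 ins.
have k0 p : euclidean_mean_curvature g Y nu p != 0.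
  rewrite euclidean_mean_curvatureE; apply/eqP => E.
  by have := second_form_mean_gt0 (K0 p); rewrite E mulr0 ltxx.
have Yc : continuous (fun q => dot (Y q) (Y q)).
  move=> q; apply: (@CkM_continuous _ _ _ (chart_at q) (dom (chart_at q)) _ _ 0).
  - exact: dom_open.
  - by [].
  - have C0 := Ys 0 (chart_at_atlas q).
    exact: (CkM_dot (@dom_open _ _ _ (chart_at q)) (fun _ h => h) C0 C0).
  - exact: chart_at_dom.
have [p _ pmax] : exists2 p, p \in [set: S] & forall q, q \in [set: S] ->
    dot (Y q) (Y q) <= dot (Y p) (Y p).
  by apply: compact_EVT_max => //; [exists point|exact: continuous_subspaceT].
have {}pmax q : dot (Y q) (Y q) <= dot (Y p) (Y p) by apply: pmax; rewrite inE.
have kp : 0 < euclidean_mean_curvature g Y nu p.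
  have [_ rh] := farthest_point pmax.
  have r0 := farthest_outward pmax (ins p).
  have h0 : 0 < second_form (chart_at p) p 0 0.
    rewrite ltNge; apply/negP => h0; have := lt_le_trans rh (mulr_ge0_le0 r0 h0).
    by rewrite ltxx.
  by have := second_form_mean_gt0 (K0 p); rewrite pmulr_rgt0.
pose A := [set q | 0 < euclidean_mean_curvature g Y nu q].
have kc := mean_continuous.
have AT : A = [set: S].
  apply: conS; first by exists p.
    exists A; last by rewrite setTI.
    by apply: (@open_comp _ _ (euclidean_mean_curvature g Y nu) [set x | 0 < x]) => //.
  exists A; last by rewrite setTI.
  (* As k never vanishes, k > 0 and k >= 0 define the same set, which is therefore closed as well as
     open. *)
  have -> : A = euclidean_mean_curvature g Y nu @^-1` [set x | 0 <= x].
    by apply/seteqP; split=> q /=; rewrite /A /= ?lt0r ?k0 // => /ltW.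
  by apply: closed_comp => //; exact: closed_ge.
by move=> q; have : A q by rewrite AT.
Qed.

End EuclideanSurface.

(** * Surfaces in a spacelike hyperplane of Minkowski space *)

Section MinkowskiAlgebra.
Context {R : realType}.

Lemma pairing_eta (s t : R) (u v : 'rV[R]_3) :
  pairing (eta R) (row_mx s%:M u : 'rV[R]_(1 + 3)) (row_mx t%:M v : 'rV[R]_(1 + 3)) = - (s * t) + dot u v.
Proof.
rewrite /pairing /eta mul_row_block !mulmx0 addr0 add0r mulmx1 tr_row_mx mul_row_col.
rewrite -scalar_mxM tr_scalar_mx -scalar_mxM mxE mxE -dotE eqxx mulr1n.
by rewrite mulrN1 mulNr.
Qed.

Lemma lorentz_frame (t3 n3 t4 n4 : R) : - (t3 * t3) + n3 * n3 = 1 ->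
  - (t4 * t4) + n4 * n4 = -1 -> - (t3 * t4) + n3 * n4 = 0 -> 0 < t4 -> 0 < n3 ->
  n3 * t4 - n4 * t3 = 1.
Proof.
move=> E1 E2 E3 t40 n30.
have E4 : n3 * n4 = t3 * t4 by apply/eqP; rewrite -subr_eq0 addrC E3.
have E5 : t4 * t4 - t3 * t3 = 1.
  have H : (n3 * n4) * (n3 * n4) = (n3 * n3) * (n4 * n4) by ring.
  have n33 : n3 * n3 = 1 + t3 * t3 by rewrite -E1; ring.
  have n44 : n4 * n4 = t4 * t4 - 1 by rewrite -E2; ring.
  rewrite E4 n33 n44 in H.
  have : (t4 * t4 - t3 * t3 - 1) = (1 + t3 * t3) * (t4 * t4 - 1) - t3 * t4 * (t3 * t4) by ring.
  by rewrite -H subrr => /eqP; rewrite subr_eq0 => /eqP.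
have n3t4 : n3 = t4.
  apply/eqP; rewrite -(eqrXn2 (n := 2)) ?ltW // !expr2; apply/eqP.
  by move: E1 E5; lra.
have n4t3 : n4 = t3.
  by apply: (mulfI (lt0r_neq0 t40)); rewrite -{1}n3t4 E4 mulrC.
by rewrite n3t4 n4t3.
Qed.

(** With H = - k nu, the coefficients - k n4 and - k n3 are the products of H with the frame
    vectors. In the dual vector the components along nu cancel, and the time component is k times
    the determinant of the frame. *)
Lemma dual_frame (k t3 n3 t4 n4 : R) (v : 'rV[R]_3) : k != 0 -> n3 * t4 - n4 * t3 = 1 ->
  k^-1 *: ((- k * n4) *: (row_mx t3%:M (n3 *: v) : 'rV[R]_(1 + 3))
           - (- k * n3) *: (row_mx t4%:M (n4 *: v) : 'rV[R]_(1 + 3))) = row_mx 1%:M 0.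
Proof.
move=> k0 key; rewrite !scale_row_mx opp_row_mx add_row_mx scale_row_mx.
congr row_mx.
  apply/matrixP => i j; rewrite !ord1 !mxE eqxx !mulr1n.
  have -> : - k * n4 * t3 - - k * n3 * t4 = k * (n3 * t4 - n4 * t3) by ring.
  by rewrite key mulr1 mulVf.
rewrite !scalerA -scalerBl.
have -> : - k * n4 * n3 - - k * n3 * n4 = 0 by ring.
by rewrite scale0r scaler0.
Qed.

End MinkowskiAlgebra.

Section InMinkowski.
Context {R : realType} (S : manifold R 2) (X : S -> minkowski_spacetime R).
Implicit Types (c : chart R 2 S).
Let Y := spatial X.
Let e0 : 'rV[R]_(1 + 3) := delta_mx 0 0.

Definition embed3 (y : 'rV[R]_3) : 'rV[R]_(1 + 3) := row_mx 0 y.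

Lemma embed3_linear : linear embed3.
Proof. by move=> a u v; rewrite /embed3 scale_row_mx add_row_mx scaler0 addr0. Qed.
HB.instance Definition _ := GRing.isLinear.Build R 'rV[R]_3 'rV[R]_(1 + 3) _ embed3 embed3_linear.

Lemma embed3_continuous : continuous embed3.
Proof.
move=> y; apply: continuous_mx => i j.
case: (fintype.splitP j) => k jk.
  rewrite (_ : (fun z => _) = fun=> 0); first exact: cst_continuous.
  apply/funext => z; have -> : j = lshift 3 k by apply/val_inj.
  by rewrite /embed3 row_mxEl mxE.
rewrite (_ : (fun z => _) = fun z : 'rV[R]_3 => z i k); last first.
  apply/funext => z; have -> : j = rshift 1 k by apply/val_inj.
  by rewrite /embed3 row_mxEr.
exact: (differentiable_continuous (differentiable_coord (y : 'rV[R]_3) i k)).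
Qed.

Lemma rsubmx_linear_continuous : continuous (@rsubmx R 1 1 3).
Proof. exact: continuous_rsubmx. Qed.

Hypothesis Xs : smooth_map X.
Hypothesis Xspace : forall p, (X p : 'rV[R]_(1 + 3)) 0 0 = 0.

Lemma X_embed p : (X p : 'rV[R]_(1 + 3)) = embed3 (Y p).
Proof.
apply: (etrans (esym (hsubmxK (X p : 'M[R]_(1, 1 + 3))))); congr row_mx.
apply/matrixP => i j; rewrite !ord1 !mxE -[RHS](Xspace p).
by congr (X p _ _); apply/val_inj.
Qed.

Lemma spatial_CkM k c : atlas c -> CkM k c (dom c) Y.
Proof.
move=> ac; have [_ XC] := Xs.
have C1 := XC c (id_chart R 4) ac erefl k.
have U : dom c `&` X @^-1` dom (id_chart R 4) = dom c.
  by apply/seteqP; split=> [p []|p].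
rewrite U in C1.
exact: (Ck_on_lin (L := @rsubmx R 1 1 3) (chart_image_open (@dom_open _ _ _ c) (fun _ h => h))
  rsubmx_linear_continuous C1).
Qed.

Lemma push_X c i p : atlas c -> dom c p -> push X c i (id_chart R 4) p = embed3 (pd c i Y p).
Proof.
move=> ac cp; have dY := CkM_dfr (spatial_CkM 1 ac) cp.
have E : (coord (id_chart R 4) \o X : S -> 'rV[R]_(1 + 3)) = (fun q => embed3 (Y q)).
  by apply/funext => q; exact: X_embed.
apply: (etrans (congr1 (fun f => pd c i (f : S -> 'rV[R]_(1 + 3)) p) E)).
exact: (partial_lin i (embed3_continuous) dY).
Qed.

Lemma inner_X (Z W : field_along S (minkowski_spacetime R)) p :
  inner X Z W p = pairing (eta R) (Z (id_chart R 4) p) (W (id_chart R 4) p).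
Proof. by []. Qed.

Lemma pairing_embed3 (u v : 'rV[R]_3) : pairing (eta R) (embed3 u) (embed3 v) = dot u v.
Proof.
have E w : embed3 w = row_mx 0%:M w by rewrite /embed3 raddf0.
rewrite (E u) (E v).
by rewrite pairing_eta mulr0 oppr0 add0r.
Qed.

Lemma induced_metric_X c p : atlas c -> dom c p ->
  induced_metric X c p = tangent_mx Y c p *m (tangent_mx Y c p)^T.
Proof.
move=> ac cp; apply/matrixP => i j; rewrite mxE inner_X (push_X i ac cp) (push_X j ac cp).
rewrite pairing_embed3 mxE; apply: eq_bigr => k _.
by rewrite [_^T _ _]mxE [tangent_mx Y c p i k]mxE [tangent_mx Y c p j k]mxE.
Qed.

Lemma christoffel_minkowski d (q : minkowski_spacetime R) k l m :
  christoffel (@lorentz R (minkowski_spacetime R)) d q k l m = 0.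
Proof.
rewrite /christoffel big1 ?mulr0 // => e _.
have E i a b : pd d i (fun q0 => lorentz d q0 a b) q = 0.
  exact: (pd_cst d i (eta R a b : R^o) q).
by rewrite (E l m e) (E m l e) (E e l m) addr0 subr0 mulr0.
Qed.

Lemma cov_X c i (Z : field_along S (minkowski_spacetime R)) p :
  cov X c i Z (id_chart R 4) p = pd c i (Z (id_chart R 4)) p.
Proof.
rewrite /cov -[RHS]addr0; apply: (congr1 (fun z => _ + z)).
apply/rowP => k; rewrite !mxE big1 // => l _; rewrite big1 // => m _.
by rewrite christoffel_minkowski !mul0r.
Qed.

Variables (g : metric_field S) (nu : S -> 'rV[R]_3).
Hypothesis nus : forall k c, atlas c -> CkM k c (dom c) nu.
Hypothesis gX : forall c p, atlas c -> dom c p -> induced_metric X c p = g c p.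
Hypothesis gpos : forall c p, atlas c -> dom c p -> forall v, v != 0 -> 0 < pairing (g c p) v v.
Hypothesis nu_unit : forall p, dot (nu p) (nu p) = 1.
Hypothesis nu_normal : forall c p, atlas c -> dom c p -> forall i, dot (nu p) (pd c i Y p) = 0.

Lemma g_gram c p : atlas c -> dom c p -> g c p = tangent_mx Y c p *m (tangent_mx Y c p)^T.
Proof. by move=> ac cp; rewrite -gX // induced_metric_X. Qed.

Let k0 := euclidean_mean_curvature g Y nu.

(** In the global chart of Minkowski space the covariant derivative is the ordinary one, and the
    normal part of the embedded Y_ij is - h_ij nu. *)
Lemma mean_curvature_X p : mean_curvature X (id_chart R 4) p = embed3 (- k0 p *: nu p).
Proof.
rewrite /mean_curvature; set c := chart_at p.
have ac : atlas c by exact: chart_at_atlas.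
have cp : dom c p by exact: chart_at_dom.
have dY2 i j : pd c i (push X c j (id_chart R 4)) p = embed3 (pd c i (pd c j Y) p).
  have nE : \near p, (push X c j (id_chart R 4) p : 'rV[R]_(1 + 3)) = embed3 (pd c j Y p).
    by apply: (open_near (@dom_open _ _ _ c) cp) => q cq; exact: push_X.
  apply: (etrans (near_pd i cp nE)).
  exact: (partial_lin i embed3_continuous (Yd spatial_CkM j ac cp)).
have N i j : normal_part X c (cov X c i (push X c j)) (id_chart R 4) p =
    embed3 (- second_form Y nu c p i j *: nu p).
  rewrite /normal_part gX // cov_X (dY2 i j).
  have -> : - second_form Y nu c p i j *: nu p =
      pd c i (pd c j Y) p - \sum_k (\sum_l invmx (g c p) k l * dot (pd c i (pd c j Y) p) (pd c l Y p)) *: pd c k Y p.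
    rewrite -(tangent_part g_gram _ ac cp) -(second_formE spatial_CkM nus nu_normal i j ac cp).
    apply/eqP; rewrite eq_sym subr_eq addrC; apply/eqP.
    exact: (decompose g_gram gpos nu_unit nu_normal _ ac cp).
  rewrite linearB; apply: (congr1 (fun z => _ - z)).
  rewrite exchange_big linear_sum; apply: eq_bigr => k _ /=.
  rewrite [RHS]linearZ /= scaler_suml; apply: eq_bigr => l _ /=.
  rewrite inner_X cov_X (dY2 i j) (push_X l ac cp) (push_X k ac cp) pairing_embed3.
  by rewrite -[in RHS](trmx_invmx (g_sym g_gram ac cp)) mxE.
apply: (@etrans _ _ (embed3 (\sum_i \sum_j (invmx (g c p) i j * - second_form Y nu c p i j) *: nu p))).
  rewrite linear_sum; apply: eq_bigr => i _; rewrite linear_sum; apply: eq_bigr => j _ /=.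
  by rewrite gX // N -scalerA [RHS]linearZ.
apply: (congr1 embed3); rewrite /k0 euclidean_mean_curvatureE /mean_in -sumrN scaler_suml.
apply: eq_bigr => i _; rewrite -sumrN scaler_suml; apply: eq_bigr => j _.
by rewrite mulrN.
Qed.

Hypothesis k0_gt0 : forall p, 0 < k0 p.

Lemma norm_H_X p : norm_H X p = k0 p.
Proof.
rewrite /norm_H inner_X mean_curvature_X pairing_embed3 dotZl dotZr nu_unit mulr1.
by rewrite mulrNN -expr2 sqrtr_sqr gtr0_norm.
Qed.

Variables f3 f4 : field_along S (minkowski_spacetime R).
Hypothesis frame : adapted_frame X f3 f4.

(** The normal plane at p is spanned by the time direction and by nu, since the image lies in a time
    slice. *)
Lemma normal_vector_X (Z : field_along S (minkowski_spacetime R)) p : is_normal X Z ->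
  exists t n, Z (id_chart R 4) p = row_mx t%:M (n *: nu p) :> 'rV[R]_(1 + 3).
Proof.
move=> ZN; set z : 'rV[R]_(1 + 3) := Z _ p.
have ac := chart_at_atlas p; have cp := chart_at_dom p; set c := chart_at p in ac cp.
have zE : z = row_mx (z 0 0)%:M (rsubmx z).
  apply: (etrans (esym (hsubmxK (z : 'M[R]_(1, 1 + 3))))); congr row_mx.
  apply/matrixP => i j; rewrite !ord1 !mxE eqxx mulr1n.
  by congr (z _ _); apply/val_inj.
have zY i : dot (rsubmx z) (pd c i Y p) = 0.
  have := ZN c p ac cp i; rewrite inner_X (push_X i ac cp) -/z zE.
  have -> : embed3 (pd c i Y p) = row_mx 0%:M (pd c i Y p) by rewrite /embed3 raddf0.
  by rewrite row_mxKr pairing_eta mulr0 oppr0 add0r.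
exists (z 0 0), (dot (rsubmx z) (nu p)); rewrite [LHS]zE; congr row_mx.
rewrite [LHS](decompose g_gram gpos nu_unit nu_normal _ ac cp).
rewrite (tangent_part g_gram _ ac cp) big1 ?add0r // => k _.
by rewrite big1 ?scale0r // => l _; rewrite zY mulr0.
Qed.

(** For every adapted frame J_0/|H_0| is the constant unit time vector; this is why the connection
    form of X vanishes. The condition on f3 and H_0 gives n3 > 0, and future direction gives t4 >
    0. *)
Lemma normalized_dual_X p :
  normalized X (dual_mean_curvature X f3 f4) (id_chart R 4) p = row_mx 1%:M 0 :> 'rV[R]_(1 + 3).
Proof.
have [_ _ N3 N4 U3 U4 O34 HN FT] := frame.
have [t3 [n3 E3]] := normal_vector_X p N3; have [t4 [n4 E4]] := normal_vector_X p N4.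
have nn x y : dot (x *: nu p) (y *: nu p) = x * y by rewrite dotZl dotZr nu_unit mulr1.
have EH : mean_curvature X (id_chart R 4) p = row_mx 0%:M (- k0 p *: nu p) :> 'rV[R]_(1 + 3).
  by rewrite mean_curvature_X /embed3 raddf0.
have := U3 p; rewrite inner_X E3 pairing_eta nn => u3.
have := U4 p; rewrite inner_X E4 pairing_eta nn => u4.
have := O34 p; rewrite inner_X E3 E4 pairing_eta nn => o34.
have := HN p; rewrite inner_X E3 EH pairing_eta nn mulr0 oppr0 add0r mulrN oppr_lt0.
rewrite pmulr_lgt0 // => n30.
have t40 : 0 < t4.
  have [_] := FT p; rewrite /= /minkowski_metric /minkowski_time.
  have -> : (delta_mx 0 0 : 'rV[R]_(1 + 3)) = row_mx 1%:M 0.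
    apply/rowP => j; rewrite !mxE; case: (fintype.splitP j) => k jk; rewrite !mxE.
      have -> : j = 0 by apply/val_inj; rewrite /= jk ord1.
      by rewrite !ord1 /= mulr1n.
    by have -> : (j == 0) = false by apply/eqP => j0; move: jk; rewrite j0.
  by rewrite [e4 in pairing _ e4]E4 pairing_eta mulr1 (dotC _ 0) dot0l addr0 oppr_lt0.
have key := lorentz_frame u3 u4 o34 t40 n30.
rewrite /normalized /dual_mean_curvature !inner_X E3 E4 EH norm_H_X !pairing_eta !nn.
rewrite !mul0r oppr0 !add0r.
by apply: dual_frame; rewrite ?gt_eqF.
Qed.

Lemma conn_form_X p v : conn_form X f3 f4 p v = 0.
Proof.
apply: big1 => i _; rewrite inner_X cov_X.
have E : (normalized X (dual_mean_curvature X f3 f4) (id_chart R 4) : S -> 'rV[R]_(1 + 3)) =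
    fun=> row_mx 1%:M 0.
  by apply/funext => q; exact: normalized_dual_X.
have -> : pd (chart_at p) i (normalized X (dual_mean_curvature X f3 f4) (id_chart R 4)) p = 0.
  apply: (etrans (congr1 (fun f => pd (chart_at p) i (f : S -> 'rV[R]_(1 + 3)) p) E)).
  exact: pd_cst.
by rewrite /pairing !mul0mx mxE mulr0.
Qed.

End InMinkowski.

(** * The integrand *)

Section Hyperbolic.
Context {R : realType}.
Implicit Types u v x z : R.

Definition cosh x : R := (expR x + expR (- x)) / 2.

Lemma cosh_gt0 x : 0 < cosh x.
Proof. by rewrite divr_gt0 // addr_gt0 // expR_gt0. Qed.

Lemma cosh_sqr x : cosh x ^+ 2 = 1 + sinh x ^+ 2.
Proof.
have E : expR x * expR (- x) = 1 by rewrite -expRD subrr expR0.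
by rewrite /cosh /sinh; move: (expR x) (expR (- x)) E => s t E; field: E.
Qed.

Lemma cosh_asinh z : cosh (asinh z) = Num.sqrt (1 + z ^+ 2).
Proof.
apply/eqP; rewrite -(eqrXn2 (n := 2)) ?sqrtr_ge0 ?(ltW (cosh_gt0 _)) //.
by rewrite cosh_sqr asinhK sqr_sqrtr // addr_ge0 // sqr_ge0.
Qed.

(** The strict inequality 1 + y < exp y, for y = v - u and for y = u - v, applied to the two
    exponentials of cosh. *)
Lemma cosh_tangent_lt u v : u != v -> cosh u + sinh u * (v - u) < cosh v.
Proof.
move=> uv.
have vu : v - u != 0 by rewrite subr_eq0 eq_sym.
have E1 : expR u * (1 + (v - u)) < expR v.
  have -> : expR v = expR u * expR (v - u) by rewrite -expRD addrC subrK.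
  by rewrite ltr_pM2l ?expR_gt0 // expR_gt1Dx.
have E2 : expR (- u) * (1 - (v - u)) < expR (- v).
  have -> : expR (- v) = expR (- u) * expR (- (v - u)) by rewrite -expRD; congr expR; ring.
  by rewrite ltr_pM2l ?expR_gt0 // expR_gt1Dx // oppr_eq0.
rewrite /cosh /sinh -subr_gt0.
have -> : (expR v + expR (- v)) / 2 - ((expR u + expR (- u)) / 2 + (expR u - expR (- u)) / 2 * (v - u)) =
  ((expR v - expR u * (1 + (v - u))) + (expR (- v) - expR (- u) * (1 - (v - u)))) / 2 by field.
by rewrite divr_gt0 // addr_gt0 // subr_gt0.
Qed.

Lemma cosh_tangent u v : cosh u + sinh u * (v - u) <= cosh v.
Proof.
have [->|uv] := eqVneq u v; first by rewrite subrr mulr0 addr0.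
by rewrite ltW // cosh_tangent_lt.
Qed.

End Hyperbolic.

Section EnergyDensity.
Context {R : realType}.
Variables (k h A b : R).
Hypotheses (k0 : 0 < k) (h0 : 0 < h) (A0 : 0 < A) (bA : b ^+ 2 < A ^+ 2).

(** Both (A, b) and (r, x b) lie on the hyperbola of squared radius s; [th0] and [th] are their
    hyperbolic angles. In these terms the two square roots of the density are k A and h r, and its
    inverse hyperbolic sines are [th0] and [th]. *)
Let s := A ^+ 2 - b ^+ 2.
Let x := k / h.
Let r := Num.sqrt (s + x ^+ 2 * b ^+ 2).
Let th0 := asinh (b / Num.sqrt s).
Let th := asinh (x * b / Num.sqrt s).

(** The integrand of the Wang-Yau energy without the connection terms, for
    [|H_0| = k], [|H| = h], [1 + |grad tau|^2 = A^2 - b^2] and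
    [Laplace tau = k b]. *)
Definition reduced_density : R :=
  Num.sqrt (k ^+ 2 * s + (k * b) ^+ 2) - Num.sqrt (h ^+ 2 * s + (k * b) ^+ 2)
  - k * b * (asinh (k * b / (Num.sqrt s * k)) - asinh (k * b / (Num.sqrt s * h))).

Let s0 : 0 < s. Proof. by rewrite subr_gt0. Qed.
Let rs0 : 0 < Num.sqrt s. Proof. by rewrite sqrtr_gt0. Qed.
Let x0 : 0 < x. Proof. by rewrite divr_gt0. Qed.
Let kxh : k = x * h. Proof. by rewrite /x divfK // gt_eqF. Qed.

Let r0 : 0 < r.
Proof. by rewrite sqrtr_gt0 ltr_pwDl // mulr_ge0 // sqr_ge0. Qed.

Let r_sqr : r ^+ 2 = s + x ^+ 2 * b ^+ 2.
Proof.
rewrite sqr_sqrtr //; apply: addr_ge0; first exact: ltW.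
by apply: mulr_ge0; exact: sqr_ge0.
Qed.

Let cosh_th0 : cosh th0 = A / Num.sqrt s.
Proof.
rewrite /th0 cosh_asinh -[RHS]gtr0_norm ?divr_gt0 // -sqrtr_sqr; congr Num.sqrt.
rewrite !exprMn !exprVn sqr_sqrtr ?ltW // -[X in X + _](mulfV (lt0r_neq0 s0)) -mulrDl.
by congr (_ / _); rewrite /s subrK.
Qed.

Let cosh_th : cosh th = r / Num.sqrt s.
Proof.
rewrite /th cosh_asinh -[RHS]gtr0_norm ?divr_gt0 // -sqrtr_sqr; congr Num.sqrt.
rewrite !expr_div_n (sqr_sqrtr (ltW s0)) r_sqr.
by move: x (lt0r_neq0 s0) => y; move: s => z z0; field.
Qed.

Let sinh_th0 : sinh th0 = b / Num.sqrt s. Proof. exact: asinhK. Qed.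
Let sinh_th : sinh th = x * b / Num.sqrt s. Proof. exact: asinhK. Qed.

Lemma reduced_densityE :
  reduced_density - A * (k - h) = h * (A - r - x * b * (th0 - th)).
Proof.
rewrite /reduced_density.
have -> : Num.sqrt (k ^+ 2 * s + (k * b) ^+ 2) = k * A.
  have -> : k ^+ 2 * s + (k * b) ^+ 2 = (k * A) ^+ 2 by rewrite /s; ring.
  by rewrite sqrtr_sqr gtr0_norm // mulr_gt0.
have -> : Num.sqrt (h ^+ 2 * s + (k * b) ^+ 2) = h * r.
  have -> : h ^+ 2 * s + (k * b) ^+ 2 = (h * r) ^+ 2.
    by rewrite [in RHS]exprMn r_sqr kxh; move: x s => y z; ring.
  by rewrite sqrtr_sqr gtr0_norm // mulr_gt0.
have -> : k * b / (Num.sqrt s * k) = b / Num.sqrt s.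
  by field; rewrite !gt_eqF.
have -> : k * b / (Num.sqrt s * h) = x * b / Num.sqrt s.
  by rewrite /x; field; rewrite !gt_eqF.
by rewrite -/th0 -/th {1 2 3}kxh; ring.
Qed.

(** The tangent line to cosh at [th], evaluated at [th0] and multiplied by sqrt s. *)
Let tangent_th : r + x * b * (th0 - th) <= A.
Proof.
have := cosh_tangent th th0; rewrite cosh_th cosh_th0 sinh_th.
by rewrite [x * b / _ * _]mulrAC -mulrDl ler_pM2r ?invr_gt0.
Qed.

Lemma reduced_density_ge : A * (k - h) <= reduced_density.
Proof.
rewrite -subr_ge0 reduced_densityE mulr_ge0 ?(ltW h0) //.
by rewrite -addrA -opprD subr_ge0.
Qed.

(** Strict convexity forces the two angles to agree, hence x b = b: either x = 1, that is h = k, or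
    b = 0. *)
Lemma reduced_density_eq : reduced_density = A * (k - h) <-> h = k \/ b = 0.
Proof.
split=> [E|E]; last first.
  have xb : x * b = b.
    by case: E => [hk|->]; rewrite ?mulr0 // /x hk divff ?mul1r // gt_eqF.
  apply/eqP; rewrite -subr_eq0 reduced_densityE.
  have -> : th = th0 by rewrite /th xb.
  have -> : r = A.
    apply/eqP; rewrite -(eqrXn2 (n := 2)) ?ltW // r_sqr -exprMn xb.
    by rewrite /s subrK.
  by rewrite !subrr mulr0 subrr mulr0.
have /eqP : h * (A - r - x * b * (th0 - th)) = 0 by rewrite -reduced_densityE E subrr.
rewrite mulf_eq0 gt_eqF //= => /eqP E0.
have tt : th = th0.
  apply/eqP; apply/negPn/negP => tt; have := cosh_tangent_lt tt.
  rewrite cosh_th cosh_th0 sinh_th [x * b / _ * _]mulrAC -mulrDl ltr_pM2r ?invr_gt0 //.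
  by rewrite -subr_gt0 opprD addrA E0 ltxx.
have : x * b = b.
  by apply: (mulIf (lt0r_neq0 (_ : 0 < (Num.sqrt s)^-1))); rewrite ?invr_gt0 // -sinh_th -sinh_th0 tt.
move/eqP; rewrite -{2}[b]mul1r -subr_eq0 -mulrBl mulf_eq0 => /orP[|/eqP]; last by right.
rewrite subr_eq0 => /eqP x1; left.
by rewrite kxh x1 mul1r.
Qed.

(** The tangent line is now taken at [th0], which bounds the excess by (k - h)(r - A). Here r - A =
    (x^2 - 1) b^2 / (r + A), since r^2 - A^2 = (x^2 - 1) b^2. *)
Lemma reduced_density_le :
  reduced_density <= A * (k - h) + b ^+ 2 / A * (`|k ^+ 2 / h ^+ 2 + k / h - 2| * `|k - h|).
Proof.
rewrite -lerBlDl reduced_densityE.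
have T : A + b * (th - th0) <= r.
  have := cosh_tangent th0 th; rewrite cosh_th cosh_th0 sinh_th0.
  by rewrite [b / _ * _]mulrAC -mulrDl ler_pM2r ?invr_gt0.
have -> : h * (A - r - x * b * (th0 - th)) = h * (A - r) + h * x * (b * (th - th0)) by ring.
have H1 : h * (A - r) + h * x * (b * (th - th0)) <= h * (A - r) + h * x * (r - A).
  rewrite lerD2l; apply: ler_wpM2l; first exact: ltW (mulr_gt0 h0 x0).
  by rewrite lerBrDl.
apply: (le_trans H1).
have -> : h * (A - r) + h * x * (r - A) = (k - h) * (r - A) by rewrite kxh; ring.
have rA : r - A = (x ^+ 2 - 1) * b ^+ 2 / (r + A).
  have rA0 : r + A != 0 by rewrite gt_eqF // addr_gt0.
  apply: (mulIf rA0); rewrite divfK // -subr_sqr r_sqr /s; ring.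
have -> : k ^+ 2 / h ^+ 2 + k / h - 2 = (x - 1) * (x + 2).
  by rewrite -expr_div_n -/x; ring.
have x1 : 0 < x + 1 by rewrite addr_gt0.
have x2 : 0 < x + 2 by rewrite addr_gt0.
have rA1 : 0 < r + A by rewrite addr_gt0.
have n2 : `|(x - 1) * (x + 2)| = `|x - 1| * (x + 2) by rewrite normrM (gtr0_norm x2).
have n1 : `|r - A| = `|x - 1| * (x + 1) * b ^+ 2 / (r + A).
  rewrite rA; have -> : x ^+ 2 - 1 = (x - 1) * (x + 1) by move: x => y; ring.
  by rewrite !normrM (gtr0_norm x1) -normrM -expr2 (ger0_norm (sqr_ge0 b)) normfV (gtr0_norm rA1).
apply: (le_trans (ler_norm _)); rewrite n2 normrM n1 [leRHS]mulrA [leLHS]mulrC.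
apply: ler_wpM2r => //.
have -> : `|x - 1| * (x + 1) * b ^+ 2 / (r + A) = b ^+ 2 * (`|x - 1| * ((x + 1) / (r + A))).
  by move: `|x - 1| (x + 1) (r + A)^-1 => u v w; ring.
have -> : b ^+ 2 / A * (`|x - 1| * (x + 2)) = b ^+ 2 * (`|x - 1| * ((x + 2) / A)).
  by move: `|x - 1| (x + 2) A^-1 => u v w; ring.
apply: ler_wpM2l; first exact: sqr_ge0.
apply: ler_wpM2l => //.
(* The two enlargements that lead to the constant in the statement: x + 1 becomes x + 2, and r + A
   in the denominator becomes A. *)
apply: ler_pM.
- exact: ltW.
- by rewrite invr_ge0 ltW.
- by rewrite lerD2l ler1n.
- by rewrite lef_pV2 ?posrE // lerDr ltW.
Qed.

End EnergyDensity.

(** * The area measure *)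

Section IntegralMonotone.
Local Open Scope ereal_scope.

(** The integral of a nonnegative function is a supremum over the simple functions below it, and a
    larger function has more of them below it. Pointwise bounds alone thus compare the area density
    with constants. *)
Lemma ge0_subset_le_integral d (T : measurableType d) (R : realType)
    (mu : {measure set T -> \bar R}) (D : set T) (f1 f2 : T -> \bar R) :
  (forall x, D x -> 0 <= f1 x) -> (forall x, D x -> f1 x <= f2 x) ->
  \int[mu]_(x in D) f1 x <= \int[mu]_(x in D) f2 x.
Proof.
move=> f10 f12; rewrite !ge0_integralE //; last by move=> x Dx; exact: le_trans (f10 _ Dx) (f12 _ Dx).
apply: le_ereal_sup => _ [h hf <-]; exists h => // x.
by apply: le_trans (hf x) _; rewrite !patchE; case: ifPn => // /set_mem; exact: f12.
Qed.

End IntegralMonotone.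

Section AreaMeasure.
Context {R : realType} (S : manifold R 2) (g : metric_field S).
Variable mu : {measure set (borel S) -> \bar R}.
Hypothesis mu_area : area_measure g mu.
Hypothesis gC : forall c, atlas c -> CkM 0 c (dom c) (g c).
Hypothesis gdet : forall c p, atlas c -> dom c p -> 0 < \det (g c p).
Hypothesis Scompact : compact [set: S].

Lemma open_borel (O : set S) : open O -> measurable (O : set (borel S)).
Proof. by move=> oO; apply: sub_sigma_algebra. Qed.

(** The norm on row vectors is the maximum norm, so coordinate balls are products of intervals,
    whose product measure is explicit. *)
Lemma row2_ball (u : 'rV[R]_2) (e : R) : 0 < e -> [set z : R * R | ball u e (row2 z)] =
  `](u 0 0 - e), (u 0 0 + e)[%classic `*` `](u 0 1 - e), (u 0 1 + e)[%classic.
Proof.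
move=> e0; apply/seteqP; split=> [z /= [_ bz]|z /= []].
  have := bz 0 0; have := bz 0 1; rewrite !mxE /ball /= !in_itv /= !(distrC (u _ _)) !ltr_distl.
  by move=> -> ->.
rewrite !in_itv /= -!ltr_distl => z1 z2; split=> // i j.
by rewrite (ord1 i) mxE /ball /= distrC; case: (ord2_cases j) => ->.
Qed.

Lemma box_measure (a b : R) (e : R) : 0 < e ->
  ((@lebesgue_measure R) \x (@lebesgue_measure R))%E
  (`](a - e), (a + e)[%classic `*` `](b - e), (b + e)[%classic) = ((2 * e) ^+ 2)%:E.
Proof.
move=> e0; rewrite product_measure1E //; try exact: measurable_itv.
have ee (x : R) : ((x + e)%:E - (x - e)%:E)%E = (2 * e)%:E by rewrite -EFinB; congr (_%:E); ring.
have il (x : R) : lebesgue_measure `](x - e), (x + e)[%classic = (2 * e)%:E.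
  rewrite lebesgue_measure_itv /= lte_fin ifT ?ee //.
  by rewrite ltrD2l gtrN.
transitivity ((2 * e)%:E * (2 * e)%:E)%E; last by rewrite -EFinM expr2.
exact: (congr2 *%E (il a) (il b)).
Qed.

(** A is a coordinate ball so small that it stays in O and that the area density lies between half
    and twice its value at p. The finite measure yields finite total area by compactness; the
    positive one detects functions that do not vanish. *)
Lemma open_neighborhood_measure (p : S) (O : set S) : open O -> O p ->
  exists A : set S, [/\ open A, A p, A `<=` O & (0 < mu A < +oo)%E].
Proof.
move=> oO Op; set c := chart_at p.
have cA : atlas c := chart_at_atlas p.
have cp : dom c p := chart_at_dom p.
pose ph u : R := Num.sqrt (\det (g c (param c u))).
have phc : {for coord c p, continuous ph}.
  have : CkM 0 c (dom c) (fun q => Num.sqrt (\det (g c q))).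
    apply: (CkM_sqrt (@dom_open _ _ _ c) (fun _ h => h)) => [q cq|]; first exact: gdet.
    exact: (CkM_det (@dom_open _ _ _ c) (fun _ h => h) (gC cA)).
  by apply; exists p.
have ph0 : 0 < ph (coord c p) by rewrite /ph coordK // sqrtr_gt0; exact: gdet.
have oDO : open (dom c `&` O) by apply: openI => //; exact: dom_open.
have oU : open (coord c @` (dom c `&` O)) by apply: chart_image_open => // q [].
have Up : (coord c @` (dom c `&` O)) (coord c p) by exists p.
have n1 : \forall u \near coord c p, (coord c @` (dom c `&` O)) u.
  exact: (open_near oU Up).
have n2 : \forall u \near coord c p, ph (coord c p) / 2 < ph u < ph (coord c p) * 2.
  have : \forall y \near ph (coord c p), y \in `]ph (coord c p) / 2, ph (coord c p) * 2[.
    apply: near_in_itvoo; rewrite in_itv /=; lra.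
  move=> h.
  have : \forall u \near coord c p, ph u \in `]ph (coord c p) / 2, ph (coord c p) * 2[ by exact: (phc _ h).
  by apply: filterS => u; rewrite in_itv.
have [e /= e0 eU] : exists2 e : R, 0 < e & forall u, ball (coord c p) e u ->
    (coord c @` (dom c `&` O)) u /\ ph (coord c p) / 2 < ph u < ph (coord c p) * 2.
  have [e e0 eP] := (nbhs_ballP _ _).1 (filterI n1 n2).
  by exists e => // u /eP.
pose A := [set q | (dom c `&` O) q /\ ball (coord c p) e (coord c q)].
have AO : A `<=` dom c `&` O by move=> q [].
have oA : open A.
  rewrite openE => q [DOq bq]; apply: filterI; first exact: open_nbhs_nbhs.
  have cq : dom c q by case: DOq.
  apply: (coord_continuous cq); apply: open_nbhs_nbhs; split => //.
  exact: ball_open.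
have imA : coord c @` A = ball (coord c p) e.
  apply/seteqP; split => [_ [q [_ bq] <-] //|u bu].
  have [[q DOq uE] _] := eU _ bu.
  by exists q => //; split => //; rewrite uE.
exists A; split => //.
- by split => //; apply: ballxx.
- by move=> q /AO [].
- rewrite (mu_area cA) //; [|exact: open_borel|by move=> q /AO []].
  rewrite imA row2_ball //.
  set D := _ `*` _.
  have mD : measurable D by apply: measurableX; exact: measurable_itv.
  have phD z : D z -> ph (coord c p) / 2 < ph (row2 z) < ph (coord c p) * 2.
    by rewrite /D -row2_ball // => /eU [].
  have ic (r : R) : (\int[(@lebesgue_measure R) \x (@lebesgue_measure R)]_(z in D)
      cst r%:E z)%E = (r * (2 * e) ^+ 2)%:E.
    rewrite integral_cst // EFinM; congr (_ * _)%E; exact: box_measure.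
  apply/andP; split.
    apply: (@lt_le_trans _ _ (\int[(@lebesgue_measure R) \x (@lebesgue_measure R)]_(z in D)
      (cst (ph (coord c p) / 2)%:E z))%E).
      by rewrite ic lte_fin mulr_gt0 ?divr_gt0 ?exprn_gt0 ?mulr_gt0.
    apply: ge0_subset_le_integral => z Dz; rewrite lee_fin ?divr_ge0 ?(ltW ph0) //.
    by have /andP[/ltW] := phD z Dz.
  apply: (@le_lt_trans _ _ (\int[(@lebesgue_measure R) \x (@lebesgue_measure R)]_(z in D)
      (cst (ph (coord c p) * 2)%:E z))%E).
    apply: ge0_subset_le_integral => z Dz; rewrite lee_fin ?sqrtr_ge0 //.
    by have /andP[_ /ltW] := phD z Dz.
  by rewrite ic ltry.
Qed.

Lemma area_finite : (mu [set: S] < +oo)%E.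
Proof.
have /choice[A AP] p := open_neighborhood_measure openT (I : [set: S] p).
have mA p : measurable (A p : set (borel S)) by apply: open_borel; have [] := AP p.
have fA p : (mu (A p) < +oo)%E by have [_ _ _ /andP[]] := AP p.
have := Scompact; rewrite compact_cover => /(_ S setT A) [||D _ cD].
- by move=> p _; have [] := AP p.
- by move=> p _; exists p => //; have [] := AP p.
have -> : [set: S] = \big[setU/set0]_(p <- finmap.enum_fset D) A p.
  by rewrite -bigcup_fset; apply/seteqP; split => // q /cD [].
suff: measurable ((\big[setU/set0]_(p <- finmap.enum_fset D) A p) : set (borel S)) /\
  (mu (\big[setU/set0]_(p <- finmap.enum_fset D) A p) < +oo)%E by case.
apply: (big_ind (fun B : set S => measurable (B : set (borel S)) /\ (mu B < +oo)%E)).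
- by rewrite measure0; split; [exact: measurable0|exact: ltry].
- move=> B C [mB fB] [mC fC]; split; first exact: measurableU.
  by apply: le_lt_trans (measureU2 mu mB mC) _; exact: lte_add_pinfty.
- by move=> p _; split.
Qed.

Lemma continuous_borel (f : S -> R) : continuous f -> measurable_fun setT (f : borel S -> R).
Proof.
move=> /continuousP fc; apply: (measurability _ (measurable_realfun.RGenOpens.measurableE R)).
move=> _ [_ [a [b ->] <-]]; rewrite setTI; apply: open_borel.
exact/fc/interval_open.
Qed.

Lemma continuous_bounded (f : S -> R) : continuous f -> exists M, forall p, `|f p| <= M.
Proof.
move=> fc; have : bounded_set (f @` [set: S]).
  apply: compact_bounded; apply: continuous_compact => //; exact: continuous_subspaceT.
move=> [M [_ /(_ (M + 1))]]; rewrite ltrDl ltr01 => /(_ isT) h.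
by exists (M + 1) => p; apply: h; exists p.
Qed.

Lemma continuous_integrable (f : S -> R) : continuous f ->
  mu.-integrable setT (EFin \o (f : borel S -> R)).
Proof.
move=> fc; apply: measurable_bounded_integrable => //; first exact: area_finite.
  exact: continuous_borel.
have [M fM] := continuous_bounded fc.
exists M; split; first exact: num_real.
by move=> x Mx p _ /=; apply: le_trans (fM p) (ltW Mx).
Qed.

Lemma surface_meanD (f h : S -> R) : continuous f -> continuous h ->
  surface_mean mu (fun p => f p + h p) = surface_mean mu f + surface_mean mu h.
Proof.
move=> fc hc; rewrite /surface_mean -mulrDr; congr (_ * _).
by apply: (@RintegralD _ (borel S)) => //; exact: continuous_integrable.
Qed.

Lemma surface_meanZ (k : R) (f : S -> R) : continuous f ->
  surface_mean mu (fun p => k * f p) = k * surface_mean mu f.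
Proof.
move=> fc; rewrite /surface_mean mulrCA; congr (_ * _).
by apply: (@RintegralZl _ (borel S)) => //; exact: continuous_integrable.
Qed.

Lemma pi8_gt0 : 0 < (8 * pi : R)^-1.
Proof. by rewrite invr_gt0 mulr_gt0 // pi_gt0. Qed.

Lemma le_surface_mean (f h : S -> R) : continuous f -> continuous h ->
  (forall p, f p <= h p) -> surface_mean mu f <= surface_mean mu h.
Proof.
move=> fc hc fh; rewrite /surface_mean ler_wpM2l ?(ltW pi8_gt0) //.
apply: (@le_Rintegral _ (borel S)) => //; exact: continuous_integrable.
Qed.

(** Where f is positive it exceeds half its value on an open set, which has positive area, so its
    mean could not vanish. *)
Lemma surface_mean_eq0 (f : S -> R) : continuous f -> (forall p, 0 <= f p) ->
  surface_mean mu f = 0 -> forall p, f p = 0.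
Proof.
move=> fc f0 /eqP; rewrite /surface_mean mulf_eq0 (gt_eqF pi8_gt0) /= => /eqP fi0 p.
apply/eqP; rewrite eq_le f0 andbT leNgt; apply/negP => fp.
have fcp : \forall q \near p, f p / 2 < f q.
  have : \forall y \near f p, y \in `]f p / 2, f p + 1[.
    by apply: near_in_itvoo; rewrite in_itv /=; lra.
  move=> h.
  have : \forall q \near p, f q \in `]f p / 2, f p + 1[ by exact: (fc p _ h).
  by apply: filterS => q; rewrite in_itv /= => /andP[].
have : nbhs p [set q | f p / 2 < f q] := fcp.
rewrite nbhsE => -[U [oU Up] Uf].
have [A [oA Ap AO /andP[mA0 mAf]]] := open_neighborhood_measure oU Up.
have mA := open_borel oA.
have fint := continuous_integrable fc.
have : (0 < \int[mu]_(x in setT) (f x)%:E)%E.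
  apply: (@lt_le_trans _ _ (\int[mu]_(x in A) (cst (f p / 2)%:E x))%E).
    by rewrite integral_cst // mule_gt0 // lte_fin divr_gt0.
  apply: (@le_trans _ _ (\int[mu]_(x in A) (f x)%:E)%E).
    apply: ge0_subset_le_integral => x Ax; rewrite lee_fin ?divr_ge0 ?(ltW fp) //.
    exact/ltW/Uf/AO.
  apply: ge0_subset_integral => //.
    exact: measurable_int fint.
  by move=> x _; rewrite lee_fin.
rewrite -(fineK (integrable_fin_num _ fint)) //.
by move: fi0; rewrite /Rintegral => ->; rewrite ltxx.
Qed.

End AreaMeasure.

(** * The energy *)

Section ReducedContinuity.
Context {R : realType} (T : topologicalType).

Lemma continuous_comp_fun (U W : topologicalType) (f : T -> U) (G : U -> W) p :
  {for p, continuous f} -> {for f p, continuous G} -> {for p, continuous (fun q => G (f q))}.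
Proof. exact: continuous_comp. Qed.

Lemma asinh_continuous : continuous (@asinh R).
Proof.
move=> x; have x0 : 0 < x + Num.sqrt (x ^+ 2 + 1).
  have : `|x| < Num.sqrt (x ^+ 2 + 1).
    by rewrite -(@sqrtr_sqr _ x) ltr_sqrt ?ltrDl // ltr_wpDl // sqr_ge0.
  by move=> h; rewrite -ltrBlDl sub0r (le_lt_trans _ h) // -normrN ler_norm.
apply: (@continuous_comp _ _ _ (fun x : R => x + Num.sqrt (x ^+ 2 + 1)) (@ln R)).
  apply: continuousD; first exact: cvg_id.
  apply: continuous_comp; last exact: sqrt_continuous.
  apply: continuousD; last exact: cst_continuous.
  exact: exprn_continuous.
exact: continuous_ln.
Qed.

Lemma reduced_density_continuous (k h b : T -> R) (A : R) p :
  {for p, continuous k} -> {for p, continuous h} -> {for p, continuous b} ->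
  0 < k p -> 0 < h p -> b p ^+ 2 < A ^+ 2 ->
  {for p, continuous (fun q => reduced_density (k q) (h q) A (b q))}.
Proof.
move=> kc hc bc k0 h0 bA.
have sqc (f : T -> R) : {for p, continuous f} -> {for p, continuous (fun q => f q ^+ 2)}.
  by move=> fc; apply: (continuous_comp_fun (G := fun x : R => x ^+ 2) fc); exact: exprn_continuous.
have src (f : T -> R) : {for p, continuous f} -> {for p, continuous (fun q => Num.sqrt (f q))}.
  by move=> fc; apply: (continuous_comp_fun (G := Num.sqrt) fc); exact: sqrt_continuous.
have asc (f : T -> R) : {for p, continuous f} -> {for p, continuous (fun q => asinh (f q))}.
  by move=> fc; apply: (continuous_comp_fun (G := asinh) fc); exact: asinh_continuous.
have kb := continuousM kc bc.
have sc : {for p, continuous (fun q => A ^+ 2 - b q ^+ 2)}.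
  by apply: continuousB; [exact: cst_continuous|exact: sqc].
have sp : 0 < Num.sqrt (A ^+ 2 - b p ^+ 2) by rewrite sqrtr_gt0 subr_gt0.
have quo (f : T -> R) : {for p, continuous f} -> 0 < f p ->
    {for p, continuous (fun q => asinh (k q * b q / (Num.sqrt (A ^+ 2 - b q ^+ 2) * f q)))}.
  move=> fc f0; apply: asc; apply: continuousM => //.
  apply: continuousV; first by rewrite gt_eqF // mulr_gt0.
  by apply: continuousM => //; exact: src.
have rad (f : T -> R) : {for p, continuous f} ->
    {for p, continuous (fun q => Num.sqrt (f q ^+ 2 * (A ^+ 2 - b q ^+ 2) + (k q * b q) ^+ 2))}.
  move=> fc; apply: src; apply: continuousD; last exact: sqc.
  by apply: continuousM => //; exact: sqc.
apply: (continuousB (continuousB (rad _ kc) (rad _ hc))).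
apply: (continuousM kb).
exact: (continuousB (quo _ kc k0) (quo _ hc h0)).
Qed.

Lemma continuous_dot n (u v : T -> 'rV[R]_n) p : {for p, continuous u} -> {for p, continuous v} ->
  {for p, continuous (fun q => dot (u q) (v q))}.
Proof.
move=> uc vc; apply: continuous_at_sum => i _.
apply: continuousM.
  apply: (continuous_comp_fun (G := fun w : 'rV[R]_n => w 0 i) uc).
  exact: differentiable_continuous (differentiable_coord (u p) 0 i).
apply: (continuous_comp_fun (G := fun w : 'rV[R]_n => w 0 i) vc).
exact: differentiable_continuous (differentiable_coord (v p) 0 i).
Qed.

End ReducedContinuity.

Section WangYauDensity.
Context {R : realType} (N : spacetime R) (S : manifold R 2).
Variables (F : S -> N) (e3 e4 : field_along S N).
Variables (X : S -> minkowski_spacetime R) (f3 f4 : field_along S (minkowski_spacetime R)).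
Variable nu : S -> 'rV[R]_3.
Hypotheses (Fs : smooth_map F) (Fsp : spacelike F) (Hsp : spacelike_mean_curvature F).
Hypotheses (e3s : smooth_field_along F e3) (e4s : smooth_field_along F e4).
Hypotheses (Xs : smooth_map X)
  (gX : forall c p, atlas c -> dom c p -> induced_metric X c p = induced_metric F c p)
  (Xspace : forall p, (X p : 'rV[R]_(1 + 3)) 0 0 = 0)
  (frame : adapted_frame X f3 f4).
Let g := induced_metric F.
Let Y := spatial X.
Let k0 := euclidean_mean_curvature g Y nu.
Hypothesis nus : forall k c, atlas c -> CkM k c (dom c) nu.
Hypothesis nu_unit : forall p, dot (nu p) (nu p) = 1.
Hypothesis nu_normal : forall c p, atlas c -> dom c p -> forall i, dot (nu p) (pd c i Y p) = 0.
Hypothesis k0_gt0 : forall p, 0 < k0 p.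

Let Ys : forall k c, atlas c -> CkM k c (dom c) Y.
Proof. by move=> k c ac; exact: spatial_CkM. Qed.
Let gE : forall c p, atlas c -> dom c p -> g c p = tangent_mx Y c p *m (tangent_mx Y c p)^T.
Proof. exact: (g_gram Xs Xspace gX). Qed.
Let gpos : forall c p, atlas c -> dom c p -> forall v, v != 0 -> 0 < pairing (g c p) v v := Fsp.

Lemma conn_vector_R3E p : conn_vector_R3 F e3 e4 X p =
  conn_covector F e3 e4 (chart_at p) p *m invmx (g (chart_at p) p) *m tangent_mx Y (chart_at p) p.
Proof.
rewrite -conn_vectorE mulmx_sum_row; apply: eq_bigr => i _.
by rewrite rowK.
Qed.

Lemma conn_vector_R3_continuous : continuous (conn_vector_R3 F e3 e4 X).
Proof.
move=> p; set c := chart_at p; set d := chart_at (F p).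
have ac : atlas c by exact: chart_at_atlas.
have cp : dom c p by exact: chart_at_dom.
have ad : atlas d by exact: chart_at_atlas.
have dp : dom d (F p) by exact: chart_at_dom.
have o := odom_open Fs c d; have s := @odom_sub _ _ _ F c d.
have CV : CkM 0 c (odom F c d) (conn_vector_R3 F e3 e4 X).
  apply: (eq_CkM o s (f := fun q =>
    conn_covector F e3 e4 c q *m invmx (g c q) *m tangent_mx Y c q)).
    move=> q [cq _]; rewrite conn_vector_R3E.
    apply: esym; apply: (conn_vector_image_chart Fs Fsp Hsp e3s e4s ac (chart_at_atlas q) cq (chart_at_dom q)).
    exact: (CkM_dfr (Ys 1 ac) cq).
  apply: (CkM_mulmx o s).
    by apply: (CkM_mulmx o s); [exact: conn_covector_CkM|exact: (inv_metric_CkM Fs Fsp)].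
  apply: (CkM_sub s) => //.
  apply: (CkM_mx (@dom_open _ _ _ c) (fun _ h => h)) => i j.
  apply: (eq_CkM (@dom_open _ _ _ c) (fun _ h => h) (f := fun q => (pd c i Y q) 0 j)).
    by move=> q _; rewrite [tangent_mx _ _ _ _ _]mxE.
  apply: (CkM_entry (@dom_open _ _ _ c) (fun _ h => h)).
  exact: (CkM_pd (@dom_open _ _ _ c) (fun _ h => h) i (Ys 1 ac)).
exact: (CkM_continuous o s CV (conj cp dp)).
Qed.

Lemma nu_continuous : continuous nu.
Proof.
move=> p; have ac : atlas (chart_at p) by exact: chart_at_atlas.
exact: (CkM_continuous (@dom_open _ _ _ _) (fun _ h => h) (nus 0 ac) (chart_at_dom p)).
Qed.

Lemma height_mink (a : 'rV[R]_3) q : - mink (X q) (observer_of a) = - dot (Y q) a.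
Proof.
congr (- _); rewrite (X_embed Xspace) /embed3 /observer_of.
by have := pairing_eta 0 (Num.sqrt (1 + dot a a)) (Y q) a; rewrite mul0r oppr0 add0r rmorph0.
Qed.

Lemma wang_yau_densityE (a : 'rV[R]_3) p :
  wang_yau_density F e3 e4 X f3 f4 (observer_of a) p =
  reduced_density (k0 p) (norm_H F p) (Num.sqrt (1 + dot a a)) (dot (nu p) a)
  - dot a (conn_vector_R3 F e3 e4 X p).
Proof.
rewrite /wang_yau_density.
have -> : (fun q => - mink (X q) (observer_of a)) = (fun q => - dot (Y q) a).
  by apply/funext => q; exact: height_mink.
have -> := norm_H_X Xs Xspace nus gX gpos nu_unit nu_normal k0_gt0 p.
have -> := gradient_height_norm Ys gE gpos nu_unit nu_normal p a.
have -> := laplacian_height Ys nus gE gpos nu_unit nu_normal p a.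
have -> := conn_form_X Xs Xspace nus gX gpos nu_unit nu_normal k0_gt0 frame p.
have -> : 1 + (dot a a - dot (nu p) a ^+ 2) =
    Num.sqrt (1 + dot a a) ^+ 2 - dot (nu p) a ^+ 2.
  by rewrite sqr_sqrtr ?addrA ?addr_ge0 ?dot_ge0.
rewrite subr0 /reduced_density.
(* As the gradient of tau is minus the tangential part of a, evaluating the connection form on it
   gives - a . V. *)
suff -> : conn_form F e3 e4 p (gradient (induced_metric F) (fun q => - dot (Y q) a) p) =
  - dot a (conn_vector_R3 F e3 e4 X p) by [].
have -> : conn_form F e3 e4 p (gradient (induced_metric F) (fun q => - dot (Y q) a) p) =
    dot (gradient g (fun q => - dot (Y q) a) p) (conn_covector F e3 e4 (chart_at p) p).
  exact: conn_formE.
rewrite (gradient_height g Ys) conn_vector_R3E dotNl; congr (- _).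
have ac := chart_at_atlas p; have cp := chart_at_dom p.
rewrite dotC dotE [RHS]dotC [RHS]dotE !trmx_mul trmxK.
rewrite (trmx_invmx (g_sym gE ac cp)).
by rewrite !mulmxA.
Qed.

End WangYauDensity.

(** * Inner products on R^n, and observers *)

Section CauchySchwarz.
Context {R : realType} (n : nat).
Implicit Types u v : 'rV[R]_n.

Lemma dot_linear u : linear (dot u).
Proof. by move=> k v w; rewrite dotDr dotZr. Qed.

HB.instance Definition _ u := GRing.isLinear.Build R 'rV[R]_n R *%R (dot u) (dot_linear u).

Lemma cauchy_schwarz u v : dot u v ^+ 2 <= dot u u * dot v v.
Proof.
have := dot_ge0 (dot v v *: u - dot u v *: v).
rewrite !(dotDl, dotDr, dotNl, dotNr, dotZl, dotZr) (dotC v u).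
have [v0 _|v0] := eqVneq (dot v v) 0.
  move/eqP: v0; rewrite dot_eq0 => /eqP ->; rewrite dotC dot0l; lra.
have vp : 0 < dot v v by rewrite lt_neqAle eq_sym v0 dot_ge0.
move=> h; rewrite -(ler_pM2l vp); nra.
Qed.

Lemma entry_le_norm u i : `|u 0 i| <= `|u|.
Proof.
rewrite {2}/Num.norm /= mx_normrE.
exact: (le_bigmax _ (fun ij : 'I_1 * 'I_n => `|u ij.1 ij.2|) (0, i)).
Qed.

(** The factor n compares the Euclidean norm with the maximum norm, which is the norm in which
    differentiability is defined. *)
Lemma dot_le_norm u : dot u u <= n%:R * `|u| ^+ 2.
Proof.
rewrite mulr_natl -[n in _ *+ n]card_ord -sumr_const; apply: ler_sum => i _.
rewrite -expr2 -(real_normK (num_real (u 0 i))).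
by rewrite lerXn2r ?nnegrE ?normr_ge0 // entry_le_norm.
Qed.

End CauchySchwarz.

Section Observers.
Context {R : realType}.
Implicit Types a v : 'rV[R]_3.

Definition lorentz_factor a : R := Num.sqrt (1 + dot a a).

Lemma lorentz_factor_sqr a : lorentz_factor a ^+ 2 = 1 + dot a a.
Proof. by rewrite sqr_sqrtr // addr_ge0 // dot_ge0. Qed.

Lemma lorentz_factor_ge1 a : 1 <= lorentz_factor a.
Proof. by rewrite -{1}sqrtr1 ler_sqrt ?lerDl ?dot_ge0 // addr_ge0 // dot_ge0. Qed.

Lemma lorentz_factor_gt0 a : 0 < lorentz_factor a.
Proof. exact: lt_le_trans ltr01 (lorentz_factor_ge1 a). Qed.

Lemma lorentz_factor_quotient a : dot a a / lorentz_factor a <= lorentz_factor a.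
Proof. by rewrite ler_pdivrMr ?lorentz_factor_gt0 // -expr2 lorentz_factor_sqr lerDr. Qed.

Lemma mink_row (s t : R) (u v : 'rV[R]_3) :
  mink (row_mx s%:M u) (row_mx t%:M v) = - (s * t) + dot u v.
Proof. exact: pairing_eta. Qed.

Lemma mink_observer_of (m : R) v a :
  - mink (observer_of a) (row_mx m%:M v) = lorentz_factor a * m - dot a v.
Proof. by rewrite mink_row opprD opprK. Qed.

Lemma row_mx_eta (T : 'rV[R]_(1 + 3)) : T = row_mx (T 0 0)%:M (rsubmx T).
Proof.
rewrite -[LHS]hsubmxK; congr row_mx; apply/matrixP => i j; rewrite !ord1 !mxE /=.
by rewrite mulr1n; congr (T _ _); apply: val_inj.
Qed.

(** An observer is determined by its spatial part, so the infimum over observers runs over all a in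
    R^3. *)
Lemma observerP (T : 'rV[R]_(1 + 3)) : observer T <-> exists a, T = observer_of a.
Proof.
split=> [[TT T0]|[a ->]].
  exists (rsubmx T); rewrite {1}(row_mx_eta T); congr (row_mx _%:M _).
  move: TT; rewrite [X in mink X](row_mx_eta T) [X in mink _ X](row_mx_eta T) mink_row => TT.
  rewrite -[LHS]gtr0_norm // -sqrtr_sqr; congr Num.sqrt; rewrite expr2; lra.
have A0 := lorentz_factor_gt0 a; split.
  by rewrite mink_row -expr2 lorentz_factor_sqr; lra.
have -> : (0 : 'I_(1 + 3)) = lshift 3 0 by exact: val_inj.
by rewrite row_mxEl mxE mulr1n.
Qed.

End Observers.

(** * Consequences of the two-sided bound on the energy *)

Section EnergyConsequences.
Context {R : realType}.
Variables (E : 'rV[R]_(1 + 3) -> R) (m C : R) (V : 'rV[R]_3).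
Hypothesis C_ge0 : 0 <= C.
Hypothesis E_ge : forall a, lorentz_factor a * m - dot a V <= E (observer_of a).
Hypothesis E_le : forall a, E (observer_of a) <=
  lorentz_factor a * m - dot a V + dot a a / lorentz_factor a * C.

Let W := row_mx m%:M V : 'rV[R]_(1 + 3).
Let w := Num.sqrt (- mink W W).
Let infE := ereal_inf [set (E T0)%:E | T0 in observer (R := R)].

Lemma infE_le a : (infE <= (E (observer_of a))%:E)%E.
Proof. by apply: ereal_inf_lbound; exists (observer_of a) => //; apply/observerP; exists a. Qed.

Lemma le_infE (x : R) : (forall a, x <= E (observer_of a)) -> (x%:E <= infE)%E.
Proof.
move=> xE; apply: le_ereal_inf_tmp => _ [T /observerP[a ->] <-].
by rewrite lee_fin.
Qed.

(** At a = 0 the lower and the upper bound coincide. *)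
Lemma E_rest : E (observer_of 0) = m.
Proof.
have A0 : lorentz_factor (0 : 'rV[R]_3) = 1 by rewrite /lorentz_factor dot0l addr0 sqrtr1.
have := E_ge 0; have := E_le 0; rewrite A0 !dot0l mul0r mul0r => h1 h2; lra.
Qed.

(** The observer W/w has Lorentz factor m/w and makes the lower bound equal to w; the error there is
    at most C m/w because |a|^2/A <= A. *)
Lemma timelike_bounds : future_vector W ->
  [/\ E (w^-1 *: W) <= w + C * (m / w),
      (infE <= (E (w^-1 *: W))%:E)%E & (w%:E <= infE)%E].
Proof.
move=> [WW W0].
have m0 : 0 < m.
  move: W0; rewrite (_ : (0 : 'I_(1 + 3)) = lshift 3 0); last exact: val_inj.
  by rewrite row_mxEl mxE mulr1n.
have w2 : w ^+ 2 = m ^+ 2 - dot V V.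
  by rewrite sqr_sqrtr ?oppr_ge0 ?(ltW WW) // mink_row opprD opprK expr2.
have w0 : 0 < w by rewrite sqrtr_gt0 oppr_gt0.
have fac : lorentz_factor (w^-1 *: V) = m / w.
  rewrite -[RHS]gtr0_norm ?divr_gt0 // -sqrtr_sqr; congr Num.sqrt.
  rewrite dotZl dotZr expr_div_n; apply: (mulIf (lt0r_neq0 (exprn_gt0 2 w0))).
  rewrite divfK ?gt_eqF ?exprn_gt0 // mulrDl mul1r {1}w2.
  have wn : w != 0 by rewrite gt_eqF.
  by rewrite mulrA -expr2 exprVn mulrAC mulVf ?expf_neq0 // mul1r subrK.
have TE : w^-1 *: W = observer_of (w^-1 *: V).
  rewrite /observer_of -/(lorentz_factor _) fac scale_row_mx; congr row_mx.
  by rewrite -mul_scalar_mx -scalar_mxM mulrC.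
split.
- rewrite TE; apply: le_trans (E_le _) _; apply: lerD.
    rewrite fac dotZl (_ : m / w * m - w^-1 * dot V V = (m ^+ 2 - dot V V) / w); last by ring.
    by rewrite -w2 expr2 mulfK ?gt_eqF.
  rewrite -fac mulrC; apply: ler_wpM2l => //; exact: lorentz_factor_quotient.
- by rewrite TE; exact: infE_le.
- apply: le_infE => a; apply: le_trans (E_ge a).
  have A1 := lorentz_factor_ge1 a; have A2 := lorentz_factor_sqr a.
  have := cauchy_schwarz a V.
  move: (lorentz_factor a) A1 A2 => A A1 A2 cs.
  have mw : w <= m by rewrite -(@ler_pXn2r _ 2) ?nnegrE ?(ltW w0) ?(ltW m0) // w2 lerBlDr lerDl dot_ge0.
  have wA : w <= A * m by nra.
  (* The reversed Cauchy-Schwarz inequality: with |a|^2 = A^2 - 1 and |V|^2 = m^2 - w^2 one has (A m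
     - w)^2 - |a|^2 |V|^2 = (A w - m)^2. Square roots may be taken since w <= A m. *)
  have h : dot a V ^+ 2 <= (A * m - w) ^+ 2.
    apply: le_trans cs _.
    have -> : dot a a = A ^+ 2 - 1 by rewrite A2 addrC addKr.
    have -> : dot V V = m ^+ 2 - w ^+ 2 by rewrite w2 subKr.
    by have := sqr_ge0 (A * w - m); nra.
  have : `|dot a V| <= A * m - w.
    by rewrite -(@ler_pXn2r _ 2) ?nnegrE ?subr_ge0 // real_normK ?num_real.
  by move/(le_trans (ler_norm _)); lra.
Qed.

(** Since A - 1 <= |a|^2 and |a|^2/A <= |a|^2, the bounds give |E - m + V . a| <= |a|^2 (|m| + C), a
    quadratic remainder. *)
Lemma energy_differential : differentiable (E \o @observer_of R) 0 /\
  forall v : 'rV[R]_3, 'd (E \o @observer_of R) 0 v = dot (- V) v.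
Proof.
suff [dE E'] : differentiable (E \o @observer_of R) 0 /\ 'd (E \o @observer_of R) 0 = dot (- V) :> (_ -> _).
  by split=> // v; rewrite E'.
apply: diff_eps.
  by move=> v; apply: (continuous_dot (u := fun=> - V) (v := id)); [exact: cst_continuous|exact: cvg_id].
(* The 3 is the dimension, from the comparison of the Euclidean with the maximum norm; the radius e
   / (K + 1) stays meaningful when K = 0. *)
move=> e e0; pose K := 3 * (`|m| + C).
have K0 : 0 <= K by rewrite mulr_ge0 // addr_ge0.
apply/nbhs_norm0P; exists (e / (K + 1)) => [|h /= hlt]; first by rewrite /= divr_gt0 // ltr_wpDl.
have hK : K * `|h| <= e.
  move: hlt; rewrite ltr_pdivlMr ?ltr_wpDl // => hk; have := normr_ge0 h; nra.
rewrite addr0 /= E_rest dotNl.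
have hh : dot h h <= 3 * `|h| ^+ 2 := dot_le_norm h.
have := E_ge h; have := E_le h; rewrite (dotC h V).
have A1 := lorentz_factor_ge1 h; have A2 := lorentz_factor_sqr h.
have q : dot h h / lorentz_factor h <= dot h h.
  rewrite ler_pdivrMr ?lorentz_factor_gt0 //.
  by have := dot_ge0 h; nra.
have qC := ler_wpM2r C_ge0 q.
move=> ub lb.
have h0 := dot_ge0 h; have nh := normr_ge0 h.
have Am : `|(lorentz_factor h - 1) * m| <= dot h h * `|m|.
  rewrite normrM ler_wpM2r // ger0_norm ?subr_ge0 //.
  by move: (lorentz_factor h) A1 A2 => A A1 A2; nra.
have bd : `|E (observer_of h) - m - - dot V h| <= dot h h * (`|m| + C).
  move: Am; rewrite !ler_norml => /andP[l1 l2]; apply/andP; split; nra.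
apply: le_trans bd _.
apply: (@le_trans _ _ (3 * `|h| ^+ 2 * (`|m| + C))).
  by rewrite ler_wpM2r // addr_ge0.
rewrite (_ : 3 * `|h| ^+ 2 * (`|m| + C) = K * `|h| * `|h|); last by rewrite /K; ring.
by rewrite ler_wpM2r.
Unshelve. all: by end_near.
Qed.

(** If V = 0, the sign of m makes the lower bound A m smallest at rest, where E equals m. If V is
    nonzero, a small boost along V brings E below m, because the gain is of first order and the cost
    of second. *)
Lemma momentum_eq0 : 0 <= m -> (V = 0 <-> infE = m%:E).
Proof.
move=> m0; split=> [V0|iE].
  apply/eqP; rewrite eq_le -{1}E_rest infE_le /=; apply: le_infE => a.
  apply: le_trans (E_ge a); rewrite V0 dotC dot0l subr0.
  by rewrite -{1}[m]mul1r ler_wpM2r // lorentz_factor_ge1.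
apply/eqP; rewrite -dot_eq0 eq_le dot_ge0 andbT leNgt; apply/negP => v0.
(* For a = t V with t = 1 / (m + C + 1) the upper bound gives E - m <= t |V|^2 (t (m + C) - 1),
   which is negative. *)
have t0 : 0 < m + C + 1 by rewrite ltr_wpDl // addr_ge0.
have := infE_le ((m + C + 1)^-1 *: V); rewrite iE lee_fin => h.
have := le_trans h (E_le _).
set a := _ *: V.
have A1 := lorentz_factor_ge1 a; have A2 := lorentz_factor_sqr a.
have h0 := dot_ge0 a.
have q : dot a a / lorentz_factor a <= dot a a.
  by rewrite ler_pdivrMr ?lorentz_factor_gt0 //; nra.
have qC := ler_wpM2r C_ge0 q.
have Am : (lorentz_factor a - 1) * m <= dot a a * m.
  rewrite ler_wpM2r //.
  by move: (lorentz_factor a) A1 A2 => A A1 A2; nra.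
have aa : dot a a = (m + C + 1)^-1 ^+ 2 * dot V V by rewrite dotZl dotZr mulrA expr2.
have aV : dot a V = (m + C + 1)^-1 * dot V V by rewrite dotZl.
move=> le1.
have : 0 <= dot a a * (m + C) - dot a V by lra.
rewrite aa aV expr2 (_ : _ - _ = (m + C + 1)^-1 * dot V V * ((m + C + 1)^-1 * (m + C) - 1)); last by ring.
rewrite leNgt => /negP; apply; rewrite pmulr_rlt0 ?mulr_gt0 ?invr_gt0 //.
by rewrite subr_lt0 mulrC ltr_pdivrMr // mul1r ltrDl.
Qed.

End EnergyConsequences.

(** * Integration of the pointwise bounds over the surface *)

Section EnergyOfSurface.
Context {R : realType} (S : manifold R 2) (g : metric_field S).
Variable mu : {measure set (borel S) -> \bar R}.
Hypothesis mu_area : area_measure g mu.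
Hypothesis gC : forall c, atlas c -> CkM 0 c (dom c) (g c).
Hypothesis gdet : forall c p, atlas c -> dom c p -> 0 < \det (g c p).
Hypothesis Scompact : compact [set: S].
Variables (k h : S -> R) (nu V : S -> 'rV[R]_3).
Hypotheses (kc : continuous k) (hc : continuous h) (nuc : continuous nu) (Vc : continuous V).
Hypotheses (k0 : forall p, 0 < k p) (h0 : forall p, 0 < h p).
Hypothesis nu_unit : forall p, dot (nu p) (nu p) = 1.
Hypothesis nu_full : forall (p : S) (a : 'rV[R]_3), (\forall q \near p, dot (nu q) a = 0) -> a = 0.

Let A := @lorentz_factor R.
Let m := surface_mean mu (fun p => k p - h p).
Let mom : 'rV[R]_3 := \row_i surface_mean mu (fun p => V p 0 i).
Let density (a : 'rV[R]_3) p := reduced_density (k p) (h p) (A a) (dot (nu p) a).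
Let E a := surface_mean mu (fun p => density a p - dot a (V p)).
Let ratio p := `|k p ^+ 2 / h p ^+ 2 + k p / h p - 2|.
Let C := sup (range ratio) * surface_mean mu (fun p => `|k p - h p|).

Let cC (x : R) : continuous (fun _ : S => x). Proof. by move=> p; exact: cst_continuous. Qed.
Let cD (f1 f2 : S -> R) : continuous f1 -> continuous f2 -> continuous (fun p => f1 p + f2 p).
Proof. by move=> c1 c2 p; exact: (continuousD (c1 p) (c2 p)). Qed.
Let cN (f : S -> R) : continuous f -> continuous (fun p => - f p).
Proof. by move=> c p; exact: (continuousN (c p)). Qed.
Let cM (f1 f2 : S -> R) : continuous f1 -> continuous f2 -> continuous (fun p => f1 p * f2 p).
Proof. by move=> c1 c2 p; exact: (continuousM (c1 p) (c2 p)). Qed.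
Let cV (f : S -> R) : (forall p, f p != 0) -> continuous f -> continuous (fun p => (f p)^-1).
Proof. by move=> f0 c p; exact: (continuousV (f0 p) (c p)). Qed.
Let cA (f : S -> R) : continuous f -> continuous (fun p => `|f p|).
Proof.
by move=> c p; apply: (continuous_comp_fun (G := fun x : R => `|x|) (c p)); exact: norm_continuous.
Qed.
Let cX (f : S -> R) : continuous f -> continuous (fun p => f p ^+ 2).
Proof. by move=> c p; have := cM c c; exact. Qed.

Let meanD (f1 f2 : S -> R) : continuous f1 -> continuous f2 ->
  surface_mean mu (fun p => f1 p + f2 p) = surface_mean mu f1 + surface_mean mu f2.
Proof. exact: (surface_meanD mu_area gC gdet Scompact). Qed.
Let meanZ (x : R) (f : S -> R) : continuous f ->
  surface_mean mu (fun p => x * f p) = x * surface_mean mu f.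
Proof. exact: (surface_meanZ mu_area gC gdet Scompact). Qed.
Let mean0 : surface_mean mu (fun=> 0) = 0.
Proof.
rewrite -[RHS](mul0r (surface_mean mu k)) -(meanZ 0 kc).
by congr surface_mean; apply/funext => p; rewrite mul0r.
Qed.
Let meanN (f : S -> R) : continuous f -> surface_mean mu (fun p => - f p) = - surface_mean mu f.
Proof.
move=> fc; rewrite -mulN1r -(meanZ _ fc).
by congr surface_mean; apply/funext => p; rewrite mulN1r.
Qed.
Let le_mean (f1 f2 : S -> R) : continuous f1 -> continuous f2 -> (forall p, f1 p <= f2 p) ->
  surface_mean mu f1 <= surface_mean mu f2.
Proof. exact: (le_surface_mean mu_area gC gdet Scompact). Qed.

Let entry_c i : continuous (fun p => V p 0 i).
Proof.
move=> p; apply: (continuous_comp_fun (f := V) (G := fun w : 'rV[R]_3 => w 0 i)); first exact: Vc.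
exact: differentiable_continuous (differentiable_coord (V p) 0 i).
Qed.

Let kh_c : continuous (fun p => k p - h p) := cD kc (cN hc).

Let aV_c a : continuous (fun p => dot a (V p)).
Proof. by move=> p; apply: (continuous_dot (u := fun=> a) (v := V)); [exact: cst_continuous|exact: Vc]. Qed.

Let b_c a : continuous (fun p => dot (nu p) a).
Proof. by move=> p; apply: (continuous_dot (u := nu) (v := fun=> a)); [exact: nuc|exact: cst_continuous]. Qed.

Let b_sqr_le a p : dot (nu p) a ^+ 2 <= dot a a.
Proof. by have := cauchy_schwarz (nu p) a; rewrite nu_unit mul1r. Qed.

Let b_sqr_lt a p : dot (nu p) a ^+ 2 < A a ^+ 2.
Proof. by rewrite lorentz_factor_sqr (le_lt_trans (b_sqr_le a p)) // ltrDr. Qed.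

Let density_c a : continuous (density a).
Proof.
move=> p; apply: (reduced_density_continuous (k := k) (h := h) (b := fun q => dot (nu q) a)).
- exact: kc.
- exact: hc.
- exact: b_c.
- exact: k0.
- exact: h0.
- exact: b_sqr_lt.
Qed.

Let A0 := @lorentz_factor_gt0 R.

Let mean_dot a : surface_mean mu (fun p => dot a (V p)) = dot a mom.
Proof.
have hs (s : seq 'I_3) : surface_mean mu (fun p => \sum_(i <- s) a 0 i * V p 0 i) =
    \sum_(i <- s) a 0 i * surface_mean mu (fun p => V p 0 i).
  elim: s => [|i s IH].
    by rewrite big_nil -[RHS]mean0; congr surface_mean; apply/funext => p; rewrite big_nil.
  rewrite big_cons -IH -(meanZ _ (@entry_c i)) -(meanD (cM (@cC _) (@entry_c i))).
    by congr surface_mean; apply/funext => p; rewrite big_cons.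
  move=> p; apply: continuous_at_sum => j _.
  exact: (cM (f1 := fun=> a 0 j) (f2 := fun q => V q 0 j) (@cC _) (@entry_c j)).
by rewrite hs; apply: eq_bigr => i _; rewrite mxE.
Qed.

Let density_E a : E a = surface_mean mu (density a) - dot a mom.
Proof. by rewrite /E (meanD (@density_c a) (cN (@aV_c a))) (meanN (@aV_c a)) mean_dot. Qed.

Let AkB_c a : continuous (fun p => A a * (k p - h p)) := cM (@cC (A a)) kh_c.

Lemma energy_ge a : A a * m - dot a mom <= E a.
Proof.
rewrite density_E lerD2r -(meanZ _ kh_c); apply: (le_mean (@AkB_c a) (@density_c a)) => p.
exact: (reduced_density_ge (k0 p) (h0 p) (A0 a) (b_sqr_lt a p)).
Qed.

Let ratio_c : continuous ratio.
Proof.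
have hn p : h p != 0 by rewrite gt_eqF.
have hn2 p : h p ^+ 2 != 0 by rewrite expf_neq0.
apply: (cA (f := fun p => k p ^+ 2 / h p ^+ 2 + k p / h p - 2)).
apply: (cD (f1 := fun p => k p ^+ 2 / h p ^+ 2 + k p / h p)); last exact: cC.
apply: (cD (f1 := fun p => k p ^+ 2 / h p ^+ 2)); last exact: (cM kc (cV hn hc)).
exact: (cM (cX kc) (cV hn2 (cX hc))).
Qed.

(** The operator [sup] bounds a set only if that set is bounded above; here compactness and
    continuity ensure it. *)
Let ratio_sup p : ratio p <= sup (range ratio).
Proof.
have [M Mr] := continuous_bounded Scompact ratio_c.
apply: ub_le_sup; last by exists p.
by exists M => _ [q _ <-]; apply: le_trans (Mr q); exact: ler_norm.
Qed.

Lemma error_ge0 : 0 <= C.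
Proof.
apply: mulr_ge0; first by apply: le_trans (ratio_sup point); exact: normr_ge0.
by rewrite -mean0; apply: (le_mean (@cC 0) (cA kh_c)).
Qed.

(** The pointwise bound is integrated after b^2 has been enlarged to |a|^2, by Cauchy-Schwarz with
    the unit vector nu, and the ratio to its supremum, so that only | k - h | remains under the
    integral. *)
Lemma energy_le a : E a <= A a * m - dot a mom + dot a a / A a * C.
Proof.
rewrite density_E addrAC lerD2r -(meanZ _ kh_c) /C (mulrA (dot a a / A a)) -(meanZ _ (cA kh_c)).
rewrite -(meanD (@AkB_c a) (cM (@cC _) (cA kh_c))).
apply: (le_mean (@density_c a) (cD (@AkB_c a) (cM (@cC _) (cA kh_c)))) => p.
apply: le_trans (reduced_density_le (k0 p) (h0 p) (A0 a) (b_sqr_lt a p)) _.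
rewrite lerD2l mulrA; apply: ler_wpM2r => //.
have Ai : 0 <= (A a)^-1 by rewrite invr_ge0 ltW.
apply: ler_pM => //; [|by apply: ler_wpM2r|exact: ratio_sup].
by rewrite mulr_ge0 ?sqr_ge0.
Qed.

Lemma energy_eq a : E a = A a * m - dot a mom <-> a = 0 \/ forall p, h p = k p.
Proof.
rewrite density_E -(meanZ _ kh_c); split=> [/addIr Eq|cases]; last first.
  congr (surface_mean mu _ - _); apply/funext => p.
  apply/(reduced_density_eq (k0 p) (h0 p) (A0 a) (b_sqr_lt a p)).
  by case: cases => [->|hk]; [right; rewrite dotC dot0l|left].
have [hk|] := pselect (forall p, h p = k p); [by right|move=> /existsNP[p hkp]; left].
apply: (@nu_full p).
have fc : continuous (fun q => density a q - A a * (k q - h q)) := cD (@density_c a) (cN (@AkB_c a)).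
(* Equality of the integrals makes the mean of a continuous nonnegative function vanish; hence the
   pointwise inequality is an equality everywhere, and its equality case applies at each point near
   p. *)
have diff0 q : density a q - A a * (k q - h q) = 0.
  apply: (surface_mean_eq0 mu_area gC gdet Scompact fc) => [r|].
    by rewrite subr_ge0; exact: (reduced_density_ge (k0 r) (h0 r) (A0 a) (b_sqr_lt a r)).
  by rewrite (meanD (@density_c a) (cN (@AkB_c a))) (meanN (@AkB_c a)) Eq subrr.
have ne : \forall q \near p, k q - h q != 0.
  have nx : \forall x \near k p - h p, x != 0.
    apply: open_nbhs_nbhs; split; last by rewrite /= subr_eq0; apply/eqP => kh; apply: hkp.
    exact: open_neq.
  refine (@kh_c p _ nx).
move: ne; apply: filterS => q kh.
have [hk|//] := (reduced_density_eq (k0 q) (h0 q) (A0 a) (b_sqr_lt a q)).1 (subr0_eq (diff0 q)).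
by move: kh; rewrite hk subrr eqxx.
Qed.

End EnergyOfSurface.

Theorem theorem2p1 (R : realType) (N : spacetime R) (Sigma : manifold R 2)
  (F : Sigma -> N) (e3 e4 : field_along Sigma N)
  (X : Sigma -> minkowski_spacetime R) (f3 f4 : field_along Sigma (minkowski_spacetime R))
  (nu : Sigma -> 'rV[R]_3)
  (mu : {measure set (borel Sigma) -> \bar R})
  (Sigma_closed : compact [set: Sigma]) (Sigma_connected : connected [set: Sigma])
  (F_embedding : embedding F) (F_spacelike : spacelike F)
  (K_pos : forall p, 0 < gauss_curvature (induced_metric F) p)
  (H_spacelike : spacelike_mean_curvature F)
  (F_frame : adapted_frame F e3 e4)
  (X_embedding : embedding X)
  (X_isometric : forall c p, atlas c -> dom c p ->
    induced_metric X c p = induced_metric F c p)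
  (X_space : forall p, (X p : 'rV[R]_(1 + 3)) 0 0 = 0)
  (X_frame : adapted_frame X f3 f4)
  (nu_normal : outward_unit_normal (spatial X) nu)
  (mu_area : area_measure (induced_metric F) mu) :
  let E := wang_yau_energy mu F e3 e4 X f3 f4 in
  let m := liu_yau_mass mu F X nu in
  let V := momentum mu F e3 e4 X in
  let W := energy_momentum mu F e3 e4 X nu in
  let C := error_const mu F X in
  let w := Num.sqrt (- mink W W) in
  let infE := ereal_inf [set (E T0)%:E | T0 in observer (R := R)] in
  (* (i) *)
  (forall a : 'rV[R]_3,
    let T0 := observer_of a in
    let s := Num.sqrt (1 + dot a a) in
    [/\ - mink T0 W + C * s = s * (m + C) - dot a V,
        E T0 <= s * (m + C) - dot a V,
        s * m - dot a V <= E T0,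
        s * m - dot a V = - mink T0 W &
        (E T0 = - mink T0 W <->
           T0 = row_mx 1%:M 0 \/ forall p, norm_H F p = norm_H X p)]) /\
  ((forall p, norm_H F p = norm_H X p) ->
    forall a : 'rV[R]_3, E (observer_of a) = - dot a V) /\
  (* (ii) *)
  (future_vector W ->
    [/\ E (w^-1 *: W) <= w + C * (m / w),
        (infE <= (E (w^-1 *: W))%:E)%E &
        (w%:E <= infE)%E]) /\
  (* (iii) *)
  (differentiable (E \o @observer_of R) 0 /\
   forall v : 'rV[R]_3, 'd (E \o @observer_of R) 0 v = dot (- V) v) /\
  (0 <= m -> (V = 0 <-> infE = m%:E)).
Proof.
move=> E m V W C w infE.
have [Fs _ _] := F_embedding; have [Xs _ _] := X_embedding.
have e3s := e3_smooth F_frame; have e4s := e4_smooth F_frame.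
have nus k c : atlas c -> CkM k c (dom c) nu.
  by move=> ac; exact: (nu_smooth nu_normal ac k).
have nu1 := nu_unit nu_normal; have nun := Defs.nu_normal nu_normal.
have Ys k c : atlas c -> CkM k c (dom c) (spatial X) by move=> ac; exact: spatial_CkM.
have gE := g_gram Xs X_space X_isometric.
have k0 : forall p, 0 < euclidean_mean_curvature (induced_metric F) (spatial X) nu p.
  move=> p; apply: (mean_gt0 Ys nus gE F_spacelike nu1 nun) => // q.
  by have := nu_outward nu_normal q; apply: filterS => t [].
have h0 : forall p, 0 < norm_H F p by move=> p; exact: norm_H_gt0.
set k := euclidean_mean_curvature (induced_metric F) (spatial X) nu in k0.
have kE p : norm_H X p = k p.
  exact: (norm_H_X Xs X_space nus X_isometric F_spacelike nu1 nun k0).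
have kc : continuous k by exact: (mean_continuous Ys nus gE F_spacelike).
have hc : continuous (norm_H F).
  exact: (Cfun_continuous Fs (norm_H_Cfun Fs F_spacelike H_spacelike 0)).
have nuc : continuous nu by exact: (nu_continuous nus).
have Vc : continuous (conn_vector_R3 F e3 e4 X).
  exact: conn_vector_R3_continuous.
have gC c : atlas c -> CkM 0 c (dom c) (induced_metric F c) by exact: (g_CkM Ys gE 0).
have gdet c p : atlas c -> dom c p -> 0 < \det (induced_metric F c p).
  by move=> ac cp; apply: det_posdef2; exact: F_spacelike.
have full (p : Sigma) (a : 'rV[R]_3) : (\forall q \near p, dot (nu q) a = 0) -> a = 0.
  refine (normal_component_nonzero Ys nus gE F_spacelike nu1 nun (K_pos p)).
have EE a : E (observer_of a) = surface_mean mu (fun p =>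
    reduced_density (k p) (norm_H F p) (lorentz_factor a) (dot (nu p) a)
    - dot a (conn_vector_R3 F e3 e4 X p)).
  congr surface_mean; apply/funext => p.
  exact: (wang_yau_densityE e3 e4 F_spacelike Xs X_isometric X_space X_frame nus nu1 nun k0).
have CE : C = sup (range (fun p => `|k p ^+ 2 / norm_H F p ^+ 2 + k p / norm_H F p - 2|)) *
    surface_mean mu (fun p => `|k p - norm_H F p|).
  have kX : norm_H X = k by apply/funext => p; exact: kE.
  by rewrite /C /error_const kX.
have C0 : 0 <= C by rewrite CE; exact: (error_ge0 mu_area gC gdet).
have Ege a : lorentz_factor a * m - dot a V <= E (observer_of a).
  rewrite EE; exact: (energy_ge mu_area gC gdet).
have Ele a : E (observer_of a) <=
    lorentz_factor a * m - dot a V + dot a a / lorentz_factor a * C.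
  rewrite EE CE; exact: (energy_le mu_area gC gdet).
have Eeq a : E (observer_of a) = lorentz_factor a * m - dot a V <->
    a = 0 \/ forall p, norm_H F p = k p.
  rewrite EE; exact: (energy_eq mu_area gC gdet).
have hk : (forall p, norm_H F p = norm_H X p) <-> forall p, norm_H F p = k p.
  by split=> H p; have := H p; rewrite kE.
have TW a : - mink (observer_of a) W = lorentz_factor a * m - dot a V.
  exact: mink_observer_of.
split=> [a T0 s|].
  have sE : s = lorentz_factor a by [].
  have s0 := lorentz_factor_gt0 a.
  rewrite /T0 TW sE; split.
  - by ring.
  (* Here the error C |a|^2/A is weakened to C A. *)
  - apply: le_trans (Ele a) _; rewrite mulrDr addrAC lerD2r lerD2l.
    by apply: ler_wpM2r => //; exact: lorentz_factor_quotient.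
  - exact: Ege.
  - by [].
  - apply: iff_trans (Eeq a) _; split=> -[h|h].
    + left; rewrite h /observer_of dot0l addr0 sqrtr1 //.
    + by right; apply/hk.
    + left; move: h; rewrite /observer_of => /(congr1 (@rsubmx _ _ _ _)).
      by rewrite !row_mxKr.
    + by right; apply/hk.
split=> [/hk h a|].
  have -> : E (observer_of a) = lorentz_factor a * m - dot a V by apply/Eeq; right.
  suff -> : m = 0 by rewrite mulr0 sub0r.
  rewrite /m /liu_yau_mass /surface_mean.
  have -> : (fun p => euclidean_mean_curvature (induced_metric F) (spatial X) nu p - norm_H F p) = cst 0.
    by apply/funext => p; rewrite h subrr.
  by rewrite /Rintegral integral0 mulr0.
split; first exact: timelike_bounds.
split; first exact: (energy_differential C0).
exact: (momentum_eq0 C0 Ege Ele).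
Qed.
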